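(* Let $f\in C^1(\mathcal P_p)$ for some $p\in[1,\infty)\cup\{0\}$. Then there exist $C^1$ cylinder functions $f_n$, $n\in\mathbb N$, (with versions of their derivatives) such that $$f_n(\mu)\to f(\mu)\quad\text{and}\quad\frac{\partial f_n}{\partial\mu}(x,\mu)\to\frac{\partial f}{\partial\mu}(x,\mu)$$ for all $\mu\in\mathcal P_p$, $x\in\mathbb R^d$, and for every compact $K\subset\mathcal P_p$ there is a constant $c_K$ with $$|f_n(\mu)|\le c_K\quad\text{and}\quad\Big|\frac{\partial f_n}{\partial\mu}(x,\mu)\Big|\le c_K(1+|x|^p)$$ for all $\mu\in K$, $x\in\mathbb R^d$, $n\in\mathbb N$.
   Context: Fix $d\in\mathbb N$. $\mathcal P$ is the set of Borel probability measures on $\mathbb R^d$ (weak topology); for $p\in[1,\infty)$, $\mathcal P_p$ is the subset with finite $p$-th moment, with the Wasserstein-$p$ metric; $\mathcal P_0:=\mathcal P$; $|x|^0:=1$; $\mu(\varphi)=\int\varphi\,d\mu$. $C^1(\mathcal P_p)$ is the set of $f:\mathcal P_p\to\mathbb R$ for which there exists a continuous function $\frac{\partial f}{\partial\mu}:\mathbb R^d\times\mathcal P_p\to\mathbb R$ (a version of the derivative) such that for every compact $K\subset\mathcal P_p$ there is $c_K$ with $|\frac{\partial f}{\partial\mu}(x,\mu)|\le c_K(1+|x|^p)$ for all $x\in\mathbb R^d,\mu\in K$, and $f(\nu)-f(\mu)=\int_0^1\int_{\mathbb R^d}\frac{\partial f}{\partial\mu}(x,t\nu+(1-t)\mu)(\nu-\mu)(dx)\,dt$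 for all $\mu,\nu\in\mathcal P_p$. A $C^1$ cylinder function is $f(\mu)=\tilde f(\mu(\varphi_1),\dots,\mu(\varphi_n))$ with $n\in\mathbb N$, $\tilde f\in C^1(\mathbb R^n)$, $\varphi_i$ bounded continuous on $\mathbb R^d$; a version of its derivative is $\sum_i\partial_i\tilde f(\mu(\varphi_1),\dots,\mu(\varphi_n))\varphi_i(x)$. *)

(* Defs.v *)
From HB Require Import structures.
From mathcomp Require Import all_boot all_order all_algebra.
From mathcomp Require Import all_classical all_reals all_analysis.
Import Order.TTheory GRing.Theory Num.Theory.
Import numFieldNormedType.Exports.

Set Implicit Arguments.
Unset Strict Implicit.
Unset Printing Implicit Defensive.

Local Open Scope classical_set_scope.
Local Open Scope ring_scope.

(* R^d is represented by d.-tuple R with the product sigma-algebra of the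
   Borel sigma-algebras of R (= Borel sigma-algebra of R^d). *)
Definition Rd (R : realType) (d : nat) := d.-tuple R.

Section defs.
Variables (R : realType) (d : nat).

Local Notation Rd := (Rd R d).
Local Notation P := (probability Rd R).

Definition dist (x y : Rd) : R :=
  Num.sqrt (\sum_(i < d) (tnth x i - tnth y i) ^+ 2).
Definition enorm (x : Rd) : R := Num.sqrt (\sum_(i < d) (tnth x i) ^+ 2).

(* |x|^p, with the convention |x|^0 = 1 (powR 0 0 = 1) *)
Definition npow (p : R) (x : Rd) : R := enorm x `^ p.

Definition cont_Rd (g : Rd -> R) : Prop :=
  forall (x : Rd) (eps : R), 0 < eps ->
    exists2 del : R, 0 < del & forall y, dist y x < del -> `|g y - g x| < eps.

Definition bcont (g : Rd -> R) : Prop :=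
  cont_Rd g /\ exists M : R, forall x, `|g x| <= M.

Definition mint (mu : P) (g : Rd -> R) : R := Rintegral mu setT g.

(* P_p : finite p-th moment (for p = 0 this is all of P) *)
Definition Pp (p : R) : set P :=
  [set mu | (\int[mu]_x (npow p x)%:E < +oo)%E].

Definition coupling (mu nu : P) : set (probability (Rd * Rd)%type R) :=
  [set pi | forall A : set Rd, measurable A ->
      pi (A `*` setT) = mu A /\ pi (setT `*` A) = nu A].

Definition Wp (p : R) (mu nu : P) : R :=
  (fine (ereal_inf [set (\int[pi]_z ((dist z.1 z.2) `^ p)%:E)%E
                   | pi in coupling mu nu])) `^ (p^-1).

(* neighbourhoods of mu in P_p: weak topology for p = 0,
   W_p-metric topology for p >= 1 *)
Definition Pnbhd (p : R) (mu : P) (N : set P) : Prop :=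
  if p == 0 then
    exists (k : nat) (phi : 'I_k -> Rd -> R) (eps : R),
      [/\ forall i, bcont (phi i), 0 < eps &
        forall nu, Pp p nu ->
          (forall i, `|mint nu (phi i) - mint mu (phi i)| < eps) -> N nu]
  else
    exists2 eps : R, 0 < eps &
      forall nu, Pp p nu -> Wp p nu mu < eps -> N nu.

Definition Popen (p : R) (U : set P) : Prop :=
  U `<=` Pp p /\ forall mu, U mu -> Pnbhd p mu U.

Definition Pcompact (p : R) (K : set P) : Prop :=
  K `<=` Pp p /\
  forall (I : Type) (U : I -> set P), (forall i, Popen p (U i)) ->
    K `<=` \bigcup_i U i ->
    exists s : seq I, K `<=` \big[setU/set0]_(i <- s) U i.

Definition clamp01 (t : R) : R := Num.min 1 (Num.max 0 t).

Lemma clamp01_ge0 t : 0 <= clamp01 t.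
Proof.
rewrite /clamp01 le_min ler01 /= le_max lexx //.
Qed.

Lemma clamp01_le1 t : 0 <= 1 - clamp01 t.
Proof. by rewrite subr_ge0 /clamp01 ge_min lexx. Qed.

Definition pmix_fun (t : R) (nu mu : P) (A : set Rd) : \bar R :=
  measure_add (mscale (NngNum (clamp01_ge0 t)) nu)
              (mscale (NngNum (clamp01_le1 t)) mu) A.

Section pmix_inst.
Variables (t : R) (nu mu : P).
HB.instance Definition _ := Measure.copy (pmix_fun t nu mu)
  (measure_add (mscale (NngNum (clamp01_ge0 t)) nu)
               (mscale (NngNum (clamp01_le1 t)) mu)).
Lemma pmix_setT : pmix_fun t nu mu setT = 1%E.
Proof.
rewrite /pmix_fun measure_addE.
change ((clamp01 t)%:E * nu setT + (1 - clamp01 t)%:E * mu setT = 1)%E.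
rewrite !probability_setT -EFinD !mulr1.
by rewrite addrC subrK.
Qed.
HB.instance Definition _ :=
  Measure_isProbability.Build _ _ _ (pmix_fun t nu mu) pmix_setT.
End pmix_inst.

Definition pmix (t : R) (nu mu : P) : P := pmix_fun t nu mu.

Definition C1P (p : R) (f : P -> R) (Df : Rd -> P -> R) : Prop :=
  [/\
      (forall (x : Rd) (mu : P), Pp p mu -> forall eps : R, 0 < eps ->
         exists2 del : R, 0 < del & exists N, Pnbhd p mu N /\
           forall y nu, dist y x < del -> Pp p nu -> N nu ->
             `|Df y nu - Df x mu| < eps),
      (forall K, Pcompact p K -> exists c : R, forall x mu, K mu ->
         `|Df x mu| <= c * (1 + npow p x)) &
      (forall mu nu, Pp p mu -> Pp p nu ->
         ((f nu - f mu)%:E =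
          \int[lebesgue_measure]_(t in `[0%R, 1%R])
             (mint nu (Df ^~ (pmix t nu mu)) - mint mu (Df ^~ (pmix t nu mu)))%:E)%E)].

Definition pderiv (k : nat) (g : 'rV[R]_k -> R) (i : 'I_k) (y : 'rV[R]_k) : R :=
  'D_(delta_mx 0 i) g y.

Definition C1Rn (k : nat) (g : 'rV[R]_k -> R) : Prop :=
  forall i : 'I_k, (forall y, derivable g y (delta_mx 0 i)) /\
                   continuous (pderiv g i).

Definition cyl (k : nat) (g : 'rV[R]_k -> R) (phi : 'I_k -> Rd -> R) (mu : P) : R :=
  g (\row_i mint mu (phi i)).

Definition cylD (k : nat) (g : 'rV[R]_k -> R) (phi : 'I_k -> Rd -> R)
  (x : Rd) (mu : P) : R :=
  \sum_(i < k) pderiv g i (\row_j mint mu (phi j)) * phi i x.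

End defs.

(* Main.v *)
Require Import Defs.
From HB Require Import structures.
From mathcomp Require Import all_boot all_order all_algebra.
From mathcomp Require Import all_classical all_reals all_analysis.
From mathcomp Require Import measurable_realfun.
From mathcomp Require Import ring lra.
Import Order.TTheory GRing.Theory Num.Theory.
Import numFieldNormedType.Exports.

Set Implicit Arguments.
Unset Strict Implicit.
Unset Printing Implicit Defensive.

Local Open Scope classical_set_scope.
Local Open Scope ring_scope.

(* Let [T_n mu] be the finitely supported measure [sum_i mu(ph_i) delta_(pt_i)]
   given by a partition of unity [ph_i] of mesh [1/(n+1)] on the ball of radius
   [n].  Both [f (T_n mu)] and [Df (pt_i) (T_n mu)] are functions of the vector
   [(mu(ph_i))_i] of the simplex, and on the simplex [f] is approximated in C^1
   by a Bernstein polynomial [g_n].  The chain rule then makes the derivative of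
   the cylinder function close to [sum_i ph_i(x) Df (pt_i) (T_n mu)], which tends
   to [Df x mu] because [T_n mu] tends to [mu].

   All topological arguments use neighbourhoods defined by integrals of
   finitely many continuous test functions of growth at most [1 + |x|^p].  They
   are the weak neighbourhoods for [p = 0], and the [W_p] neighbourhoods for
   [p >= 1]: one inclusion integrates a pointwise estimate against an almost
   optimal coupling, the other one couples two measures cell by cell along the
   partition of unity.  These neighbourhoods have a countable base, so [Df] is
   locally bounded by [c (1 + |x|^p)]: otherwise the bound would fail on a
   compact set made of a convergent sequence and its limit. *)

(** * Euclidean space *)

(** The obstacle is that [f] lives on probability measures only, so [f (T_n mu)] is a function on
    the simplex, a set without interior: its values determine tangential derivatives but not the
    normal component of the gradient, which [Df] nevertheless prescribes. Bernstein polynomials fit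
    because they sample lattice points of the simplex only and are still defined on the whole space;
    the normal component is corrected by a term that vanishes on the simplex. No derivative of
    [f (T_n mu)] is taken: the formula for [f nu - f mu] enters as a mean value inequality, which
    needs no measurability in [t].

    The growth bound survives because [x] is only ever moved to points of norm at most [|x| + 1]:
    its cell is small, or it is the remainder and is sent to the origin. Tails are handled by a
    continuous truncation of [1 + |x|^p], itself a test function, so that a small tail at [mu]
    remains small at nearby measures. For [c_K], the levels beyond some index are bounded by
    covering [K], the finitely many others by compactness of the simplex. *)

Section euclidean.
Variables (R : realType) (d : nat).
Local Notation Rd := (Rd R d).
Implicit Types (x y z : Rd) (g h : Rd -> R).

(** Up to the factor [B], the defect of the inequality is the sum of the squares of
    [B * a i - C * b i]. For [B = 0] that factor cannot be cancelled, but then every [b i]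
    vanishes. *)
Lemma cauchy_schwarz_sum (I : finType) (a b : I -> R) :
  (\sum_i a i * b i) ^+ 2 <= (\sum_i a i ^+ 2) * (\sum_i b i ^+ 2).
Proof.
set A := \sum_i a i ^+ 2; set B := \sum_i b i ^+ 2; set C := \sum_i a i * b i.
have B0 : 0 <= B by apply: sumr_ge0 => i _; exact: sqr_ge0.
have key : 0 <= B * (A * B - C ^+ 2).
  have -> : B * (A * B - C ^+ 2) = \sum_i (B * a i - C * b i) ^+ 2.
    under eq_bigr do rewrite sqrrB !exprMn.
    rewrite big_split/= sumrB -!mulr_sumr.
    have -> : \sum_i B * a i * (C * b i) *+ 2 = B * C * C *+ 2.
      rewrite -[X in _ = (_ * X) *+ 2]/(\sum_i a i * b i) mulr_sumr -sumrMnl.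
      by apply: eq_bigr => i _; congr (_ *+ 2); ring.
    by rewrite -/A -/B; ring.
  by apply: sumr_ge0 => i _; exact: sqr_ge0.
have [B00|Bp] := eqVneq B 0; last first.
  by rewrite -subr_ge0 -(pmulr_rge0 _ (_ : 0 < B))// lt_def Bp.
have b0 i : b i = 0.
  apply/eqP; rewrite -sqrf_eq0; apply/eqP.
  by apply: (psumr_eq0P _ B00) => // j _; exact: sqr_ge0.
by rewrite /C big1 ?expr0n ?B00 ?mulr0// => i _; rewrite b0 mulr0.
Qed.

Lemma minkowski_sum (I : finType) (a b : I -> R) :
  Num.sqrt (\sum_i (a i + b i) ^+ 2) <=
  Num.sqrt (\sum_i a i ^+ 2) + Num.sqrt (\sum_i b i ^+ 2).
Proof.
have s0 (c : I -> R) : 0 <= \sum_i c i ^+ 2.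
  by apply: sumr_ge0 => i _; exact: sqr_ge0.
rewrite -(@ler_pXn2r _ 2%N)// ?nnegrE ?addr_ge0 ?sqrtr_ge0//.
rewrite sqrrD !sqr_sqrtr//.
under eq_bigr do rewrite sqrrD.
rewrite !big_split/= -mulr2n lerD2r lerD2l lerMn2r/=.
apply: le_trans (ler_norm _) _.
rewrite -(@ler_pXn2r _ 2%N)// ?nnegrE ?mulr_ge0 ?sqrtr_ge0//.
by rewrite exprMn !sqr_sqrtr// real_normK ?num_real// cauchy_schwarz_sum.
Qed.

Lemma dist_ge0 x y : 0 <= dist x y. Proof. exact: sqrtr_ge0. Qed.
Lemma enorm_ge0 x : 0 <= enorm x. Proof. exact: sqrtr_ge0. Qed.

Lemma distC x y : dist x y = dist y x.
Proof.
by congr Num.sqrt; apply: eq_bigr => i _; rewrite -sqrrN opprB.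
Qed.

Lemma distxx x : dist x x = 0.
Proof. by rewrite /dist big1 ?sqrtr0// => i _; rewrite subrr expr0n. Qed.

Lemma dist_triangle y x z : dist x z <= dist x y + dist y z.
Proof.
have := minkowski_sum (fun i => tnth x i - tnth y i) (fun i => tnth y i - tnth z i).
by under eq_bigr do rewrite addrA subrK.
Qed.

Definition zeroRd : Rd := [tuple 0 | i < d].

Lemma enormE x : enorm x = dist x zeroRd.
Proof. by congr Num.sqrt; apply: eq_bigr => i _; rewrite tnth_mktuple subr0. Qed.

Lemma enorm_zeroRd : enorm zeroRd = 0. Proof. by rewrite enormE distxx. Qed.

Lemma enorm_le x y : enorm x <= enorm y + dist x y.
Proof. by rewrite !enormE addrC dist_triangle. Qed.

Lemma dist_le_enorm x y : dist x y <= enorm x + enorm y.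
Proof. by rewrite !enormE (distC y) dist_triangle. Qed.

Lemma coord_le_dist x y i : `|tnth x i - tnth y i| <= dist x y.
Proof.
rewrite -sqrtr_sqr ler_wsqrtr// (bigD1 i)//= lerDl.
by apply: sumr_ge0 => j _; exact: sqr_ge0.
Qed.

Lemma coord_le_enorm x i : `|tnth x i| <= enorm x.
Proof. by rewrite enormE -[X in `|X|]subr0 -[X in _ - X](tnth_mktuple (fun=> 0 : R) i) coord_le_dist. Qed.

(** Dividing by [d.+1] rather than [d] covers [d = 0] and keeps the inequality strict after summing
    [d] terms. *)
Lemma dist_lt_coord (e : R) x y : 0 < e ->
  (forall i, `|tnth x i - tnth y i| < e / d.+1%:R) -> dist x y < e.
Proof.
move=> e0 h; rewrite -[ltRHS]ger0_norm ?(ltW e0)// -sqrtr_sqr ltr_sqrt ?exprn_gt0//.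
have d0 : 0 < d.+1%:R :> R by rewrite ltr0n.
apply: (@le_lt_trans _ _ (\sum_(i < d) (e ^+ 2 / d.+1%:R))).
  apply: ler_sum => i _; rewrite -[leLHS]real_normK ?num_real//.
  apply: (@le_trans _ _ ((e / d.+1%:R) ^+ 2)).
    by rewrite ler_pXn2r ?nnegrE// ?ltW// divr_gt0.
  rewrite exprMn ler_pM2l ?exprn_gt0// expr2 -[leRHS]mulr1.
  by rewrite ler_pM2l ?invr_gt0// invf_le1// ler1n.
rewrite sumr_const card_ord -mulrnAr gtr_pMr ?exprn_gt0//.
by rewrite -mulr_natl ltr_pdivrMr// mul1r ltr_nat.
Qed.

(** The neighbourhood filter of [dist]. It turns [cont_Rd] into convergence along a filter, so that
    the limit rules of the library give the algebra of continuous functions. *)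
Definition dnbhs x : set_system Rd :=
  [set A | exists2 del : R, 0 < del & forall y, dist y x < del -> A y].

Global Instance dnbhs_filter x : ProperFilter (dnbhs x).
Proof.
split.
  by case=> del d0 /(_ x); apply; rewrite distxx.
split.
- by exists 1.
- move=> A B [a a0 ha] [b b0 hb]; exists (Num.min a b).
    by rewrite lt_min a0.
  by move=> y; rewrite lt_min => /andP[/ha ? /hb ?].
- by move=> A B AB [a a0 ha]; exists a => // y /ha /AB.
Qed.

Lemma cont_RdP g : cont_Rd g <-> forall x, g @ dnbhs x --> g x.
Proof.
split=> [cg x|cg x e e0].
  apply/cvgrPdist_lt => e e0; have [del del0 h] := cg x _ e0.
  by exists del => // y /h; rewrite distrC.
have /cvgrPdist_lt/(_ _ e0)[del del0 h] := cg x.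
by exists del => // y /h; rewrite distrC.
Qed.

Lemma cont_cst (c : R) : cont_Rd (fun _ : Rd => c).
Proof. by apply/cont_RdP => x; exact: cvg_cst. Qed.

Lemma contD g h : cont_Rd g -> cont_Rd h -> cont_Rd (fun x => g x + h x).
Proof. by move=> /cont_RdP cg /cont_RdP ch; apply/cont_RdP => x; exact: cvgD. Qed.

Lemma contB g h : cont_Rd g -> cont_Rd h -> cont_Rd (fun x => g x - h x).
Proof. by move=> /cont_RdP cg /cont_RdP ch; apply/cont_RdP => x; exact: cvgB. Qed.

Lemma contM g h : cont_Rd g -> cont_Rd h -> cont_Rd (fun x => g x * h x).
Proof. by move=> /cont_RdP cg /cont_RdP ch; apply/cont_RdP => x; exact: cvgM. Qed.

Lemma cont_norm g : cont_Rd g -> cont_Rd (fun x => `|g x|).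
Proof. by move=> /cont_RdP cg; apply/cont_RdP => x; exact: cvg_norm. Qed.

Lemma cont_min g h : cont_Rd g -> cont_Rd h -> cont_Rd (fun x => Num.min (g x) (h x)).
Proof.
move=> /cont_RdP cg /cont_RdP ch; apply/cont_RdP => x.
under eq_fun do rewrite minr_absE; rewrite minr_absE; apply: cvgMl.
by apply: cvgB; [exact: cvgD|apply: cvg_norm; exact: cvgB].
Qed.

Lemma cont_max g h : cont_Rd g -> cont_Rd h -> cont_Rd (fun x => Num.max (g x) (h x)).
Proof.
move=> /cont_RdP cg /cont_RdP ch; apply/cont_RdP => x.
under eq_fun do rewrite maxr_absE; rewrite maxr_absE; apply: cvgMl.
by apply: cvgD; [exact: cvgD|apply: cvg_norm; exact: cvgB].
Qed.

Lemma cont_dist y : cont_Rd (fun x => dist x y).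
Proof.
move=> x e e0; exists e => // z zx; rewrite ltr_norml; apply/andP; split.
  rewrite ltrBrDr addrC ltrBlDr.
  by rewrite (le_lt_trans (dist_triangle z x y))// distC addrC ltrD2l.
by rewrite ltrBlDr (le_lt_trans (dist_triangle x z y))// ltrD2r.
Qed.

Lemma cont_enorm : cont_Rd (@enorm R d).
Proof.
rewrite (_ : @enorm R d = (fun x => dist x zeroRd)); first exact: cont_dist.
by apply/funext => x; rewrite enormE.
Qed.

(** Compactness of balls as an exchange of quantifiers: a condition eventually true around each
    point is eventually true on the whole ball at once. It is transported from cubes of row vectors,
    and is applied to the filters [\oo], [0^'+] and [tn p mu]. *)
Lemma ball_near_covering (I : Type) (F : set_system I) (P : I -> Rd -> Prop) (r : R) :
  Filter F ->
  (forall x, exists2 del : R, 0 < del &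
     \forall i \near F, forall y, dist y x < del -> P i y) ->
  \forall i \near F, forall x, enorm x <= r -> P i x.
Proof.
move=> FF h.
pose A (i : 'I_d) := `[- r, r]%classic : set R.
have /compact_near_coveringP cA : compact [set v : 'rV[R]_d | forall i, A i (v ord0 i)].
  by apply: rV_compact => i; exact: segment_compact.
pose tup (v : 'rV[R]_d) : Rd := [tuple v ord0 i | i < d].
have := cA I F (fun i v => P i (tup v)) FF.
have cov : forall v, [set v : 'rV[R]_d | forall i, A i (v ord0 i)] v ->
    \forall v' \near v & i \near F, P i (tup v').
  move=> v _; have [del del0 hd] := h (tup v).
  have dd0 : 0 < del / d.+1%:R by rewrite divr_gt0// ltr0n.
  exists (ball v (del / d.+1%:R), [set i | forall y, dist y (tup v) < del -> P i y]) => /=.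
    by split => //; exact: nbhsx_ballx.
  case=> v' i [/= bv hi]; apply: hi; apply: dist_lt_coord => // j.
  rewrite !tnth_mktuple distrC.
  exact: (bv.2 ord0 j).
move=> /(_ cov); apply: filterS => i hi x xr.
have -> : x = tup (\row_j tnth x j).
  by apply: eq_from_tnth => j; rewrite tnth_mktuple mxE.
apply: hi => j; rewrite /A /= mxE in_itv/= -ler_norml.
by rewrite (le_trans (coord_le_enorm _ _)).
Qed.

Lemma cont_unif g (r e : R) : cont_Rd g -> 0 < e ->
  exists2 del : R, 0 < del & forall x y, enorm x <= r -> dist y x < del ->
    `|g y - g x| < e.
Proof.
move=> cg e0.
have : \forall del \near (0:R)^'+, forall x, enorm x <= r ->
    forall y, dist y x < del -> `|g y - g x| < e.
  apply: (@ball_near_covering _ _ (fun del x => forall y, dist y x < del -> `|g y - g x| < e)) => x.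
  have e20 : 0 < e / 2 by rewrite divr_gt0.
  have [del del0 hd] := cg x _ e20.
  exists (del / 2); first by rewrite divr_gt0.
  near=> t => y yx z zy.
  have dz : dist z x < del.
    rewrite (le_lt_trans (dist_triangle y _ _))// [ltRHS]splitr ltrD//.
    by rewrite (lt_le_trans zy)//; near: t; apply: nbhs_right_le; rewrite divr_gt0.
  have dy : dist y x < del by rewrite (lt_le_trans yx)// ler_pdivrMr// ler_pMr// ler1n.
  have := hd _ dz; have := hd _ dy; rewrite distrC => h1 h2.
  by rewrite (le_lt_trans (ler_distD (g x) _ _))// [ltRHS]splitr ltrD.
move=> hn; have /filter_ex [del [hdel del0]] : \forall del \near (0:R)^'+,
   (forall x, enorm x <= r -> forall y, dist y x < del -> `|g y - g x| < e) /\ 0 < del.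
  by apply: filterI; [exact: hn|exact: nbhs_right_gt].
by exists del => // x y xr; exact: hdel.
Unshelve. all: by end_near. Qed.

Definition ratRd (q : d.-tuple rat) : Rd := [tuple ratr (tnth q i) | i < d].

Lemma ratRd_dense x (e : R) : 0 < e -> exists q, dist x (ratRd q) < e.
Proof.
move=> e0; have dd0 : 0 < e / d.+1%:R by rewrite divr_gt0// ltr0n.
have /choice[q hq] : forall i : 'I_d, exists q : rat, `|tnth x i - ratr q| < e / d.+1%:R.
  move=> i; have /rat_in_itvoo[q] : tnth x i - e / d.+1%:R < tnth x i + e / d.+1%:R.
    by rewrite ltrBlDr -addrA ltrDl addr_gt0.
  by rewrite in_itv/= => /andP[h1 h2]; exists q; rewrite distrC ltr_distl h1.
exists [tuple q i | i < d]; apply: dist_lt_coord => // i.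
by rewrite !tnth_mktuple.
Qed.

Definition denseRd (n : nat) : Rd :=
  if unpickle n is Some q then ratRd q else zeroRd.

Lemma denseRdP x (e : R) : 0 < e -> exists n, dist x (denseRd n) < e.
Proof.
by move=> /(ratRd_dense x)[q hq]; exists (pickle q); rewrite /denseRd pickleK.
Qed.

Lemma finite_net (r e : R) : 0 < e ->
  exists k, forall x, enorm x <= r -> exists2 i, (i < k)%N & dist x (denseRd i) < e.
Proof.
move=> e0; have e20 : 0 < e / 2 by rewrite divr_gt0.
have : \forall k \near \oo, forall x, enorm x <= r ->
    exists2 i, (i < k)%N & dist x (denseRd i) < e.
  apply: (@ball_near_covering _ _ (fun k x => exists2 i, (i < k)%N & dist x (denseRd i) < e)) => x.
  have [n hn] := denseRdP x e20; exists (e / 2) => //.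
  near=> k => y yx; exists n; first by near: k; exact: nbhs_infty_gt.
  by rewrite (le_lt_trans (dist_triangle x _ _))// [ltRHS]splitr ltrD.
by move=> [k _ hk]; exists k; apply: hk => /=.
Unshelve. all: by end_near. Qed.

(** The sigma-algebra on tuples comes from the coordinates, so the superlevel set [U] is written as
    a countable union of sets cut out by coordinates: the boxes contained in [U] with rational
    centre and radius [1 / m.+1]. *)
Lemma measurable_cont g : cont_Rd g -> measurable_fun setT g.
Proof.
move=> cg; apply: (measurability _ (@RGenOInfty.measurableE R)) => //.
move=> _ [_ [c ->] <-]; rewrite setTI.
pose box (qm : d.-tuple rat * nat) : set Rd :=
  \bigcap_(i in [set: 'I_d]) [set x | `|tnth x i - ratr (tnth qm.1 i)| < qm.2.+1%:R^-1].
pose U := g @^-1` `]c, +oo[%classic.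
rewrite -/U.
have -> : U = \bigcup_qm (if `[< box qm `<=` U >] then box qm else set0).
  apply/seteqP; split => [x Ux|x [qm _]]; last by case: asboolP => // h /h.
  have : 0 < g x - c by move: Ux; rewrite /U /= in_itv/= andbT subr_gt0.
  move=> /(cg x)[del del0 hdel].
  have dd0 : 0 < del / d.+1%:R by rewrite divr_gt0// ltr0n.
  have [m hm] : exists m, 2 * m.+1%:R^-1 < del / d.+1%:R.
    have dd2 : 0 < del / d.+1%:R / 2 by rewrite divr_gt0.
    have /cvgrPdist_lt/(_ _ dd2)[m _ hm] := @cvg_harmonic R.
    exists m; have := hm m (leqnn _) => /=; rewrite sub0r normrN gtr0_norm ?invr_gt0//.
    by rewrite ltr_pdivlMr// mulrC.
  have [q hq] := @ratRd_dense x m.+1%:R^-1 (ltac:(by rewrite invr_gt0)).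
  have xb : box (q, m) x.
    move=> i _ /=; apply: le_lt_trans hq.
    by rewrite -[ratr _](tnth_mktuple (fun i => ratr (tnth q i) : R)) coord_le_dist.
  exists (q, m) => //; case: asboolP => // nU; exfalso; apply: nU => y yb.
  have : dist y x < del.
    apply: dist_lt_coord => // i; apply: lt_trans hm.
    rewrite (le_lt_trans (ler_distD (ratr (tnth q i)) _ _))// mulr_natl mulr2n ltrD//.
      exact: yb.
    by rewrite distrC; exact: xb.
  move=> /hdel; rewrite /U /= in_itv/= andbT ltr_norml => /andP[].
  by rewrite opprB ltrBDr subrK.
apply: countable_bigcupT_measurable; first exact: countableP.
move=> qm; case: asboolP => // _.
rewrite /box; apply: fin_bigcap_measurable => // i _.
have -> : [set x : Rd | `|tnth x i - ratr (tnth qm.1 i)| < qm.2.+1%:R^-1] =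
  (fun x : Rd => tnth x i) @^-1` [set t : R | `|t - ratr (tnth qm.1 i)| < qm.2.+1%:R^-1] by [].
rewrite -[X in measurable X]setTI; apply: (measurable_tnth i) => //.
have -> : [set t : R | `|t - ratr (tnth qm.1 i)| < qm.2.+1%:R^-1] =
  `](ratr (tnth qm.1 i) - qm.2.+1%:R^-1), (ratr (tnth qm.1 i) + qm.2.+1%:R^-1)[%classic.
  by apply/seteqP; split=> t /=; rewrite in_itv/= ltr_distl.
exact: measurable_itv.
Qed.

Lemma measurable_dist : measurable_fun setT (fun z : Rd * Rd => dist z.1 z.2).
Proof.
apply: (measurableT_comp (f := @Num.sqrt R)).
  exact: continuous_measurable_fun (@sqrt_continuous R).
apply: measurable_sum => i; apply: (measurable_funX 2) => //.
apply: measurable_funB.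
- exact: (measurableT_comp (measurable_tnth i) measurable_fst).
- exact: (measurableT_comp (measurable_tnth i) measurable_snd).
Qed.

End euclidean.

(** * Test functions of polynomial growth *)

Section weight.
Variables (R : realType) (d : nat) (p : R).
Hypothesis hp : p = 0 \/ 1 <= p.
Local Notation Rd := (Rd R d).
Local Notation P := (probability Rd R).
Implicit Types (x y z : Rd) (g h phi : Rd -> R) (mu nu : P).

Lemma hp_ge0 : 0 <= p.
Proof. by case: hp => [->//|]; apply: le_trans. Qed.
Let p0 := hp_ge0.

Lemma npow_ge0 x : 0 <= npow p x. Proof. exact: powR_ge0. Qed.

Lemma powR_addr_le (a b : R) : 0 <= a -> 0 <= b ->
  (a + b) `^ p <= 2 `^ p * (a `^ p + b `^ p).
Proof.
move=> a0 b0; wlog ab : a b a0 b0 / a <= b.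
  by move=> h; case: (leP a b) => [|/ltW] ba; [exact: h|rewrite addrC (addrC (a `^ _)); exact: h].
apply: (@le_trans _ _ ((2 * b) `^ p)).
  by apply: ge0_ler_powR; rewrite ?nnegrE ?addr_ge0 ?mulr_ge0// mulr_natl mulr2n lerD2r.
by rewrite powRM// ler_pM2l ?powR_gt0// lerDr powR_ge0.
Qed.

(** Differentiability of the power gives continuity at positive [a] only. At [a = 0] the inequality
    b^p <= b on ]0, 1], valid for [1 <= p], takes over. *)
Lemma powR_continuous_ge0 (a : R) : 1 <= p -> 0 <= a -> forall e : R, 0 < e ->
  exists2 del : R, 0 < del & forall b, 0 <= b -> `|b - a| < del -> `|b `^ p - a `^ p| < e.
Proof.
move=> p1; rewrite le_eqVlt => /predU1P[<- e e0|a0 e e0].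
  exists (Num.min 1 e); first by rewrite lt_min ltr01.
  move=> b; rewrite le_eqVlt => /predU1P[<-|b0]; first by rewrite !subrr normr0.
  rewrite powR0 ?subr0 ?gt_eqF ?(lt_le_trans ltr01)// !ger0_norm ?powR_ge0 ?(ltW b0)//.
  rewrite lt_min => /andP[b1 be]; apply: le_lt_trans be.
  by rewrite ge1r_powR// b0 ltW.
have : {for a, continuous (fun b : R => b `^ p)}.
  apply: differentiable_continuous; apply/derivable1_diffP.
  by apply: derivable_powR; rewrite in_itv/= a0.
move=> /cvgrPdist_lt/(_ _ e0)/nbhs_ballP[del del0 h].
by exists del => // b b0 ba; rewrite distrC; apply: h; rewrite /ball/= distrC.
Qed.

Lemma cont_npow : cont_Rd (@npow R d p).
Proof.
case: (hp) => [->|p1].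
  rewrite (_ : npow 0 = fun=> 1); first exact: cont_cst.
  by apply/funext => x; rewrite /npow powRr0.
move=> x e e0; have [del del0 h] := powR_continuous_ge0 p1 (enorm_ge0 x) e0.
have [del' del'0 h'] := @cont_enorm R d x _ del0.
by exists del' => // y /h'; apply: h; exact: enorm_ge0.
Qed.

Definition wt x : R := 1 + npow p x.

Lemma wt_ge1 x : 1 <= wt x. Proof. by rewrite lerDl npow_ge0. Qed.
Lemma wt_gt0 x : 0 < wt x. Proof. exact: lt_le_trans (wt_ge1 x). Qed.
Lemma cont_wt : cont_Rd wt. Proof. exact: contD (@cont_cst _ _ 1) cont_npow. Qed.

(** A displacement by at most 1 costs a constant factor. Through [ph_pt] this compares the weight at
    the discretization points with the weight at the original point, with the same constant at every
    level. *)
Lemma wt_shift x y : enorm y <= enorm x + 1 -> wt y <= 2 * 2 `^ p * wt x.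
Proof.
move=> yx.
have c1 : 1 <= 2 `^ p :> R by rewrite -[leLHS](powRr0 2) ler_powR// ler1n.
have : npow p y <= 2 `^ p * (npow p x + 1).
  rewrite (@le_trans _ _ ((enorm x + 1) `^ p))//.
    by apply: ge0_ler_powR; rewrite ?nnegrE ?addr_ge0 ?enorm_ge0.
  by rewrite (le_trans (powR_addr_le _ _)) ?enorm_ge0// powR1.
move=> h; have := npow_ge0 x; rewrite /wt; set a := npow p x in h *; set b := npow p y in h *.
by move: h c1; set c := 2 `^ p; nra.
Qed.

(** For [p = 0] the weight is the constant 2, and these are the bounded continuous functions. For
    [p >= 1] their integrals are still continuous for [Wp] ([Wp_mint]), and the unbounded ones
    detect moments that escape to infinity. *)
Definition adm phi := cont_Rd phi /\ exists C : R, forall x, `|phi x| <= C * wt x.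

Lemma admC phi : adm phi -> exists2 C : R, 0 < C & forall x, `|phi x| <= C * wt x.
Proof.
case=> _ [C hC]; exists (`|C| + 1); first by rewrite ltr_wpDl.
move=> x; rewrite (le_trans (hC x))// ler_pM2r ?wt_gt0//.
by rewrite (le_trans (ler_norm _))// lerDl.
Qed.

Lemma adm_cst (c : R) : adm (fun=> c).
Proof.
split; first exact: cont_cst.
by exists `|c| => x; rewrite ler_peMr// wt_ge1.
Qed.

Lemma adm_wt : adm wt.
Proof.
split; first exact: cont_wt.
by exists 1 => x; rewrite mul1r ger0_norm// ltW// wt_gt0.
Qed.

Lemma admD g h : adm g -> adm h -> adm (fun x => g x + h x).
Proof.
move=> [cg [C hC]] [ch [D hD]]; split; first exact: contD.
by exists (C + D) => x; rewrite (le_trans (ler_normD _ _))// mulrDl lerD.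
Qed.

Lemma admZ (c : R) g : adm g -> adm (fun x => c * g x).
Proof.
move=> [cg [C hC]]; split; first by apply: contM => //; exact: cont_cst.
by exists (`|c| * C) => x; rewrite normrM -mulrA ler_wpM2l.
Qed.

Lemma admB g h : adm g -> adm h -> adm (fun x => g x - h x).
Proof.
move=> ag /(admZ (-1)) ah; have := admD ag ah.
by under [X in adm X -> _]eq_fun do rewrite mulN1r.
Qed.

Lemma adm_norm g : adm g -> adm (fun x => `|g x|).
Proof.
move=> [cg [C hC]]; split; first exact: cont_norm.
by exists C => x; rewrite normr_id.
Qed.

Lemma adm_sum (I : Type) (r : seq I) (G : I -> Rd -> R) :
  (forall i, adm (G i)) -> adm (fun x => \sum_(i <- r) G i x).
Proof.
move=> cG; elim: r => [|i r ih].
  by under [X in adm X]eq_fun do rewrite big_nil; exact: adm_cst.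
by under [X in adm X]eq_fun do rewrite big_cons; exact: admD.
Qed.

Lemma adm_le g h : cont_Rd g -> adm h -> (forall x, `|g x| <= `|h x|) -> adm g.
Proof. by move=> cg [_ [C hC]] gh; split => //; exists C => x; rewrite (le_trans (gh x)). Qed.

Lemma bcont_adm g : bcont g -> adm g.
Proof.
move=> [cg [M hM]]; apply: (adm_le cg (adm_cst M)) => x.
by rewrite (le_trans (hM x))// ler_norm.
Qed.

Lemma integrable_le mu g : Pp p mu -> measurable_fun setT g ->
  (exists C : R, forall x, `|g x| <= C * wt x) -> mu.-integrable setT (EFin \o g).
Proof.
move=> mup mg [C hC].
have : mu.-integrable setT (EFin \o (fun x => C * wt x)).
  apply/integrableP; split.
    apply/measurable_EFinP; apply: measurable_funM => //.
    exact: measurable_cont cont_wt.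
  apply: (@le_lt_trans _ _ (\int[mu]_x ((`|C|)%:E + (`|C|)%:E * (npow p x)%:E))%E).
    apply: ge0_le_integral => //=.
    - apply/measurable_EFinP; apply: measurableT_comp => //.
      apply: measurable_funM => //; exact: measurable_cont cont_wt.
    - apply/measurable_EFinP; apply: measurable_funD => //.
      apply: measurable_funM => //; exact: measurable_cont cont_npow.
    - move=> x _; rewrite -EFinM -EFinD lee_fin normrM (ger0_norm (ltW (wt_gt0 x))).
      by rewrite mulrDr mulr1.
  rewrite ge0_integralD//=; last 2 first.
  - by move=> x _; rewrite mule_ge0// lee_fin npow_ge0.
  - apply/measurable_EFinP.
    apply: measurable_funM => //; exact: measurable_cont cont_npow.
  rewrite integral_cst//= probability_setT mule1 lte_add_pinfty ?ltry//.
  rewrite ge0_integralZl//=; last 2 first.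
  - apply/measurable_EFinP; exact: measurable_cont cont_npow.
  - by move=> x _; rewrite lee_fin npow_ge0.
  by rewrite lte_mul_pinfty.
apply: le_integrable => //; first exact/measurable_EFinP.
by move=> x _ /=; rewrite lee_fin (le_trans (hC x))// ler_norm.
Qed.

Lemma adm_integrable mu g : Pp p mu -> adm g -> mu.-integrable setT (EFin \o g).
Proof.
by move=> mup [cg hC]; apply: integrable_le => //; exact: measurable_cont.
Qed.

Section mint.
Variable mu : P.
Hypothesis mup : Pp p mu.
Let ai g := @adm_integrable mu g mup.

Lemma mintD g h : adm g -> adm h ->
  mint mu (fun x => g x + h x) = mint mu g + mint mu h.
Proof. by move=> ag ah; rewrite /mint RintegralD//; exact: ai. Qed.

Lemma mintB g h : adm g -> adm h ->
  mint mu (fun x => g x - h x) = mint mu g - mint mu h.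
Proof. by move=> ag ah; rewrite /mint RintegralB//; exact: ai. Qed.

Lemma mintZ (c : R) g : adm g -> mint mu (fun x => c * g x) = c * mint mu g.
Proof. by move=> ag; rewrite /mint RintegralZl//; exact: ai. Qed.

Lemma mint_cst (c : R) : mint mu (fun=> c) = c.
Proof.
transitivity (c * fine (mu setT)); first exact: Rintegral_cst.
by rewrite probability_setT mulr1.
Qed.

Lemma mint_le g h : adm g -> adm h -> (forall x, g x <= h x) -> mint mu g <= mint mu h.
Proof. by move=> ag ah gh; rewrite /mint le_Rintegral//; exact: ai. Qed.

Lemma mint_norm g : adm g -> `|mint mu g| <= mint mu (fun x => `|g x|).
Proof. by move=> ag; rewrite /mint le_normr_Rintegral//; exact: ai. Qed.

Lemma mint_norm_le g h : adm g -> adm h -> (forall x, `|g x| <= h x) ->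
  `|mint mu g| <= mint mu h.
Proof.
move=> ag ah gh; apply: (le_trans (mint_norm ag)).
by apply: mint_le => //; exact: adm_norm.
Qed.

Lemma mint_ge0 g : (forall x, 0 <= g x) -> 0 <= mint mu g.
Proof. by move=> g0; apply: Rintegral_ge0 => x _. Qed.

Lemma mint_sum (I : Type) (r : seq I) (G : I -> Rd -> R) : (forall i, adm (G i)) ->
  mint mu (fun x => \sum_(i <- r) G i x) = \sum_(i <- r) mint mu (G i).
Proof.
move=> aG; elim: r => [|i r ih].
  by under eq_fun do rewrite big_nil; rewrite mint_cst big_nil.
under eq_fun do rewrite big_cons.
by rewrite mintD ?ih ?big_cons//; exact: adm_sum.
Qed.

Lemma mintE g : adm g -> (mint mu g)%:E = (\int[mu]_x (g x)%:E)%E.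
Proof. by move=> ag; rewrite /mint /Rintegral fineK//; apply: integrable_fin_num => //; exact: ai. Qed.

End mint.

Definition cut (r : R) x : R := Num.min 1 (Num.max 0 (enorm x - r)).

Lemma cut_ge0 r x : 0 <= cut r x.
Proof. by rewrite /cut le_min ler01/= le_max lexx. Qed.
Lemma cut_le1 r x : cut r x <= 1.
Proof. by rewrite /cut ge_min lexx. Qed.
Lemma cut0 r x : enorm x <= r -> cut r x = 0.
Proof. by move=> xr; rewrite /cut max_l ?min_r// subr_le0. Qed.
Lemma cut1 r x : r + 1 <= enorm x -> cut r x = 1.
Proof.
move=> xr; rewrite /cut min_l// le_max; apply/orP; right.
by rewrite lerBrDl.
Qed.
Lemma cont_cut r : cont_Rd (cut r).
Proof.
apply: cont_min; first exact: cont_cst.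
apply: cont_max; first exact: cont_cst.
by apply: contB; [exact: cont_enorm|exact: cont_cst].
Qed.

(** The cutoff is continuous in order that [tail r] be admissible. A bound on its integral at [mu]
    then persists near [mu], which replaces any appeal to tightness or uniform integrability. *)
Definition tail (r : R) x : R := wt x * cut r x.

Lemma tail_ge0 r x : 0 <= tail r x.
Proof. by rewrite mulr_ge0 ?cut_ge0// ltW// wt_gt0. Qed.

Lemma tail_le r x : tail r x <= wt x.
Proof. by rewrite ler_piMr ?cut_le1// ltW// wt_gt0. Qed.

Lemma adm_tail r : adm (tail r).
Proof.
apply: (@adm_le _ wt); last 1 first.
- by move=> x; rewrite !ger0_norm ?tail_le ?tail_ge0// ltW// wt_gt0.
- by apply: contM; [exact: cont_wt|exact: cont_cut].
- exact: adm_wt.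
Qed.

Lemma tail_cvg0 mu : Pp p mu -> mint mu (tail n%:R) @[n --> \oo] --> (0 : R).
Proof.
move=> mup.
have := @dominated_convergence _ _ _ mu setT measurableT
  (fun n x => (tail n%:R x)%:E) (fun=> 0%E) (EFin \o wt).
case=> //.
- by move=> n; apply/measurable_EFinP; exact: measurable_cont (adm_tail _).1.
- apply: aeW => x _; apply: cvg_near_cst; near=> n.
  rewrite /tail cut0 ?mulr0//; near: n; exact: nbhs_infty_ger.
- exact: adm_integrable adm_wt.
- apply: aeW => x n _; rewrite lee_fin ger0_norm ?tail_ge0//; exact: tail_le.
move=> _ _; rewrite integral0 => /fine_cvgP[_]; apply: cvg_trans.
by apply: near_eq_cvg; apply: nearW => n.
Unshelve. all: by end_near. Qed.

Lemma tail_small mu (e : R) : Pp p mu -> 0 < e ->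
  exists n0, forall n, (n0 <= n)%N -> mint mu (tail n%:R) < e.
Proof.
move=> mup e0; have /cvgrPdist_lt/(_ _ e0)[n0 _ h] := tail_cvg0 mup.
exists n0 => n n0n; have := h n n0n.
by rewrite sub0r normrN ger0_norm// mint_ge0// => x; exact: tail_ge0.
Qed.

(* The topology of [P_p] tested on continuous functions of growth at most
   [1 + |x|^p]; [PnbhdP] identifies it with the one of the definitions. *)
Definition tn mu : set_system P := [set N | exists (k : nat) (phi : 'I_k -> Rd -> R) (eps : R),
  [/\ forall i, adm (phi i), 0 < eps &
   forall nu, Pp p nu -> (forall i, `|mint nu (phi i) - mint mu (phi i)| < eps) -> N nu]].

Global Instance tn_filter mu : Filter (tn mu).
Proof.
split.
- by exists 0%N, (fun=> fun=> 0), 1; split => // i; exact: adm_cst.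
- move=> A B [k [f [e [af e0 hA]]]] [k' [f' [e' [af' e'0 hB]]]].
  exists (k + k')%N, (fun i => match fintype.split i with inl j => f j | inr j => f' j end), (Num.min e e').
  split; [|by rewrite lt_min e0|].
    by move=> i; case: fintype.split.
  move=> nu nup h; split.
    apply: hA => // i; have := h (lshift k' i); rewrite (unsplitK (inl i : 'I_k + 'I_k')).
    by rewrite lt_min => /andP[].
  apply: hB => // i; have := h (rshift k i); rewrite (unsplitK (inr i : 'I_k + 'I_k')).
  by rewrite lt_min => /andP[].
- move=> A B AB [k [f [e [af e0 hA]]]]; exists k, f, e; split => // nu nup h.
  by apply: AB; exact: hA.
Qed.

Lemma tn_Pp mu : tn mu (Pp p).
Proof. by exists 0%N, (fun=> fun=> 0), 1; split => // i; exact: adm_cst. Qed.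

Lemma tn_mint mu phi (e : R) : adm phi -> 0 < e ->
  \forall nu \near tn mu, `|mint nu phi - mint mu phi| < e.
Proof.
move=> ap e0; exists 1%N, (fun=> phi), e; split => // nu _; apply; exact: ord0.
Qed.

Lemma tn_self mu N : Pp p mu -> tn mu N -> N mu.
Proof.
move=> mup [k [f [e [af e0 h]]]]; apply: h => // i.
by rewrite subrr normr0.
Qed.

(** Half of the tolerance is kept in reserve. This makes interiors open, as the open covers in
    [Pcompact] require. *)
Lemma tn_near mu N : tn mu N -> \forall nu \near tn mu, tn nu N.
Proof.
move=> [k [f [e [af e0 h]]]]; exists k, f, (e / 2); split => //; first by rewrite divr_gt0.
move=> nu _ hnu; exists k, f, (e / 2); split => //; first by rewrite divr_gt0.
move=> nu' nup hnu'; apply: h => // i.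
by rewrite (le_lt_trans (ler_distD (mint nu (f i)) _ _))// [ltRHS]splitr ltrD.
Qed.

End weight.

Arguments adm_wt {R d p} hp.
Arguments adm_tail {R d p} hp r.

(** * Mixtures and discrete measures *)

Section unit_integral.
Variable R : realType.
Local Open Scope ereal_scope.

(* No measurability is assumed: the integral of a nonnegative function is a
   supremum over simple functions, hence monotone for arbitrary functions. *)
Lemma le_ge0_integral d (T : measurableType d) (mu : {measure set T -> \bar R})
    (f g : T -> \bar R) :
  (forall x, 0 <= f x) -> (forall x, f x <= g x) ->
  \int[mu]_x f x <= \int[mu]_x g x.
Proof.
move=> f0 fg; rewrite !ge0_integralTE//; last first.
  by move=> x; exact: le_trans (fg x).
apply: ge_ereal_sup => _ [h /= hf <-]; apply: ereal_sup_ubound.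
by exists h => // x; exact: le_trans (fg x).
Qed.

(** The integrand of [C1P] is not known to be measurable in [t], so only monotonicity of nonnegative
    integrals is used: for [M >= 0] the positive part is at most [M]; for [M < 0] it vanishes and
    the negative part is at least [- M]. *)
Lemma unit_integral_le (r M : R) (f : R -> R) :
  r%:E = \int[lebesgue_measure]_(t in `[0%R, 1%R]) (f t)%:E ->
  (forall t, 0 <= t <= 1 -> f t <= M)%R -> (r <= M)%R.
Proof.
move=> rE fM.
pose F := (fun t => (f t)%:E) \_ `[0%R, 1%R].
have i01 : lebesgue_measure (`[0%R, 1%R]%classic : set R) = 1.
  by rewrite lebesgue_measure_itv/= lte_fin ltr01 oppr0 adde0.
have FE t : F t = if (0 <= t <= 1)%R then (f t)%:E else 0.
  rewrite /F patchE; case: ifPn => [|].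
    by rewrite inE/= in_itv/= => ->.
  by rewrite notin_setE/= in_itv/= => /negP/negbTE ->.
have cstE (c : R) : (0 <= c)%R ->
    \int[lebesgue_measure]_t (((fun=> c%:E) \_ (`[0%R, 1%R]%classic : set R)) t) = c%:E.
  by move=> c0; rewrite -integral_mkcond integral_cst//= i01 mule1.
have PE (c : R) t : ((fun=> c%:E) \_ (`[0%R, 1%R]%classic : set R)) t =
    if (0 <= t <= 1)%R then c%:E else 0.
  rewrite patchE; case: ifPn => [|].
    by rewrite inE/= in_itv/= => ->.
  by rewrite notin_setE/= in_itv/= => /negP/negbTE ->.
move: rE; rewrite integral_mkcond -/F integralE.
have [M0|M0] := leP 0%R M.
- move=> rE; rewrite -lee_fin rE.
  rewrite (@le_trans _ _ (\int[lebesgue_measure]_t F^\+ t))//.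
    by rewrite -[leRHS]adde0 leeD// oppe_le0 integral_ge0.
  rewrite -(cstE _ M0); apply: le_ge0_integral => // t.
  rewrite PE funeposE FE; case: ifPn => [/fM ft|_]; last by rewrite maxxx.
  by rewrite ge_max !lee_fin ft.
- move=> rE; rewrite -lee_fin rE.
  have -> : \int[lebesgue_measure]_t F^\+ t = 0.
    apply: integral0_eq => t _; rewrite funeposE FE.
    case: ifPn => [/fM ft|_]; last by rewrite maxxx.
    by apply/max_idPr; rewrite lee_fin (le_trans ft)// ltW.
  rewrite sub0e leeNl -EFinN -(cstE (- M)%R) ?oppr_ge0 ?(ltW M0)//.
  apply: le_ge0_integral => t.
    by rewrite PE; case: ifP => // _; rewrite lee_fin oppr_ge0 ltW.
  rewrite PE funenegE FE; case: ifPn => [/fM ft|_]; last by rewrite oppe0 maxxx.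
  by rewrite le_max -EFinN lee_fin lerN2 ft.
Qed.

Lemma unit_integral_norm_le (r a M : R) (f : R -> R) :
  r%:E = \int[lebesgue_measure]_(t in `[0%R, 1%R]) (f t)%:E ->
  (forall t, 0 <= t <= 1 -> `|f t - a| <= M)%R -> (`|r - a| <= M)%R.
Proof.
move=> rE fM; rewrite ler_distl; apply/andP; split.
  rewrite -lerN2; apply: (@unit_integral_le _ _ (fun t => - f t)%R).
    rewrite EFinN rE -integralN//.
    (* Negation passes through the integral unless both parts are infinite, which the finite value
       [r] excludes. *)
    have defB (x y : \bar R) : x - y \is a fin_num -> x +? - y by case: x => [?||]; case: y.
    by apply: defB; rewrite -integralE -rE.
  by move=> t /fM; rewrite lerN2 ler_distl => /andP[].
by apply: (unit_integral_le rE) => t /fM; rewrite ler_distl => /andP[].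
Qed.

End unit_integral.

Section prob_of.
Context d (T : measurableType d) (R : realType).
Variables (m : {measure set T -> \bar R}) (m1 : m setT = 1%E).

(** The proof of total mass 1 is an index of the term, which lets the probability structure be
    inferred from it. *)
Definition prob_of (_ : m setT = 1%E) : set T -> \bar R := m.

HB.instance Definition _ := Measure.copy (prob_of m1) m.
HB.instance Definition _ := Measure_isProbability.Build _ _ _ (prob_of m1) m1.

End prob_of.

Section discrete.
Variables (R : realType) (d : nat) (p : R).
Hypothesis hp : p = 0 \/ 1 <= p.
Local Notation Rd := (Rd R d).
Local Notation P := (probability Rd R).
Implicit Types (x : Rd) (phi : Rd -> R) (mu nu : P).

(** It suffices to know [kappa] on nonnegative functions: an admissible [phi] becomes nonnegative
    after adding [C * wt p x], whose integral is then subtracted. Mixtures and discrete measures are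
    both treated this way. *)
Lemma mint_combination k (c : 'I_k -> R) (m : 'I_k -> P) (kappa : P) :
  (forall j, 0 <= c j) -> (forall j, Pp p (m j)) ->
  (forall g : Rd -> R, measurable_fun setT g -> (forall x, 0 <= g x) ->
    (\int[kappa]_x (g x)%:E = \sum_j (c j)%:E * \int[m j]_x (g x)%:E)%E) ->
  Pp p kappa /\ forall phi, adm p phi -> mint kappa phi = \sum_j c j * mint (m j) phi.
Proof.
move=> c0 mp h.
have kp : Pp p kappa.
  rewrite /Pp/= h; [|exact: measurable_cont (cont_npow hp)|exact: npow_ge0].
  by apply: lte_sum_pinfty => j _; rewrite lte_mul_pinfty// ?lee_fin// mp.
split=> // phi ap.
have pos g : adm p g -> (forall x, 0 <= g x) -> mint kappa g = \sum_j c j * mint (m j) g.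
  move=> ag g0; apply: EFin_inj; rewrite (mintE hp)// h//; last exact: measurable_cont ag.1.
  rewrite -sumEFin; apply: eq_bigr => j _.
  by rewrite EFinM (mintE hp).
have [C C0 hC] := admC ap.
have aw : adm p (fun x : Rd => C * wt p x) := admZ C (adm_wt hp).
have ag := admD ap aw.
have E : phi = (fun x => (phi x + C * wt p x) - C * wt p x).
  by apply/funext => x; rewrite addrK.
rewrite {1}E (mintB hp)// !pos//.
- rewrite -sumrB; apply: eq_bigr => j _; rewrite -mulrBr; congr (_ * _).
  by rewrite -(mintB hp)// -E.
- by move=> x; rewrite mulr_ge0 ?ltW// wt_gt0.
- move=> x; have := hC x; rewrite ler_norml => /andP[+ _].
  by rewrite -lerBlDr sub0r.
Qed.

Lemma pmix_mint (t : R) mu nu : 0 <= t <= 1 -> Pp p mu -> Pp p nu ->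
  Pp p (pmix t nu mu) /\ forall phi, adm p phi ->
    mint (pmix t nu mu) phi = t * mint nu phi + (1 - t) * mint mu phi.
Proof.
move=> /andP[t0 t1] mup nup.
have ct : clamp01 t = t by rewrite /clamp01 max_r// min_r.
pose c (j : 'I_2) : R := if val j == 0%N then t else 1 - t.
pose m (j : 'I_2) : P := if val j == 0%N then nu else mu.
have [||g mg g0|pm h] := @mint_combination _ c m (pmix t nu mu).
- by move=> j; rewrite /c; case: ifP => // _; rewrite subr_ge0.
- by move=> j; rewrite /m; case: ifP.
- rewrite !big_ord_recl big_ord0 adde0 /c /m/=.
  transitivity (\int[measure_add (mscale (NngNum (clamp01_ge0 t)) nu)
              (mscale (NngNum (clamp01_le1 t)) mu)]_x (g x)%:E)%E.
    by apply: eq_measure_integral.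
  have mg' : measurable_fun setT (EFin \o g) by exact/measurable_EFinP.
  rewrite ge0_integral_measure_add//; last by move=> x _; rewrite lee_fin.
  rewrite !ge0_integral_mscale//; try by move=> x _; rewrite lee_fin.
  by rewrite /= ct.
split => // phi ap; rewrite h// !big_ord_recl big_ord0 addr0.
by rewrite /c /m.
Qed.

Lemma Pp_dirac x : Pp p (\d_x : P).
Proof.
rewrite /Pp/= integral_dirac//= ?diracT ?mul1e ?ltry//.
by apply/measurable_EFinP; exact: measurable_cont (cont_npow hp).
Qed.

Lemma mint_dirac x phi : cont_Rd phi -> mint (\d_x : P) phi = phi x.
Proof.
move=> cphi; rewrite /mint /Rintegral integral_dirac//=; last first.
  by apply/measurable_EFinP; exact: measurable_cont.
by rewrite indicE in_setT mul1r.
Qed.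

Definition simplex k : set 'rV[R]_k :=
  [set y | (forall i, 0 <= y 0 i) /\ \sum_i y 0 i = 1].

Lemma disc_exists k (x : 'I_k -> Rd) (y : 'rV[R]_k) : simplex y ->
  exists mu : P, Pp p mu /\
    forall phi, adm p phi -> mint mu phi = \sum_i y 0 i * phi (x i).
Proof.
move=> [y0 y1].
(* [msum] takes a family indexed by [nat]: indices outside ['I_k] get weight 0 at the origin. The
   absolute value supplies nonnegativity for all indices and changes nothing on the simplex. *)
have ay i : 0 <= `|oapp (fun j : 'I_k => y 0 j) 0 (insub i)| by [].
pose ms (i : nat) : {measure set Rd -> \bar R} :=
  mscale (NngNum (ay i)) (\d_(oapp x (zeroRd R d) (insub i))).
pose m : {measure set Rd -> \bar R} := msum ms k.
have m1 : m setT = 1%E.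
  rewrite /m/= /msum/= -[RHS]/((1 : R)%:E) -y1 -sumEFin; apply: eq_bigr => i _.
  rewrite /ms/= /mscale/= diracT mule1; congr EFin.
  by rewrite valK/= ger0_norm.
pose pm : P := prob_of m1.
exists pm.
have [||g mg g0|pmp h] := @mint_combination _ (fun i => y 0 i) (fun i => \d_(x i) : P) pm.
- exact: y0.
- by move=> j; exact: Pp_dirac.
- have mg' : measurable_fun setT (EFin \o g) by exact/measurable_EFinP.
  transitivity (\int[m]_x (g x)%:E)%E; first by apply: eq_measure_integral.
  rewrite /m ge0_integral_measure_sum//; last by move=> z _; rewrite lee_fin.
  apply: eq_bigr => i _; rewrite ge0_integral_mscale//; last by move=> z _; rewrite lee_fin.
  by rewrite /= valK/= ger0_norm.
split => // phi ap; rewrite h//; apply: eq_bigr => i _.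
by rewrite mint_dirac//; exact: ap.1.
Qed.

(** Off the simplex a Dirac mass is the default value, so that [disc] is a total function of the
    weight vector. *)
Definition disc k (x : 'I_k -> Rd) (y : 'rV[R]_k) : P :=
  if pselect (simplex y) is left h then sval (cid (disc_exists x h))
  else \d_(zeroRd R d).

Lemma discP k (x : 'I_k -> Rd) (y : 'rV[R]_k) : simplex y ->
  Pp p (disc x y) /\
    forall phi, adm p phi -> mint (disc x y) phi = \sum_i y 0 i * phi (x i).
Proof. by move=> hy; rewrite /disc; case: pselect => // h; case: cid. Qed.

End discrete.

(** * Discretization along a partition of unity *)

Lemma inv_nat_small (R : realType) (e : R) : 0 < e ->
  exists j0, forall j, (j0 <= j)%N -> j.+1%:R^-1 < e.
Proof.
move=> e0; have /cvgrPdist_lt/(_ _ e0)[j0 _ h] := @cvg_harmonic R.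
by exists j0 => j /h; rewrite /= sub0r normrN gtr0_norm.
Qed.

Section partition.
Variables (R : realType) (d : nat).
Local Notation Rd := (Rd R d).
Implicit Types (x : Rd) (phi : Rd -> R).

Definition chi (e : R) (i : nat) x : R :=
  Num.min 1 (Num.max 0 (2 - dist x (denseRd R d i) / e)).

Lemma chi_ge0 e i x : 0 <= chi e i x.
Proof. by rewrite le_min ler01/= le_max lexx. Qed.

Lemma chi_le1 e i x : chi e i x <= 1.
Proof. by rewrite ge_min lexx. Qed.

Lemma chi_eq1 e i x : 0 < e -> dist x (denseRd R d i) <= e -> chi e i x = 1.
Proof.
move=> e0 h; rewrite /chi min_l// le_max; apply/orP; right.
have : dist x (denseRd R d i) / e <= 1 by rewrite ler_pdivrMr// mul1r.
by set t := _ / _; lra.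
Qed.

Lemma chi_neq0 e i x : 0 < e -> chi e i x != 0 -> dist x (denseRd R d i) < 2 * e.
Proof.
move=> e0; rewrite ltNge; apply: contra; rewrite -ler_pdivlMr// => h; apply/eqP.
by rewrite /chi max_l ?min_r// subr_le0.
Qed.

Lemma cont_chi e i : cont_Rd (chi e i).
Proof.
apply: cont_min; first exact: cont_cst.
apply: cont_max; first exact: cont_cst.
apply: contB; first exact: cont_cst.
by apply: contM; [exact: cont_dist|exact: cont_cst].
Qed.

Fixpoint rest (e : R) (k : nat) x : R :=
  if k is k'.+1 then rest e k' x * (1 - chi e k' x) else 1.

Lemma rest_ge0 e k x : 0 <= rest e k x.
Proof. by elim: k => //= k ih; rewrite mulr_ge0// subr_ge0 chi_le1. Qed.

Lemma cont_rest e k : cont_Rd (rest e k).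
Proof.
elim: k => [|k ih]; first exact: cont_cst.
by apply: contM => //; apply: contB; [exact: cont_cst|exact: cont_chi].
Qed.

Lemma rest_eq0 e k i x : 0 < e -> (i < k)%N -> dist x (denseRd R d i) < e -> rest e k x = 0.
Proof.
move=> e0 + h; elim: k => // k ih; rewrite ltnS leq_eqVlt => /predU1P[ik|/ih/= ->]; last by rewrite mul0r.
by rewrite /= -ik chi_eq1 ?ltW// subrr mulr0.
Qed.

(* The products [rest] telescope, so no division is needed to get a sum of 1;
   the last function [rest e k] carries the complement of the net. *)
Definition pou (e : R) (k i : nat) x : R :=
  if (i < k)%N then chi e i x * rest e i x else rest e k x.

Lemma sum_pou e k x : \sum_(i < k.+1) pou e k i x = 1.
Proof.
rewrite big_ord_recr/= {2}/pou ltnn.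
under eq_bigr do rewrite /pou ltn_ord.
elim: k => [|k ih]; first by rewrite big_ord0 add0r.
by rewrite big_ord_recr/= -[RHS]ih; ring.
Qed.

(** The bumps [chi] vanish beyond distance [2 * rad n], which is the mesh [1 / n.+1]. *)
Definition rad (n : nat) : R := (2 * n.+1%:R)^-1.

Lemma rad_gt0 n : 0 < rad n. Proof. by rewrite invr_gt0 mulr_gt0. Qed.

Definition kn (n : nat) : nat := sval (cid (@finite_net R d n%:R _ (rad_gt0 n))).

Definition ph n (i : 'I_(kn n).+1) x : R := pou (rad n) (kn n) i x.

(** The last index carries what the net does not reach, at norm greater than [n]. Sending it to the
    origin keeps [ph_pt] true for that cell as well. *)
Definition pt n (i : 'I_(kn n).+1) : Rd := if (i < kn n)%N then denseRd R d i else zeroRd R d.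

Lemma ph_ge0 n i x : 0 <= @ph n i x.
Proof. by rewrite /ph /pou; case: ifP => _; rewrite ?mulr_ge0 ?chi_ge0 ?rest_ge0. Qed.

Lemma ph_sum n x : \sum_i @ph n i x = 1.
Proof. exact: sum_pou. Qed.

Lemma ph_le1 n i x : @ph n i x <= 1.
Proof.
by rewrite -(ph_sum n x) (bigD1 i)//= lerDl sumr_ge0// => j _; exact: ph_ge0.
Qed.

Lemma ph_bcont n i : bcont (@ph n i).
Proof.
split; last by exists 1 => x; rewrite ger0_norm ?ph_ge0 ?ph_le1.
rewrite /ph /pou; case: (i < kn n)%N; last exact: cont_rest.
by apply: contM; [exact: cont_chi|exact: cont_rest].
Qed.

Lemma ph_near n i x : @ph n i x != 0 -> (i < kn n)%N -> dist x (pt i) < n.+1%:R^-1.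
Proof.
rewrite /ph /pou /pt => + ik; rewrite ik mulf_eq0 negb_or => /andP[/chi_neq0 h _].
by rewrite (lt_le_trans (h (rad_gt0 n)))// /rad invfM mulrA divff// mul1r.
Qed.

Lemma ph_last n i x : @ph n i x != 0 -> (kn n <= i)%N -> n%:R < enorm x.
Proof.
rewrite /ph /pou => + ki; rewrite ltnNge ki/=; rewrite ltNge; apply: contra => xn; apply/eqP.
have [j jk hj] := svalP (cid (@finite_net R d n%:R _ (rad_gt0 n))) x xn.
by rewrite (rest_eq0 (rad_gt0 n) jk hj).
Qed.

Lemma ph_close n i x : @ph n i x != 0 -> enorm x <= n%:R -> dist x (pt i) < n.+1%:R^-1.
Proof.
move=> h xn; apply: ph_near => //; rewrite ltnNge; apply/negP => /(ph_last h).
by rewrite ltNge xn.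
Qed.

Lemma ph_pt n i x : @ph n i x != 0 -> enorm (pt i) <= enorm x + 1.
Proof.
move=> h; have [ik|ki] := ltnP i (kn n).
  rewrite (le_trans (enorm_le _ x))// lerD2l distC ltW// (lt_le_trans (ph_near h ik))//.
  by rewrite invf_le1// ler1n.
by rewrite /pt ltnNge ki/= enorm_zeroRd addr_ge0// enorm_ge0.
Qed.

(** An average over the cells sees only those that contain [x], and its bound does not depend on
    their number. *)
Lemma ph_avg_le n x (G : 'I_(kn n).+1 -> R) (M : R) :
  (forall i, @ph n i x != 0 -> G i <= M) -> \sum_i ph i x * G i <= M.
Proof.
move=> h; rewrite -[leRHS]mul1r -(ph_sum n x) mulr_suml; apply: ler_sum => i _.
have [->|/h] := eqVneq (ph i x) 0; first by rewrite !mul0r.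
by apply: ler_wpM2l; exact: ph_ge0.
Qed.

End partition.
Arguments kn {R} d n.
Arguments ph {R d n}.
Arguments pt {R d n}.

Section discretization.
Variables (R : realType) (d : nat) (p : R).
Hypothesis hp : p = 0 \/ 1 <= p.
Local Notation Rd := (Rd R d).
Local Notation P := (probability Rd R).
Local Notation kn := (@kn R d).
Implicit Types (x : Rd) (phi : Rd -> R) (mu nu : P).

Lemma adm_ph n (i : 'I_(kn n).+1) : adm p (ph i).
Proof. exact: bcont_adm (ph_bcont _). Qed.

Definition cf n mu : 'rV[R]_(kn n).+1 := \row_i mint mu (ph i).

Lemma cf_simplex n mu : Pp p mu -> simplex (cf n mu).
Proof.
move=> mup; split.
  by move=> i; rewrite mxE mint_ge0// => x; exact: ph_ge0.
under eq_bigr do rewrite mxE.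
rewrite -(mint_sum hp)//; last by move=> i; exact: adm_ph.
by under eq_fun do rewrite ph_sum; rewrite mint_cst.
Qed.

Definition Tn n mu : P := disc hp pt (cf n mu).

Lemma Tn_Pp n mu : Pp p mu -> Pp p (Tn n mu).
Proof. by move=> mup; have [] := discP hp pt (cf_simplex n mup). Qed.

(** The adjoint of [Tn]: convergence of the measures [Tn n mu] becomes a pointwise estimate on test
    functions, independent of [mu]. *)
Definition Tadj n phi x : R := \sum_(i < (kn n).+1) ph i x * phi (pt i).

Lemma adm_Tadj n phi : adm p (Tadj n phi).
Proof.
apply: adm_sum => i; under [X in adm _ X]eq_fun do rewrite mulrC.
exact: admZ (adm_ph i).
Qed.

Lemma mint_Tadj n mu phi : Pp p mu ->
  mint mu (Tadj n phi) = \sum_(i < (kn n).+1) mint mu (ph i) * phi (pt i).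
Proof.
move=> mup; rewrite /Tadj (mint_sum hp)//; last first.
  by move=> i; under [X in adm _ X]eq_fun do rewrite mulrC; exact: admZ (adm_ph i).
apply: eq_bigr => i _; under eq_fun do rewrite mulrC.
by rewrite (mintZ hp)//; [rewrite mulrC|exact: adm_ph].
Qed.

Lemma mint_Tn n mu phi : Pp p mu -> adm p phi ->
  mint (Tn n mu) phi = mint mu (Tadj n phi).
Proof.
move=> mup ap; have [_ ->//] := discP hp pt (cf_simplex n mup).
by rewrite mint_Tadj//; apply: eq_bigr => i _; rewrite mxE.
Qed.

(** Inside the ball of radius [r + 1] uniform continuity applies; outside, [tail] equals the full
    weight and absorbs the growth of both functions. [C] depends on [phi] alone, so [r] can be
    chosen afterwards to make [C] times the tail integral small. *)
Lemma Tadj_approx phi : adm p phi -> exists2 C : R, 0 < C &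
  forall (e : R) (r : nat), 0 < e -> exists n0, forall n, (n0 <= n)%N ->
    forall x, `|Tadj n phi x - phi x| <= e + C * tail p r%:R x.
Proof.
move=> ap; have [C C0 hC] := admC ap.
have K0 : 0 < 2 * 2 `^ p :> R by rewrite mulr_gt0// powR_gt0.
exists (C * (2 * 2 `^ p) + C); first by rewrite addr_gt0// mulr_gt0.
move=> e r e0; have [del del0 hdel] := cont_unif (r%:R + 1) ap.1 e0.
have [j0 hj0] := inv_nat_small del0.
(* From level [r.+1] on, the net covers the ball of radius [r + 1]. *)
exists (maxn j0 r.+1) => n; rewrite geq_max => /andP[j0n rn] x.
have [xr|/ltW xr] := leP (enorm x) (r%:R + 1).
  apply: (@le_trans _ _ e); last first.
    by rewrite lerDl mulr_ge0 ?tail_ge0// ltW// addr_gt0// mulr_gt0.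
  have -> : Tadj n phi x - phi x = \sum_(i < (kn n).+1) ph i x * (phi (pt i) - phi x).
    under [RHS]eq_bigr do rewrite mulrBr.
    by rewrite sumrB -mulr_suml ph_sum mul1r.
  apply: (le_trans (ler_norm_sum _ _ _)).
  under eq_bigr do rewrite normrM (ger0_norm (ph_ge0 _ _)).
  apply: ph_avg_le => i hi; apply/ltW/hdel => //.
  rewrite distC (lt_trans _ (hj0 _ j0n))// ph_close//.
  by rewrite (le_trans xr)// natr1 ler_nat.
rewrite /tail cut1// mulr1 -[leLHS]add0r lerD ?(ltW e0)// mulrDl.
apply: (le_trans (ler_normB _ _)); rewrite lerD//.
apply: (le_trans (ler_norm_sum _ _ _)).
under eq_bigr do rewrite normrM (ger0_norm (ph_ge0 _ _)).
apply: ph_avg_le => i /ph_pt hi.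
by rewrite (le_trans (hC _))// -mulrA ler_pM2l// wt_shift.
Qed.

Lemma Tn_cvg_mint mu phi (e : R) : Pp p mu -> adm p phi -> 0 < e ->
  exists n0, \forall nu \near tn p mu, forall n, (n0 <= n)%N ->
    `|mint (Tn n nu) phi - mint mu phi| < e.
Proof.
move=> mup ap e0; have [C C0 hC] := Tadj_approx ap.
(* The errors add up to less than [(2 + 2 * C) * eta], that is, [e / 2]. *)
pose eta := e / (2 * (2 + 2 * C)).
have eta0 : 0 < eta by rewrite divr_gt0// mulr_gt0// addr_gt0// mulr_gt0.
have [r hr] := tail_small hp mup eta0.
have [n0 hn0] := hC eta r eta0.
exists n0; near=> nu => n n0n.
have nup : Pp p nu by near: nu; exact: tn_Pp.
have nut : `|mint nu (tail p r%:R) - mint mu (tail p r%:R)| < eta.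
  by near: nu; apply: tn_mint => //; exact: adm_tail.
have nuphi : `|mint nu phi - mint mu phi| < eta by near: nu; exact: tn_mint.
rewrite mint_Tn//.
have h1 : `|mint nu (Tadj n phi) - mint nu phi| <= eta + C * mint nu (tail p r%:R).
  rewrite -(mintB hp)//; last exact: adm_Tadj.
  rewrite -(mintZ hp)//; last exact: adm_tail.
  rewrite -[X in _ <= X + _](mint_cst nu) -(mintD hp)//; last 2 first.
    exact: adm_cst.
    exact: admZ (adm_tail _ _).
  apply: (mint_norm_le hp) => //.
  - by apply: admB => //; exact: adm_Tadj.
  - by apply: admD; [exact: adm_cst|exact: admZ (adm_tail _ _)].
  - by move=> x; exact: hn0.
have h2 : mint nu (tail p r%:R) < 2 * eta.
  have := hr r (leqnn _); move: nut; rewrite ltr_norml => /andP[_]; lra.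
have h3 : C * mint nu (tail p r%:R) < C * (2 * eta) by rewrite ltr_pM2l.
have E : e = 2 * ((2 + 2 * C) * eta).
  rewrite /eta; field; rewrite gt_eqF// addr_gt0// mulr_gt0//.
apply: (le_lt_trans (ler_distD (mint nu phi) _ _)).
rewrite E; nra.
Unshelve. all: by end_near. Qed.


Lemma Tn_cvg mu N : Pp p mu -> tn p mu N ->
  exists n0, \forall nu \near tn p mu, forall n, (n0 <= n)%N -> N (Tn n nu).
Proof.
move=> mup [k [f [e [af e0 hN]]]].
have /choice[n0 hn0] := fun i => Tn_cvg_mint mup (af i) e0.
exists (\max_i n0 i)%N.
have h : \forall nu \near tn p mu, forall i n, (n0 i <= n)%N ->
    `|mint (Tn n nu) (f i) - mint mu (f i)| < e by exact: filter_forall hn0.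
near=> nu => n nn.
apply: hN; first by apply: Tn_Pp; near: nu; exact: tn_Pp.
move=> i; have : forall i n, (n0 i <= n)%N -> `|mint (Tn n nu) (f i) - mint mu (f i)| < e.
  by near: nu; exact: h.
by apply; rewrite (leq_trans _ nn)// leq_bigmax.
Unshelve. all: by end_near. Qed.

(** Integrals are affine along segments, so basic neighbourhoods are star-shaped around [mu]. *)
Lemma pmix_cvg mu N : Pp p mu -> tn p mu N ->
  \forall nu \near tn p mu, forall t : R, 0 <= t <= 1 -> N (pmix t nu mu).
Proof.
move=> mup [k [f [e [af e0 hN]]]]; exists k, f, e; split => // nu nup h t t01.
have [tp th] := pmix_mint hp t01 mup nup.
apply: hN => // i; rewrite th//.
have -> : t * mint nu (f i) + (1 - t) * mint mu (f i) - mint mu (f i) =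
  t * (mint nu (f i) - mint mu (f i)) by ring.
move: t01 => /andP[t0 t1].
rewrite normrM (ger0_norm t0) (le_lt_trans _ (h i))// ler_piMl//.
Qed.

(** The functions [ph] of all levels and the tails form a countable family that is rich enough:
    [Tadj n phi] is a finite combination of the [ph i] and differs from [phi] by a constant plus a
    multiple of one tail. *)
Lemma tn_countable mu : Pp p mu -> exists B : nat -> set P,
  (forall j, tn p mu (B j)) /\
  forall N, tn p mu N -> exists j0, forall j, (j0 <= j)%N -> forall nu, Pp p nu -> B j nu -> N nu.
Proof.
move=> mup.
pose B j : set P := [set nu | forall n : 'I_j.+1,
  (forall i : 'I_(kn n).+1, `|mint nu (ph i) - mint mu (ph i)| < j.+1%:R^-1) /\
  `|mint nu (tail p (n : nat)%:R) - mint mu (tail p (n : nat)%:R)| < j.+1%:R^-1].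
exists B; split.
  move=> j; apply: (@filter_forall _ _ (fun n : 'I_j.+1 => [set nu |
    (forall i : 'I_(kn n).+1, `|mint nu (ph i) - mint mu (ph i)| < j.+1%:R^-1) /\
    `|mint nu (tail p (n : nat)%:R) - mint mu (tail p (n : nat)%:R)| < j.+1%:R^-1]) (tn p mu) _) => n.
  apply: filterI.
    apply: (@filter_forall _ _ (fun i : 'I_(kn n).+1 =>
      [set nu | `|mint nu (ph i) - mint mu (ph i)| < j.+1%:R^-1]) (tn p mu) _) => i.
    by apply: tn_mint; [exact: adm_ph|rewrite invr_gt0].
  by apply: tn_mint; [exact: adm_tail|rewrite invr_gt0].
have key phi (e : R) : adm p phi -> 0 < e -> exists j0, forall j, (j0 <= j)%N ->
    forall nu, Pp p nu -> B j nu -> `|mint nu phi - mint mu phi| < e.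
  move=> ap e0; have [C C0 hC] := Tadj_approx ap.
  (* Replacing [phi] by [Tadj n phi] costs [(1 + 2 * C) * eta] at [nu] and [(1 + C) * eta] at [mu];
     comparing the two combinations costs another [eta]. *)
  pose eta := e / (2 * (3 + 3 * C)).
  have eta0 : 0 < eta by rewrite divr_gt0// mulr_gt0// addr_gt0// mulr_gt0.
  have [r hr] := tail_small hp mup eta0.
  have [n hn] := hC eta r eta0.
  pose S := 1 + \sum_(i < (kn n).+1) `|phi (pt i)|.
  have S0 : 0 < S by rewrite ltr_pwDl// sumr_ge0.
  have [j1 hj1] : exists j1, forall j, (j1 <= j)%N -> j.+1%:R^-1 < eta / S.
    by apply: inv_nat_small; rewrite divr_gt0.
  have [j2 hj2] := inv_nat_small eta0.
  exists (maxn (maxn j1 j2) (maxn n r)) => j.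
  rewrite !geq_max => /andP[/andP[j1j j2j] /andP[nj rj]] nu nup Bnu.
  have dev (m : P) : Pp p m ->
      `|mint m (Tadj n phi) - mint m phi| <= eta + C * mint m (tail p r%:R).
    move=> mp; rewrite -(mintB hp)//; last exact: adm_Tadj.
    rewrite -(mintZ hp)//; last exact: adm_tail.
    rewrite -[X in _ <= X + _](mint_cst m) -(mintD hp)//; last 2 first.
      exact: adm_cst.
      exact: admZ (adm_tail _ _).
    apply: (mint_norm_le hp) => //.
    - by apply: admB => //; exact: adm_Tadj.
    - by apply: admD; [exact: adm_cst|exact: admZ (adm_tail _ _)].
    - by move=> x; apply: hn.
  have d1 := dev _ nup; have d2 := dev _ mup.
  have t2 := hr r (leqnn _).
  have t1 : mint nu (tail p r%:R) < 2 * eta.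
    have [_ /=] := Bnu (Ordinal (rj : r < j.+1)%N).
    have jj := hj2 j j2j; rewrite ltr_norml => /andP[_ hh].
    move: hh jj t2; set a := mint nu _; set b := mint mu _; set c := _^-1 => hh jj t2.
    lra.
  have mid : `|mint nu (Tadj n phi) - mint mu (Tadj n phi)| < eta.
    rewrite !mint_Tadj// -sumrB.
    apply: (@le_lt_trans _ _ (\sum_(i < (kn n).+1) j.+1%:R^-1 * `|phi (pt i)|)).
      apply: (le_trans (ler_norm_sum _ _ _)); apply: ler_sum => i _.
      rewrite -mulrBl normrM ler_wpM2r// ltW//.
      by have [/(_ i)] := Bnu (Ordinal (nj : n < j.+1)%N).
    rewrite -mulr_sumr (@le_lt_trans _ _ (j.+1%:R^-1 * S))//.
      by rewrite ler_pM2l ?invr_gt0// lerDr.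
    by rewrite -ltr_pdivlMr// hj1.
  have h1 : C * mint nu (tail p r%:R) < C * (2 * eta) by rewrite ltr_pM2l.
  have h2 : C * mint mu (tail p r%:R) < C * eta by rewrite ltr_pM2l.
  have E : e = 2 * ((3 + 3 * C) * eta).
    rewrite /eta; field; rewrite gt_eqF// addr_gt0// mulr_gt0//.
  apply: (le_lt_trans (ler_distD (mint nu (Tadj n phi)) _ _)).
  rewrite distrC.
  apply: (@le_lt_trans _ _ ((eta + C * mint nu (tail p r%:R)) +
     (eta + (eta + C * mint mu (tail p r%:R))))).
    rewrite lerD// (le_trans (ler_distD (mint mu (Tadj n phi)) _ _))// lerD// ltW//.
  rewrite E; nra.
move=> N [k [f [e [af e0 hN]]]].
have /choice[j0 hj0] := fun i => key (f i) e (af i) e0.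
exists (\max_i j0 i)%N => j jj nu nup Bnu; apply: hN => // i.
by apply: (hj0 i j) => //; rewrite (leq_trans _ jj)// leq_bigmax.
Qed.

End discretization.

(** * Couplings and the Wasserstein topology *)

Section nonneg_integral.
Context d (T : measurableType d) (R : realType) (m : {measure set T -> \bar R}).
Implicit Types F G : T -> R.

Lemma ge0_integralZl_real F (b : R) : measurable_fun setT F -> (forall x, 0 <= F x) ->
  0 <= b -> (\int[m]_x (b * F x)%:E = b%:E * \int[m]_x (F x)%:E)%E.
Proof.
move=> mF F0 b0; under eq_integral do rewrite EFinM.
by apply: ge0_integralZl_EFin => //; [move=> x _; rewrite lee_fin|exact/measurable_EFinP].
Qed.

Lemma ge0_integralD_real F G : measurable_fun setT F -> (forall x, 0 <= F x) ->
  measurable_fun setT G -> (forall x, 0 <= G x) ->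
  (\int[m]_x (F x + G x)%:E = \int[m]_x (F x)%:E + \int[m]_x (G x)%:E)%E.
Proof.
move=> mF F0 mG G0; under eq_integral do rewrite EFinD.
apply: ge0_integralD => //; try exact/measurable_EFinP.
- by move=> x _; rewrite lee_fin.
- by move=> x _; rewrite lee_fin.
Qed.

Lemma ge0_integral_sum_real (I : Type) (r : seq I) (F : I -> T -> R) :
  (forall i, measurable_fun setT (F i)) -> (forall i x, 0 <= F i x) ->
  (\int[m]_x (\sum_(i <- r) F i x)%:E = \sum_(i <- r) \int[m]_x (F i x)%:E)%E.
Proof.
move=> mF F0; under eq_integral do rewrite -sumEFin.
apply: ge0_integral_sum => //; first by move=> i; exact/measurable_EFinP.
by move=> i x _; rewrite lee_fin.
Qed.

End nonneg_integral.

Section coupling.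
Variables (R : realType) (d : nat).
Local Notation Rd := (Rd R d).
Local Notation P := (probability Rd R).
Implicit Types (x : Rd) (phi : Rd -> R) (mu nu : P).

Lemma coupling_fst nu mu pi (g : Rd -> \bar R) : coupling nu mu pi ->
  measurable_fun setT g -> (forall x, 0 <= g x)%E ->
  (\int[pi]_z g z.1 = \int[nu]_x g x)%E.
Proof.
move=> cpi mg g0.
have := @ge0_integral_pushforward _ _ _ _ R _ (@measurable_fst _ _ Rd Rd) pi _ _ measurableT mg (fun x _ => g0 x).
rewrite preimage_setT => <-; apply: eq_measure_integral => // [A mA _].
transitivity (pi (A `*` setT)); last by have [] := cpi A mA.
rewrite /= /pushforward; congr (pi _).
by apply/seteqP; split=> z /=; [|case].
Qed.

Lemma coupling_snd nu mu pi (g : Rd -> \bar R) : coupling nu mu pi ->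
  measurable_fun setT g -> (forall x, 0 <= g x)%E ->
  (\int[pi]_z g z.2 = \int[mu]_x g x)%E.
Proof.
move=> cpi mg g0.
have := @ge0_integral_pushforward _ _ _ _ R _ (@measurable_snd _ _ Rd Rd) pi _ _ measurableT mg (fun x _ => g0 x).
rewrite preimage_setT => <-; apply: eq_measure_integral => // [A mA _].
transitivity (pi (setT `*` A)); last by have [] := cpi A mA.
rewrite /= /pushforward; congr (pi _).
by apply/seteqP; split=> z /=; [|case].
Qed.

Lemma product_coupling nu mu : coupling nu mu (nu \x mu : probability (Rd * Rd)%type R)%E.
Proof.
move=> A mA; split.
  etransitivity; first exact: (product_measure1E nu mu mA measurableT).
  transitivity (nu A * 1)%E; last exact: mule1.
  by congr (_ * _)%E; exact: probability_setT.
etransitivity; first exact: (product_measure1E nu mu measurableT mA).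
transitivity (1 * mu A)%E; last exact: mul1e.
by congr (_ * _)%E; exact: probability_setT.
Qed.

End coupling.

(** * Integrals of test functions are continuous for the Wasserstein metric *)

Section Wp.
Variables (R : realType) (d : nat) (p : R).
Hypothesis p1 : 1 <= p.
Local Notation Rd := (Rd R d).
Local Notation P := (probability Rd R).
Implicit Types (x : Rd) (phi : Rd -> R) (mu nu : P).
Let hp : p = 0 \/ 1 <= p := or_intror p1.
Let p0 : 0 < p := lt_le_trans ltr01 p1.

Lemma dist_powR_le x y : (dist x y) `^ p <= 2 `^ p * (npow p x + npow p y).
Proof.
rewrite (@le_trans _ _ ((enorm x + enorm y) `^ p))//.
  apply: ge0_ler_powR; rewrite ?nnegrE ?addr_ge0 ?enorm_ge0 ?dist_ge0 ?(ltW p0)//.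
  exact: dist_le_enorm.
by apply: (powR_addr_le hp); exact: enorm_ge0.
Qed.

Lemma npow_dist_le x y : npow p x <= 2 `^ p * (npow p y + (dist x y) `^ p).
Proof.
rewrite (@le_trans _ _ ((enorm y + dist x y) `^ p))//.
  apply: ge0_ler_powR; rewrite ?nnegrE ?addr_ge0 ?enorm_ge0 ?dist_ge0 ?(ltW p0)//.
  exact: enorm_le.
by apply: (powR_addr_le hp); [exact: enorm_ge0|exact: dist_ge0].
Qed.

Lemma measurable_dist_powR :
  measurable_fun setT (fun z : Rd * Rd => (dist z.1 z.2) `^ p).
Proof. exact: (measurableT_comp (measurable_powR p) (@measurable_dist R d)). Qed.

Definition cost (pi : probability (Rd * Rd)%type R) : \bar R :=
  (\int[pi]_z ((dist z.1 z.2) `^ p)%:E)%E.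

Lemma cost_ge0 pi : (0 <= cost pi)%E.
Proof. by apply: integral_ge0 => z _; rewrite lee_fin powR_ge0. Qed.

Lemma cost_fin nu mu pi : Pp p nu -> Pp p mu -> coupling nu mu pi -> (cost pi < +oo)%E.
Proof.
move=> nup mup cpi.
have mn : measurable_fun setT (@npow R d p) by exact: measurable_cont (cont_npow hp).
have mnE : measurable_fun setT (fun x : Rd => (npow p x)%:E) by exact/measurable_EFinP.
have n0 (x : Rd) : (0 <= (npow p x)%:E)%E by rewrite lee_fin npow_ge0.
apply: (@le_lt_trans _ _ (\int[pi]_z (2 `^ p * (npow p z.1 + npow p z.2))%:E)%E).
  apply: le_ge0_integral => z; first by rewrite lee_fin powR_ge0.
  by rewrite lee_fin dist_powR_le.
have m1 : measurable_fun setT (fun z : Rd * Rd => npow p z.1).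
  exact: (measurableT_comp mn measurable_fst).
have m2 : measurable_fun setT (fun z : Rd * Rd => npow p z.2).
  exact: (measurableT_comp mn measurable_snd).
rewrite ge0_integralZl_real ?powR_ge0//; last 2 first.
- exact: measurable_funD.
- by move=> z; rewrite addr_ge0 ?npow_ge0.
rewrite lte_mul_pinfty ?lee_fin ?powR_ge0//.
rewrite ge0_integralD_real//; try by move=> z; exact: npow_ge0.
by rewrite (coupling_fst cpi mnE n0) (coupling_snd cpi mnE n0) lte_add_pinfty.
Qed.

Lemma Wp_ltP nu mu (del : R) : Pp p nu -> Pp p mu -> 0 < del -> Wp p nu mu < del ->
  exists2 pi, coupling nu mu pi & (cost pi < (del `^ p)%:E)%E.
Proof.
move=> nup mup del0; rewrite /Wp.
set S := [set _ | _ in _]; set I := ereal_inf S => h.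
have I0 : (0 <= I)%E by apply: le_ereal_inf_tmp => _ [pi _ <-]; exact: cost_ge0.
(* Finiteness is essential: [fine] sends [+oo] to 0, and a small [Wp] would then say nothing about
   couplings. The product coupling provides it. *)
have Ioo : (I < +oo)%E.
  apply: le_lt_trans (cost_fin nup mup (product_coupling nu mu)).
  by apply: ereal_inf_lbound; exists (nu \x mu)%E => //; exact: product_coupling.
have If : I \is a fin_num by rewrite ge0_fin_numE.
have : (I < (del `^ p)%:E)%E.
  rewrite -(fineK If) lte_fin.
  have f0 : 0 <= fine I by exact: fine_ge0.
  have -> : fine I = (fine I `^ p^-1) `^ p.
    by rewrite -powRrM mulVf ?gt_eqF// powRr1.
  by apply: gt0_ltr_powR => //; rewrite nnegrE ?powR_ge0 ?ltW.
by move=> /ereal_inf_lt[_ [pi cpi <-] h']; exists pi.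
Qed.

Lemma Wp_lt nu mu pi (e : R) : 0 < e -> coupling nu mu pi ->
  (cost pi < (e `^ p)%:E)%E -> Wp p nu mu < e.
Proof.
move=> e0 cpi h; rewrite /Wp.
set S := [set _ | _ in _]; set I := ereal_inf S.
have I0 : (0 <= I)%E by apply: le_ereal_inf_tmp => _ [pi' _ <-]; exact: cost_ge0.
have Ic : (I < (e `^ p)%:E)%E.
  by apply: le_lt_trans h; apply: ereal_inf_lbound; exists pi.
have If : I \is a fin_num by rewrite ge0_fin_numE// (lt_trans Ic)// ltry.
have -> : e = (e `^ p) `^ p^-1 by rewrite -powRrM mulfV ?gt_eqF// powRr1// ltW.
apply: gt0_ltr_powR; rewrite ?invr_gt0// ?nnegrE ?powR_ge0 ?fine_ge0//.
by rewrite -lte_fin fineK.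
Qed.

Lemma coupling_diff nu mu pi phi (h : Rd * Rd -> R) (c : R) :
  Pp p nu -> Pp p mu -> coupling nu mu pi -> adm p phi ->
  (forall z, `|phi z.1 - phi z.2| <= h z) ->
  (\int[pi]_z (h z)%:E < c%:E)%E ->
  `|mint nu phi - mint mu phi| < c.
Proof.
move=> nup mup cpi ap hh hc.
have mphi : measurable_fun setT (EFin \o phi).
  by apply/measurable_EFinP; exact: measurable_cont ap.1.
have m1 : measurable_fun setT (fun z : Rd * Rd => (phi z.1)%:E).
  exact: (measurableT_comp mphi measurable_fst).
have m2 : measurable_fun setT (fun z : Rd * Rd => (phi z.2)%:E).
  exact: (measurableT_comp mphi measurable_snd).
have E1 : (\int[pi]_z (phi z.1)%:E = \int[nu]_x (phi x)%:E)%E.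
  rewrite integralE [RHS]integralE; congr (_ - _)%E.
  - transitivity (\int[pi]_z (EFin \o phi)^\+ z.1)%E; first by apply: eq_integral => z _; rewrite !funeposE.
    exact: (coupling_fst cpi (measurable_funepos mphi) (fun x => funepos_ge0 _ x)).
  - transitivity (\int[pi]_z (EFin \o phi)^\- z.1)%E; first by apply: eq_integral => z _; rewrite !funenegE.
    exact: (coupling_fst cpi (measurable_funeneg mphi) (fun x => funeneg_ge0 _ x)).
have E2 : (\int[pi]_z (phi z.2)%:E = \int[mu]_x (phi x)%:E)%E.
  rewrite integralE [RHS]integralE; congr (_ - _)%E.
  - transitivity (\int[pi]_z (EFin \o phi)^\+ z.2)%E; first by apply: eq_integral => z _; rewrite !funeposE.
    exact: (coupling_snd cpi (measurable_funepos mphi) (fun x => funepos_ge0 _ x)).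
  - transitivity (\int[pi]_z (EFin \o phi)^\- z.2)%E; first by apply: eq_integral => z _; rewrite !funenegE.
    exact: (coupling_snd cpi (measurable_funeneg mphi) (fun x => funeneg_ge0 _ x)).
have ma : measurable_fun setT (fun x => `|(phi x)%:E|%E) by exact: measurableT_comp.
have I1 : pi.-integrable setT (fun z => (phi z.1)%:E).
  apply/integrableP; split => //.
  rewrite (coupling_fst (g := fun x => `|(phi x)%:E|%E) cpi ma)//.
  by have /integrableP[_] := adm_integrable hp nup ap.
have I2 : pi.-integrable setT (fun z => (phi z.2)%:E).
  apply/integrableP; split => //.
  rewrite (coupling_snd (g := fun x => `|(phi x)%:E|%E) cpi ma)//.
  by have /integrableP[_] := adm_integrable hp mup ap.
rewrite -lte_fin; apply: le_lt_trans hc.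
have -> : (`|mint nu phi - mint mu phi|%:E = `| \int[pi]_z ((phi z.1)%:E - (phi z.2)%:E) |)%E.
  by rewrite integralB// E1 E2 -!(mintE hp)// -EFinB.
apply: (@le_trans _ _ (\int[pi]_z `|(phi z.1)%:E - (phi z.2)%:E|)%E).
  by apply: le_abse_integral => //; exact: emeasurable_funB.
apply: le_ge0_integral => z; first exact: abse_ge0.
by rewrite -EFinB lee_fin hh.
Qed.

(** For [y] in the ball, nearby points are covered by uniform continuity, and distant ones pay with
    [dist x y] to the power [p], bounded below there. For [y] outside, the tail pays. Only the tail
    of [y] appears: [y] will follow the fixed measure [mu], and the growth in [x] is bounded through
    [y] and the distance. *)
Lemma adm_osc phi : adm p phi -> exists2 C : R, 0 < C &
  forall (e : R) (r : nat), 0 < e -> exists2 K : R, 0 < K & forall x y,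
    `|phi x - phi y| <= e + K * (dist x y) `^ p + C * tail p r%:R y.
Proof.
move=> ap; have [C C0 hC] := admC ap.
set q := 2 `^ p; have q0 : 0 < q by rewrite powR_gt0.
have q1 : 1 <= q by rewrite -[leLHS](powRr0 2) ler_powR ?ler1n// ltW.
exists (C * (q + 1)); first by rewrite mulr_gt0// addr_gt0.
move=> e r e0; have [del del0 hdel] := cont_unif (r%:R + 1) ap.1 e0.
set b := (r%:R + 1) `^ p; have b0 : 0 <= b by rewrite powR_ge0.
(* Since [wt p x + wt p y] is at most [2 + (q + 1) * npow p y] plus [q] times the distance term, the
   first summand handles the part bounded on the ball, where the distance is at least [del], and the
   second the distance term. *)
set K1 := (2 + (q + 1) * b) / del `^ p + q.
have dp0 : 0 < del `^ p by rewrite powR_gt0.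
have K10 : 0 < K1.
  by rewrite addr_gt0// divr_gt0// ltr_wpDr// mulr_ge0// ltW// addr_gt0.
exists (C * K1); first by rewrite mulr_gt0.
move=> x y.
have D0 : 0 <= dist x y `^ p by rewrite powR_ge0.
have T0 := tail_ge0 p r%:R y.
have crude : `|phi x - phi y| <= C * (wt p x + wt p y).
  by rewrite (le_trans (ler_normB _ _))// mulrDr lerD.
have nx := npow_dist_le x y.
have ny0 := npow_ge0 p y.
have [yr|/ltW yr] := leP (enorm y) (r%:R + 1); last first.
  apply: (le_trans crude); rewrite /tail cut1// mulr1.
  have hK : q * dist x y `^ p <= K1 * dist x y `^ p.
    by rewrite ler_wpM2r// /K1 lerDr divr_ge0 ?(ltW dp0)// addr_ge0// mulr_ge0// addr_ge0// ltW.
  apply: (@le_trans _ _ (C * (K1 * dist x y `^ p + (q + 1) * wt p y))); last first.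
    by rewrite mulrDr !mulrA -addrA lerDr ltW.
  rewrite ler_pM2l//; move: nx hK; rewrite /wt -/q.
  set Dp := dist x y `^ p; set X := npow p x; set Y := npow p y in ny0 *.
  by move=> nx hK; nra.
have [xy|xy] := ltP (dist x y) del.
  apply: (@le_trans _ _ e).
    by apply/ltW/hdel.
  by rewrite -addrA lerDl addr_ge0// mulr_ge0// ltW// mulr_gt0// addr_gt0.
apply: (le_trans crude).
apply: (@le_trans _ _ (C * (K1 * dist x y `^ p))); last first.
  rewrite mulrA -[leLHS]addr0 lerD ?lerDr ?(ltW e0)//.
  by rewrite mulr_ge0// ltW// mulr_gt0// addr_gt0.
rewrite ler_pM2l//.
have dD : del `^ p <= dist x y `^ p.
  by apply: ge0_ler_powR; rewrite ?nnegrE ?dist_ge0 ?(ltW p0) ?(ltW del0).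
have yb : npow p y <= b.
  by apply: ge0_ler_powR; rewrite ?nnegrE ?enorm_ge0 ?addr_ge0 ?(ltW p0).
have : 2 + (q + 1) * b <= (2 + (q + 1) * b) / del `^ p * dist x y `^ p.
  rewrite -mulrA ler_peMr//; first by rewrite addr_ge0// mulr_ge0// addr_ge0// ltW.
  by rewrite mulrC ler_pdivlMr// mul1r.
have -> : K1 * dist x y `^ p =
    (2 + (q + 1) * b) / del `^ p * dist x y `^ p + q * dist x y `^ p by rewrite /K1 mulrDl.
move: nx; rewrite /wt -/q; set Dp := dist x y `^ p; set X := npow p x; set Y := npow p y in ny0 yb *.
set Z := _ / _ * Dp.
move=> nx hZ; nra.
Qed.

Lemma Wp_mint mu phi (e : R) : Pp p mu -> adm p phi -> 0 < e ->
  exists2 del : R, 0 < del & forall nu, Pp p nu -> Wp p nu mu < del ->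
    `|mint nu phi - mint mu phi| < e.
Proof.
move=> mup ap e0; have [C C0 hC] := adm_osc ap.
have e40 : 0 < e / 4 by rewrite divr_gt0.
have [r hr] := tail_small hp mup (divr_gt0 e40 C0).
have [K K0 hK] := hC _ r e40.
have eK : 0 < e / 4 / K by rewrite divr_gt0.
(* This radius makes the transport cost less than [e / 4 / K], so that each of the three terms of
   [adm_osc] integrates to at most [e / 4]. *)
exists ((e / 4 / K) `^ p^-1); first by rewrite powR_gt0.
move=> nu nup hW.
have [pi cpi] := Wp_ltP nup mup (powR_gt0 _ eK) hW.
rewrite -powRrM mulVf ?gt_eqF// powRr1 ?(ltW eK)// => hc.
apply: (coupling_diff nup mup cpi ap (fun z => hK z.1 z.2)).
have cf : cost pi \is a fin_num by rewrite ge0_fin_numE ?cost_ge0// (lt_trans hc)// ltry.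
have mt : measurable_fun setT (@tail R d p r%:R) by exact: measurable_cont (adm_tail hp _).1.
have mtE : measurable_fun setT (fun x : Rd => (tail p r%:R x)%:E) by exact/measurable_EFinP.
have mt2 : measurable_fun setT (fun z : Rd * Rd => tail p r%:R z.2).
  exact: (measurableT_comp mt measurable_snd).
have mD := measurable_dist_powR.
have t0 (x : Rd) : (0 <= (tail p r%:R x)%:E)%E by rewrite lee_fin tail_ge0.
have -> : (\int[pi]_z (e / 4 + K * dist z.1 z.2 `^ p + C * tail p r%:R z.2)%:E =
  (e / 4)%:E + K%:E * cost pi + C%:E * (mint mu (tail p r%:R))%:E)%E.
  have mKD : measurable_fun setT (fun z : Rd * Rd => K * dist z.1 z.2 `^ p).
    exact: measurable_funM.
  have mCt : measurable_fun setT (fun z : Rd * Rd => C * tail p r%:R z.2).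
    exact: measurable_funM.
  have KD0 (z : Rd * Rd) : 0 <= K * dist z.1 z.2 `^ p by rewrite mulr_ge0 ?powR_ge0// ltW.
  have Ct0 (z : Rd * Rd) : 0 <= C * tail p r%:R z.2 by rewrite mulr_ge0 ?tail_ge0// ltW.
  rewrite (ge0_integralD_real _ (F := fun z => e / 4 + K * dist z.1 z.2 `^ p))//; last 2 first.
  - exact: measurable_funD.
  - by move=> z; rewrite addr_ge0// ltW.
  rewrite (ge0_integralD_real _ (F := fun=> e / 4))//; last by move=> z; exact: ltW.
  rewrite integral_cst//= probability_setT mule1.
  rewrite !ge0_integralZl_real ?(ltW K0) ?(ltW C0)//; last 2 first.
  - by move=> z; exact: tail_ge0.
  - by move=> z; exact: powR_ge0.
  by rewrite (coupling_snd cpi mtE t0) (mintE hp)//; exact: adm_tail.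
rewrite -(fineK cf) -!EFinM -!EFinD lte_fin.
have c1 : K * fine (cost pi) < e / 4.
  by rewrite mulrC -ltr_pdivlMr// -lte_fin fineK.
have c2 : C * mint mu (tail p r%:R) < e / 4.
  by rewrite mulrC -ltr_pdivlMr// hr.
lra.
Qed.

End Wp.

Section density.
Context d (T : measurableType d) (R : realType) (m : {measure set T -> \bar R}).
Variables (w : T -> R) (mw : measurable_fun setT w) (w0 : forall x, 0 <= w x).

Definition mdens (_ : measurable_fun setT w) (_ : forall x, 0 <= w x) (A : set T) : \bar R :=
  (\int[m]_(x in A) (w x)%:E)%E.

Let mw' : measurable_fun setT (EFin \o w).
Proof. exact/measurable_EFinP. Qed.

Let mdens0 : mdens mw w0 set0 = 0%E.
Proof. by rewrite /mdens integral_set0. Qed.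

Let mdens_ge0 A : (0 <= mdens mw w0 A)%E.
Proof. by apply: integral_ge0 => x _; rewrite lee_fin. Qed.

Let mdens_sigma_additive : semi_sigma_additive (mdens mw w0).
Proof.
move=> F mF tF mUF; rewrite /mdens ge0_integral_bigcup//.
- apply: is_cvg_ereal_nneg_natsum_cond => n _ _; exact: mdens_ge0.
- exact: measurable_funTS.
- by move=> x _; rewrite lee_fin.
Qed.

HB.instance Definition _ := isMeasure.Build _ _ _ (mdens mw w0)
  mdens0 mdens_ge0 mdens_sigma_additive.

Import HBNNSimple.

(** Upper bounds are all that transport costs need. The inequality is checked for each simple
    function below [g], split along its values. *)
Lemma mdens_integral_le (g : T -> R) : measurable_fun setT g -> (forall x, 0 <= g x) ->
  (\int[mdens mw w0]_x (g x)%:E <= \int[m]_x (g x * w x)%:E)%E.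
Proof.
move=> mg g0; rewrite [leLHS]ge0_integralTE; last by move=> x; rewrite lee_fin.
apply: ge_ereal_sup => _ [h /= hg <-].
apply: (@le_trans _ _ (\int[m]_x (h x * w x)%:E)%E); last first.
  apply: le_ge0_integral => x; first by rewrite lee_fin mulr_ge0.
  by rewrite lee_fin ler_wpM2r// -lee_fin.
rewrite sintegralE.
have E x : (h x * w x)%:E = (\sum_(r \in range h) (r * (w x * \1_(h @^-1` [set r]) x))%:E)%E.
  rewrite fsumEFin//; congr EFin; rewrite [in LHS](fimfunE h) mulr_fsuml; apply: eq_fsbigr => r _.
  by rewrite [w x * _]mulrC mulrA.
under [leRHS]eq_integral do rewrite E.
rewrite ge0_integral_fsum//; last 2 first.
- move=> r; apply/measurable_EFinP; apply: measurable_funM => //.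
  by apply: measurable_funM => //; exact: measurable_indic.
- move=> r x _; rewrite lee_fin.
  rewrite indicE; case: (boolP (x \in _)) => [|_]; last by rewrite !mulr0.
  by rewrite inE/= => <-; rewrite mulr_ge0// mulr_ge0.
apply: lee_fsum => // r [x _ <-].
rewrite ge0_integralZl_real//; last 2 first.
- by apply: measurable_funM => //; exact: measurable_indic.
- by move=> y; rewrite mulr_ge0.
rewrite /= /mdens integral_mkcond; apply: lee_wpmul2l; first by rewrite lee_fin.
apply: le_ge0_integral => y.
  by rewrite patchE; case: ifP => // _; rewrite lee_fin.
by rewrite patchE indicE; case: ifP => _ /=; rewrite ?mulr1 ?mulr0.
Qed.

End density.

(** * Couplings with prescribed masses on products of cells *)

Section transport_plan.
Variables (R : realType) (d : nat).
Local Notation Rd := (Rd R d).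
Local Notation P := (probability Rd R).

Lemma product_integral (nu mu : P) (u v : Rd -> R) :
  measurable_fun setT u -> measurable_fun setT v ->
  (forall x, 0 <= u x) -> (forall x, 0 <= v x) ->
  (\int[nu \x mu]_z (u z.1 * v z.2)%:E = \int[nu]_x (u x)%:E * \int[mu]_x (v x)%:E)%E.
Proof.
move=> mu_ mv u0 v0.
have mv' : measurable_fun setT (fun x => (v x)%:E) by exact/measurable_EFinP.
have mu' : measurable_fun setT (fun x => (u x)%:E) by exact/measurable_EFinP.
rewrite fubini_tonelli1/=; last 2 first.
- apply/measurable_EFinP; apply: measurable_funM.
  + exact: (measurableT_comp mu_ measurable_fst).
  + exact: (measurableT_comp mv measurable_snd).
- by move=> z; rewrite lee_fin mulr_ge0.
rewrite /fubini_F/=.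
under eq_integral do rewrite ge0_integralZl_real//.
rewrite ge0_integralZr//.
- by move=> x _; rewrite lee_fin.
- by apply: integral_ge0 => x _; rewrite lee_fin.
Qed.

Variables (k : nat) (psi : 'I_k -> Rd -> R).
Hypothesis mpsi : forall i, measurable_fun setT (psi i).
Hypothesis psi0 : forall i x, 0 <= psi i x.
Hypothesis psi1 : forall x, \sum_i psi i x = 1.
Variables (nu mu : P) (a b : 'I_k -> R) (c : 'I_k -> 'I_k -> R).
Hypothesis aE : forall i, (\int[nu]_x (psi i x)%:E)%E = (a i)%:E.
Hypothesis bE : forall j, (\int[mu]_x (psi j x)%:E)%E = (b j)%:E.
Hypothesis c0 : forall i j, 0 <= c i j.
Hypothesis ca : forall i, \sum_j c i j = a i.
Hypothesis cb : forall j, \sum_i c i j = b j.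

Let a0 i : 0 <= a i. Proof. by rewrite -ca sumr_ge0. Qed.
Let b0 j : 0 <= b j. Proof. by rewrite -cb sumr_ge0. Qed.
Let cle_a i j : c i j <= a i.
Proof. by rewrite -ca (bigD1 j)//= lerDl sumr_ge0. Qed.
Let cle_b i j : c i j <= b j.
Proof. by rewrite -cb (bigD1 i)//= lerDl sumr_ge0. Qed.

(* Density with respect to [nu \x mu] of a coupling whose cell masses are the
   discrete plan [c]; null cells are harmless since [c i j / 0 = 0]. *)
Definition plan_weight (z : Rd * Rd) : R :=
  \sum_i \sum_j c i j / (a i * b j) * (psi i z.1 * psi j z.2).

Let W0 i j : 0 <= c i j / (a i * b j).
Proof. by rewrite divr_ge0// mulr_ge0. Qed.

Lemma plan_weight_ge0 z : 0 <= plan_weight z.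
Proof. by apply: sumr_ge0 => i _; apply: sumr_ge0 => j _; rewrite mulr_ge0 ?W0 ?mulr_ge0. Qed.

Let mterm i j : measurable_fun setT (fun z : Rd * Rd => psi i z.1 * psi j z.2).
Proof.
apply: measurable_funM.
- exact: (measurableT_comp (mpsi i) measurable_fst).
- exact: (measurableT_comp (mpsi j) measurable_snd).
Qed.

Lemma measurable_plan_weight : measurable_fun setT plan_weight.
Proof.
apply: measurable_sum => i; apply: measurable_sum => j.
exact: measurable_funM.
Qed.

Lemma plan_integral (F : Rd * Rd -> R) : measurable_fun setT F -> (forall z, 0 <= F z) ->
  (\int[nu \x mu]_z (F z * plan_weight z)%:E =
  \sum_i \sum_j (c i j / (a i * b j))%:E * \int[nu \x mu]_z (F z * (psi i z.1 * psi j z.2))%:E)%E.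
Proof.
move=> mF F0.
have mt i j : measurable_fun setT (fun z => c i j / (a i * b j) * (F z * (psi i z.1 * psi j z.2))).
  by apply: measurable_funM => //; exact: measurable_funM.
have t0 i j z : 0 <= c i j / (a i * b j) * (F z * (psi i z.1 * psi j z.2)).
  by rewrite mulr_ge0 ?W0 ?mulr_ge0// mulr_ge0.
transitivity (\int[nu \x mu]_z (\sum_i \sum_j c i j / (a i * b j) * (F z * (psi i z.1 * psi j z.2)))%:E)%E.
  apply: eq_integral => z _; congr EFin; rewrite /plan_weight mulr_sumr; apply: eq_bigr => i _.
  by rewrite mulr_sumr; apply: eq_bigr => j _; rewrite mulrCA.
rewrite ge0_integral_sum_real; last 2 first.
- by move=> i; apply: measurable_sum => j.
- by move=> i z; apply: sumr_ge0 => j _.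
apply: eq_bigr => i _; rewrite ge0_integral_sum_real//.
apply: eq_bigr => j _; rewrite ge0_integralZl_real//.
- exact: measurable_funM.
- by move=> z; rewrite !mulr_ge0.
Qed.

Let mE (m : P) (A : set Rd) : measurable A ->
  (\int[m]_x (\1_A x)%:E)%E = m A.
Proof. by move=> mA; rewrite integral_indic// setIT. Qed.

(** Integrating out the second variable turns [psi j] into [b j] and cancels it from the
    denominator; the row sums of [c] then cancel [a i]. When [a i = 0] the cell [psi i] is null for
    [nu], and when [b j = 0] the entry [c i j] vanishes. *)
Let dens1 (A : set Rd) : measurable A ->
  (\int[nu \x mu]_(z in A `*` setT) (plan_weight z)%:E)%E = nu A.
Proof.
move=> mA.
have mi : measurable_fun setT (fun x : Rd => \1_A x : R) by exact: measurable_indic.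
rewrite integral_mkcond.
transitivity (\int[nu \x mu]_z ((\1_A z.1 : R) * plan_weight z)%:E)%E.
  apply: eq_integral => z _; rewrite patchE indicE.
  have -> : (z \in A `*` setT) = (z.1 \in A).
    by apply/idP/idP; rewrite !inE/=; [case|].
  by case: (_ \in A); rewrite ?mul1r ?mul0r.
rewrite plan_integral//; last by exact: (measurableT_comp mi measurable_fst).
pose al i := fine (\int[nu]_x (\1_A x * psi i x)%:E)%E.
have al_le i : (\int[nu]_x (\1_A x * psi i x)%:E <= (a i)%:E)%E.
  rewrite -aE; apply: le_ge0_integral => x; first by rewrite lee_fin mulr_ge0.
  by rewrite lee_fin ler_piMl// indicE; case: (_ \in _).
have al0 i : (0 <= \int[nu]_x (\1_A x * psi i x)%:E)%E.
  by apply: integral_ge0 => x _; rewrite lee_fin mulr_ge0.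
have alE i : (\int[nu]_x (\1_A x * psi i x)%:E)%E = (al i)%:E.
  by rewrite fineK// ge0_fin_numE// (le_lt_trans (al_le i))// ltry.
have -> : nu A = (\sum_i (al i)%:E)%E.
  rewrite -(mE nu mA); under [RHS]eq_bigr do rewrite -alE.
  rewrite -ge0_integral_sum_real; last 2 first.
  - by move=> i; exact: measurable_funM.
  - by move=> i x; rewrite mulr_ge0.
  by apply: eq_integral => x _; rewrite -mulr_sumr psi1 mulr1.
apply: eq_bigr => i _.
transitivity (\sum_j (c i j / (a i * b j) * (al i * b j))%:E)%E.
  apply: eq_bigr => j _; rewrite [RHS]EFinM; congr (_ * _)%E.
  transitivity (\int[nu \x mu]_z ((\1_A z.1 * psi i z.1) * psi j z.2)%:E)%E.
    by apply: eq_integral => z _; rewrite mulrA.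
  rewrite (product_integral nu mu (u := fun x => \1_A x * psi i x) (v := psi j))//.
  - by rewrite alE bE EFinM.
  - exact: measurable_funM.
  - by move=> x; rewrite mulr_ge0.
rewrite sumEFin; congr EFin.
have [ai0|ai0] := eqVneq (a i) 0.
  have al00 : al i = 0.
    apply/eqP; rewrite eq_le; apply/andP; split; last exact: fine_ge0.
    by rewrite -lee_fin -alE -ai0.
  by rewrite al00 big1// => j _; rewrite mul0r mulr0.
transitivity (\sum_j c i j * (al i / a i)).
  apply: eq_bigr => j _; have [bj0|bj0] := eqVneq (b j) 0.
    have cij : c i j = 0 by apply/eqP; rewrite eq_le c0 -bj0 cle_b.
    by rewrite cij !mul0r.
  by field; rewrite ai0 bj0.
by rewrite -mulr_suml ca mulrC divfK.
Qed.

Let dens2 (A : set Rd) : measurable A ->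
  (\int[nu \x mu]_(z in setT `*` A) (plan_weight z)%:E)%E = mu A.
Proof.
move=> mA.
have mi : measurable_fun setT (fun x : Rd => \1_A x : R) by exact: measurable_indic.
rewrite integral_mkcond.
transitivity (\int[nu \x mu]_z ((\1_A z.2 : R) * plan_weight z)%:E)%E.
  apply: eq_integral => z _; rewrite patchE indicE.
  have -> : (z \in setT `*` A) = (z.2 \in A).
    by apply/idP/idP; rewrite !inE/=; [case|].
  by case: (_ \in A); rewrite ?mul1r ?mul0r.
rewrite plan_integral//; last by exact: (measurableT_comp mi measurable_snd).
pose al i := fine (\int[mu]_x (\1_A x * psi i x)%:E)%E.
have al_le i : (\int[mu]_x (\1_A x * psi i x)%:E <= (b i)%:E)%E.
  rewrite -bE; apply: le_ge0_integral => x; first by rewrite lee_fin mulr_ge0.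
  by rewrite lee_fin ler_piMl// indicE; case: (_ \in _).
have al0 i : (0 <= \int[mu]_x (\1_A x * psi i x)%:E)%E.
  by apply: integral_ge0 => x _; rewrite lee_fin mulr_ge0.
have alE i : (\int[mu]_x (\1_A x * psi i x)%:E)%E = (al i)%:E.
  by rewrite fineK// ge0_fin_numE// (le_lt_trans (al_le i))// ltry.
have -> : mu A = (\sum_i (al i)%:E)%E.
  rewrite -(mE mu mA); under [RHS]eq_bigr do rewrite -alE.
  rewrite -ge0_integral_sum_real; last 2 first.
  - by move=> i; exact: measurable_funM.
  - by move=> i x; rewrite mulr_ge0.
  by apply: eq_integral => x _; rewrite -mulr_sumr psi1 mulr1.
rewrite exchange_big/=; apply: eq_bigr => j _.
transitivity (\sum_i (c i j / (a i * b j) * (a i * al j))%:E)%E.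
  apply: eq_bigr => i _; rewrite [RHS]EFinM; congr (_ * _)%E.
  transitivity (\int[nu \x mu]_z (psi i z.1 * (\1_A z.2 * psi j z.2))%:E)%E.
    by apply: eq_integral => z _; rewrite mulrCA.
  rewrite (product_integral nu mu (u := psi i) (v := fun x => \1_A x * psi j x))//.
  - by rewrite alE aE EFinM.
  - exact: measurable_funM.
  - by move=> x; rewrite mulr_ge0.
rewrite sumEFin; congr EFin.
have [bj0|bj0] := eqVneq (b j) 0.
  have al00 : al j = 0.
    apply/eqP; rewrite eq_le; apply/andP; split; last exact: fine_ge0.
    by rewrite -lee_fin -alE -bj0.
  by rewrite al00 big1// => i _; rewrite mulr0 mulr0.
transitivity (\sum_i c i j * (al j / b j)).
  apply: eq_bigr => i _; have [ai0|ai0] := eqVneq (a i) 0.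
    have cij : c i j = 0 by apply/eqP; rewrite eq_le c0 -ai0 cle_a.
    by rewrite cij !mul0r.
  by field; rewrite ai0 bj0.
by rewrite -mulr_suml cb mulrC divfK.
Qed.

(** The cost enters only through upper bounds [J] on products of cells, because a cell is known only
    by its diameter or by its moment. *)
Lemma plan_coupling : exists2 pi, coupling nu mu pi &
  forall (F : Rd * Rd -> R) (J : 'I_k -> 'I_k -> R),
    measurable_fun setT F -> (forall z, 0 <= F z) ->
    (forall i j, \int[nu \x mu]_z (F z * (psi i z.1 * psi j z.2))%:E <= (J i j)%:E)%E ->
    (\int[pi]_z (F z)%:E <= (\sum_i \sum_j c i j / (a i * b j) * J i j)%:E)%E.
Proof.
pose m : {measure set (Rd * Rd)%type -> \bar R} :=
  mdens (nu \x mu)%E measurable_plan_weight plan_weight_ge0.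
have m1 : m setT = 1%E.
  transitivity (nu setT); last exact: probability_setT.
  by rewrite -dens1// setXTT.
exists (prob_of m1).
  by move=> A mA; split; [exact: dens1|exact: dens2].
move=> F J mF F0 FJ.
apply: (@le_trans _ _ (\int[nu \x mu]_z (F z * plan_weight z)%:E)%E).
  exact: mdens_integral_le.
rewrite plan_integral// -sumEFin; apply: lee_sum => i _.
rewrite -sumEFin; apply: lee_sum => j _.
by rewrite [leRHS]EFinM; apply: lee_wpmul2l; rewrite ?lee_fin.
Qed.

End transport_plan.

(** * A discrete plan that leaves the common mass in place *)

Section min_plan.
Variables (R : realType) (k : nat) (a b : 'I_k -> R).
Hypothesis a0 : forall i, 0 <= a i.
Hypothesis b0 : forall i, 0 <= b i.
Hypothesis a1 : \sum_i a i = 1.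
Hypothesis b1 : \sum_i b i = 1.

Let mn i := Num.min (a i) (b i).
Let s := 1 - \sum_i mn i.

(** The maximal coupling of two probability vectors: the common mass stays on the diagonal, and the
    surpluses of [a] and of [b], both of total [s], are matched as a product. For [s = 0] both
    surpluses vanish, as does the quotient. *)
Definition min_plan (i j : 'I_k) : R :=
  (i == j)%:R * mn i + (a i - mn i) * (b j - mn j) / s.

Let amn i : 0 <= a i - mn i. Proof. by rewrite subr_ge0 ge_min lexx. Qed.
Let bmn i : 0 <= b i - mn i. Proof. by rewrite subr_ge0 ge_min lexx orbT. Qed.
Let mn0 i : 0 <= mn i. Proof. by rewrite le_min a0 b0. Qed.
Let sa : \sum_i (a i - mn i) = s. Proof. by rewrite sumrB a1. Qed.
Let sb : \sum_i (b i - mn i) = s. Proof. by rewrite sumrB b1. Qed.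
Let s0 : 0 <= s. Proof. by rewrite -sa sumr_ge0. Qed.

Lemma min_plan_ge0 i j : 0 <= min_plan i j.
Proof. by rewrite addr_ge0 ?mulr_ge0 ?invr_ge0. Qed.

Lemma min_plan_diag i : mn i <= min_plan i i.
Proof. by rewrite /min_plan eqxx mul1r lerDl ?mulr_ge0 ?invr_ge0. Qed.

Let diag_sum (f : 'I_k -> R) i : \sum_j (i == j)%:R * f j = f i.
Proof.
rewrite (bigD1 i)//= eqxx mul1r big1 ?addr0// => j; rewrite eq_sym => /negbTE ->.
by rewrite mul0r.
Qed.

Lemma min_plan_row i : \sum_j min_plan i j = a i.
Proof.
rewrite /min_plan big_split/=.
have -> : \sum_j (i == j)%:R * mn i = mn i by exact: (diag_sum (fun=> mn i)).
rewrite -mulr_suml -mulr_sumr sb.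
have [s00|sN0] := eqVneq s 0; last by rewrite mulfK// addrC subrK.
have : a i - mn i = 0.
  by apply: (psumr_eq0P (F := fun i => a i - mn i)); [move=> j _; exact: amn|exact: etrans sa s00|].
by move=> h; rewrite h !mul0r addr0; apply/esym/eqP; rewrite -subr_eq0 h.
Qed.

Lemma min_plan_col j : \sum_i min_plan i j = b j.
Proof.
rewrite /min_plan big_split/=.
have -> : \sum_i (i == j)%:R * mn i = mn j.
  by under eq_bigr do rewrite eq_sym; exact: diag_sum.
rewrite -mulr_suml -mulr_suml sa.
have [s00|sN0] := eqVneq s 0; last by rewrite mulrC mulKf// addrC subrK.
have : b j - mn j = 0.
  by apply: (psumr_eq0P (F := fun i => b i - mn i)); [move=> i _; exact: bmn|exact: etrans sb s00|].
by move=> h; rewrite h mulr0 mul0r addr0; apply/esym/eqP; rewrite -subr_eq0 h.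
Qed.

End min_plan.

(** * Transport cost of a discrete plan *)

Section plan_cost.
Variables (R : realType) (k : nat) (L : pred 'I_k).
(** Indicator of the pairs of cells whose cost is estimated by moments: all except the diagonal
    pairs of small cells. [L] marks the cells that are not small. *)
Let off (i j : 'I_k) : R := (~~ ((i == j) && ~~ L i))%:R.

(** [N i / a i] is the mean moment of cell [i], at most [Q] on a small cell. The mass leaving a
    small cell is [a i - c i i], at most [|a i - b i|] because the common mass stays. A cell of [L]
    is charged its whole moment. *)
Lemma plan_row_bound (a b N : 'I_k -> R) (c : 'I_k -> 'I_k -> R) (Q : R) :
  0 <= Q -> (forall i j, 0 <= c i j) -> (forall i, \sum_j c i j = a i) ->
  (forall i, Num.min (a i) (b i) <= c i i) ->
  (forall i, 0 <= N i) -> (forall i, ~~ L i -> N i <= Q * a i) ->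
  forall i, N i / a i * \sum_j c i j * off i j <= if L i then N i else Q * `|a i - b i|.
Proof.
move=> Q0 c0 ca cmin N0 NQ i.
have a0 : 0 <= a i by rewrite -ca sumr_ge0.
have n0 : 0 <= N i / a i by rewrite divr_ge0.
case: ifPn => Li.
  apply: (@le_trans _ _ (N i / a i * a i)).
    rewrite ler_wpM2l// -ca; apply: ler_sum => j _.
    by rewrite ler_piMr// /off; case: (~~ _).
  have [->|aN0] := eqVneq (a i) 0; first by rewrite mulr0.
  by rewrite divfK.
apply: ler_pM => //.
- by apply: sumr_ge0 => j _; rewrite mulr_ge0.
- have [ai0|aN0] := eqVneq (a i) 0; first by rewrite ai0 invr0 mulr0.
  by rewrite ler_pdivrMr ?NQ// lt_def aN0.
- have -> : \sum_j c i j * off i j = a i - c i i.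
    rewrite -ca (bigD1 i)//= /off eqxx Li/= mulr0 add0r [in RHS](bigD1 i)//= addrAC subrr add0r.
    by apply: eq_bigr => j ji; rewrite eq_sym (negbTE ji)/= mulr1.
  apply: (@le_trans _ _ (a i - Num.min (a i) (b i))); first by rewrite lerB.
  by case: (leP (a i) (b i)) => h; [rewrite subrr|rewrite ler_norm].
Qed.

(** Pairs inside one small cell cost at most [q1]; any other pair costs [q] times the sum of two
    moments. The first moments are collected by rows and the second ones by columns, the column
    estimate being the row estimate for the transposed plan. *)
Lemma plan_cost_bound (a b N M : 'I_k -> R) (c : 'I_k -> 'I_k -> R) (Q q1 q : R) :
  0 <= Q -> 0 <= q1 -> 0 <= q -> (forall i j, 0 <= c i j) ->
  (forall i, \sum_j c i j = a i) -> (forall j, \sum_i c i j = b j) ->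
  (forall i, Num.min (a i) (b i) <= c i i) -> \sum_i a i = 1 ->
  (forall i, 0 <= N i) -> (forall i, ~~ L i -> N i <= Q * a i) ->
  (forall i, 0 <= M i) -> (forall i, ~~ L i -> M i <= Q * b i) ->
  \sum_i \sum_j c i j / (a i * b j) *
    (if (i == j) && ~~ L i then q1 * (a i * b j) else q * (N i * b j + a i * M j)) <=
  q1 + q * (\sum_i (if L i then N i + M i else 2 * Q * `|a i - b i|)).
Proof.
move=> Q0 q10 q0 c0 ca cb cmin a1 N0 NQ M0 MQ.
have a0 i : 0 <= a i by rewrite -ca sumr_ge0.
have b0 i : 0 <= b i by rewrite -cb sumr_ge0.
have cza i j : a i = 0 -> c i j = 0.
  move=> ai; apply/eqP; rewrite eq_le c0 andbT -ai -ca (bigD1 j)//= lerDl.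
  by rewrite sumr_ge0.
have czb i j : b j = 0 -> c i j = 0.
  move=> bj; apply/eqP; rewrite eq_le c0 andbT -bj -cb (bigD1 i)//= lerDl.
  by rewrite sumr_ge0.
pose rowb i := N i / a i * \sum_j c i j * off i j.
pose colb j := M j / b j * \sum_i c i j * off i j.
apply: (@le_trans _ _ (q1 + q * (\sum_i rowb i + \sum_j colb j))).
  have -> : q1 + q * (\sum_i rowb i + \sum_j colb j) =
    \sum_i \sum_j (q1 * c i j + q * (N i / a i * (c i j * off i j) + M j / b j * (c i j * off i j))).
    under [RHS]eq_bigr do rewrite big_split/= -mulr_sumr -mulr_sumr big_split/= ca.
    rewrite big_split/= -mulr_sumr a1 mulr1; congr (_ + _); rewrite -mulr_sumr; congr (_ * _).
    rewrite big_split/=; congr (_ + _).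
      by apply: eq_bigr => i _; rewrite /rowb mulr_sumr.
    by rewrite exchange_big/=; apply: eq_bigr => j _; rewrite /colb mulr_sumr.
  apply: ler_sum => i _; apply: ler_sum => j _.
  have R0 : 0 <= N i / a i * (c i j * off i j) by rewrite !mulr_ge0 ?invr_ge0.
  have C0 : 0 <= M j / b j * (c i j * off i j) by rewrite !mulr_ge0 ?invr_ge0.
  have [ai|ai] := eqVneq (a i) 0.
    by rewrite (cza _ _ ai) !mul0r !mulr0 addr0 mulr0 add0r.
  have [bj|bj] := eqVneq (b j) 0.
    by rewrite (czb _ _ bj) !mul0r !mulr0 addr0 mulr0 add0r.
  rewrite /off in R0 C0 *; case: ifPn => h /=.
    rewrite mulr0 !mulr0 addr0 mulr0 addr0 le_eqVlt; apply/orP; left; apply/eqP.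
    by field; rewrite ai bj.
  rewrite mulr1; apply: (@le_trans _ _ (q * (N i / a i * c i j + M j / b j * c i j))).
    rewrite le_eqVlt; apply/orP; left; apply/eqP.
    by field; rewrite ai bj.
  by rewrite lerDr mulr_ge0.
rewrite lerD2l ler_wpM2l// -big_split/=; apply: ler_sum => i _.
have hr := plan_row_bound Q0 c0 ca cmin N0 NQ i.
have hc : colb i <= if L i then M i else Q * `|b i - a i|.
  have := @plan_row_bound b a M (fun i j => c j i) Q Q0 (fun i j => c0 j i) cb.
  have cm j : Num.min (b j) (a j) <= c j j by rewrite minC.
  move=> /(_ cm M0 MQ i); apply: le_trans; rewrite /colb ler_wpM2l ?divr_ge0//.
  apply: ler_sum => j _; rewrite ler_wpM2l// /off eq_sym.
  by have [->|] := eqVneq i j.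
move: hr hc; rewrite -/(rowb i); case: ifPn => Li hr hc; first exact: lerD.
by rewrite distrC in hc; rewrite (le_trans (lerD hr hc))// mulr_natl mulr2n mulrDl.
Qed.

End plan_cost.

(** * Comparison of the two descriptions of neighbourhoods *)

Section topology.
Variables (R : realType) (d : nat) (p : R).
Local Notation Rd := (Rd R d).
Local Notation P := (probability Rd R).
Local Notation kn := (@kn R d).
Implicit Types (x : Rd) (phi : Rd -> R) (mu nu : P).

Section Wp_nbhs.
Hypothesis p1 : 1 <= p.
Let hp : p = 0 \/ 1 <= p := or_intror p1.
Let p0 : 0 < p := lt_le_trans ltr01 p1.

Let nph n (i : 'I_(kn n).+1) x : R := npow p x * ph i x.

Let adm_nph n (i : 'I_(kn n).+1) : adm p (nph i).
Proof.
apply: (@adm_le _ _ _ _ (wt p)); last 1 first.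
- move=> x; rewrite !ger0_norm ?mulr_ge0 ?npow_ge0 ?ph_ge0 ?(ltW (wt_gt0 _ _))//.
  by rewrite (@le_trans _ _ (npow p x))// ?ler_piMr ?npow_ge0 ?ph_le1// lerDr.
- by apply: contM; [exact: cont_npow|exact: (ph_bcont _).1].
- exact: adm_wt.
Qed.

(** A common bound for |x|^p on all cells of the net; a sum serves in place of a maximum. *)
Definition plan_radius n : R := \sum_(i < (kn n).+1) (enorm (pt i) + 1) `^ p.

Lemma plan_radius_ge0 n : 0 <= plan_radius n.
Proof. by apply: sumr_ge0 => i _; exact: powR_ge0. Qed.

Let nph_le n (i : 'I_(kn n).+1) nu : Pp p nu -> (i < kn n)%N ->
  mint nu (nph i) <= plan_radius n * mint nu (ph i).
Proof.
move=> nup ik; rewrite -(mintZ hp)//; last exact: adm_ph.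
apply: (mint_le hp) => //; first by apply: admZ; exact: adm_ph.
move=> x; rewrite /nph; have [->|h] := eqVneq (ph i x) 0; first by rewrite !mulr0.
rewrite ler_wpM2r ?ph_ge0// /plan_radius (bigD1 i)//=.
apply: (@le_trans _ _ ((enorm (pt i) + 1) `^ p)); last first.
  by rewrite lerDl sumr_ge0// => j _; exact: powR_ge0.
apply: ge0_ler_powR; rewrite ?nnegrE ?enorm_ge0 ?addr_ge0 ?(ltW p0)//.
  exact: enorm_ge0.
rewrite (le_trans (enorm_le _ (pt i)))// lerD2l ltW// (lt_le_trans (ph_near h ik))//.
by rewrite invf_le1// ler1n.
Qed.

(** Besides the mesh, the bound involves finitely many test functions: the masses of the small
    cells, which are close for nearby measures, and the moment of the last cell, which lies outside
    the ball of radius [n]. *)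
Lemma Wp_cost_bound n nu mu : Pp p nu -> Pp p mu ->
  exists2 pi, coupling nu mu pi & (cost p pi <=
   ((2 * n.+1%:R^-1) `^ p + 2 `^ p * (\sum_(i < (kn n).+1) (if (kn n <= i)%N
      then mint nu (fun x => npow p x * ph i x) + mint mu (fun x => npow p x * ph i x)
      else 2 * plan_radius n * `|mint nu (ph i) - mint mu (ph i)|)))%:E)%E.
Proof.
move=> nup mup.
pose a (i : 'I_(kn n).+1) := mint nu (ph i); pose b (i : 'I_(kn n).+1) := mint mu (ph i).
have a0 i : 0 <= a i by apply: mint_ge0 => x; exact: ph_ge0.
have b0 i : 0 <= b i by apply: mint_ge0 => x; exact: ph_ge0.
have mass (m : P) : Pp p m -> \sum_(i < (kn n).+1) mint m (ph i) = 1.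
  by move=> /(cf_simplex hp n)[_]; under eq_bigr do rewrite mxE.
have a1 := mass _ nup; have b1 := mass _ mup.
pose c := min_plan a b.
pose N (i : 'I_(kn n).+1) := mint nu (nph i); pose M (i : 'I_(kn n).+1) := mint mu (nph i).
have nph0 i x : 0 <= nph (n := n) i x by rewrite mulr_ge0 ?npow_ge0 ?ph_ge0.
have mph (i : 'I_(kn n).+1) : measurable_fun setT (ph i) by exact: measurable_cont (ph_bcont i).1.
have mnph (i : 'I_(kn n).+1) : measurable_fun setT (nph i) by exact: measurable_cont (adm_nph i).1.
have aE i : (\int[nu]_x (ph i x)%:E)%E = (a i)%:E by rewrite (mintE hp)//; exact: adm_ph.
have bE i : (\int[mu]_x (ph i x)%:E)%E = (b i)%:E by rewrite (mintE hp)//; exact: adm_ph.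
have NE i : (\int[nu]_x (nph i x)%:E)%E = (N i)%:E by rewrite (mintE hp).
have ME i : (\int[mu]_x (nph i x)%:E)%E = (M i)%:E by rewrite (mintE hp).
have ph0 (i : 'I_(kn n).+1) x : 0 <= ph i x by exact: ph_ge0.
have mD := @measurable_dist_powR R d p.
have D0 (z : Rd * Rd) : 0 <= dist z.1 z.2 `^ p by exact: powR_ge0.
have [pi cpi hpi] := plan_coupling mph ph0 (@ph_sum R d n) aE bE (min_plan_ge0 a0 b0 a1)
  (min_plan_row a1 b1) (min_plan_col a1 b1).
exists pi => //.
pose q1 : R := (2 * n.+1%:R^-1) `^ p; pose q : R := 2 `^ p.
pose L : pred 'I_(kn n).+1 := fun i => (kn n <= i)%N.
pose J (i j : 'I_(kn n).+1) := if (i == j) && ~~ L i then q1 * (a i * b j)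
  else q * (N i * b j + a i * M j).
apply: le_trans (hpi _ J mD D0 _) _.
  move=> i j; rewrite /J; case: ifPn => [/andP[/eqP <- Li]|_].
    apply: (@le_trans _ _ (\int[nu \x mu]_z (q1 * (ph i z.1 * ph i z.2))%:E)%E).
      apply: le_ge0_integral => z; first by rewrite lee_fin mulr_ge0// mulr_ge0.
      rewrite lee_fin.
      have [->|h1] := eqVneq (ph i z.1) 0; first by rewrite mul0r !mulr0.
      have [->|h2] := eqVneq (ph i z.2) 0; first by rewrite !mulr0.
      rewrite ler_wpM2r ?mulr_ge0// /q1.
      apply: ge0_ler_powR; rewrite ?nnegrE ?dist_ge0 ?(ltW p0) ?mulr_ge0//.
      have ik : (i < kn n)%N by rewrite ltnNge.
      rewrite (le_trans (dist_triangle (pt i) _ _))// mulr_natl mulr2n lerD//.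
        by rewrite ltW// ph_near.
      by rewrite distC ltW// ph_near.
    rewrite ge0_integralZl_real ?powR_ge0//; last 2 first.
    - apply: measurable_funM.
      + exact: (measurableT_comp (mph i) measurable_fst).
      + exact: (measurableT_comp (mph i) measurable_snd).
    - by move=> z; rewrite mulr_ge0.
    by rewrite (product_integral nu mu (mph i) (mph i))// aE bE -!EFinM.
  have m1 : measurable_fun setT (fun z : Rd * Rd => nph i z.1 * ph j z.2).
    apply: measurable_funM.
    + exact: (measurableT_comp (mnph i) measurable_fst).
    + exact: (measurableT_comp (mph j) measurable_snd).
  have m2 : measurable_fun setT (fun z : Rd * Rd => ph i z.1 * nph j z.2).
    apply: measurable_funM.
    + exact: (measurableT_comp (mph i) measurable_fst).
    + exact: (measurableT_comp (mnph j) measurable_snd).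
  apply: (@le_trans _ _ (\int[nu \x mu]_z (q * (nph i z.1 * ph j z.2 + ph i z.1 * nph j z.2))%:E)%E).
    apply: le_ge0_integral => z; first by rewrite lee_fin mulr_ge0// mulr_ge0.
    rewrite lee_fin /nph.
    have -> : q * (npow p z.1 * ph i z.1 * ph j z.2 + ph i z.1 * (npow p z.2 * ph j z.2)) =
      q * (npow p z.1 + npow p z.2) * (ph i z.1 * ph j z.2) by ring.
    by rewrite ler_wpM2r ?mulr_ge0// dist_powR_le.
  rewrite ge0_integralZl_real ?powR_ge0//; last 2 first.
  - exact: measurable_funD.
  - by move=> z; rewrite addr_ge0// mulr_ge0.
  rewrite ge0_integralD_real//; try by move=> z; rewrite mulr_ge0.
  rewrite (product_integral nu mu (mnph i) (mph j))// (product_integral nu mu (mph i) (mnph j))//.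
  by rewrite NE ME aE bE EFinM EFinD !EFinM.
rewrite lee_fin; apply: (@plan_cost_bound R _ L a b N M _ (plan_radius n) q1 q) => //.
- exact: plan_radius_ge0.
- exact: powR_ge0.
- exact: powR_ge0.
- exact: min_plan_ge0.
- exact: min_plan_row.
- exact: min_plan_col.
- exact: min_plan_diag.
- by move=> i; exact: mint_ge0.
- by move=> i; rewrite /L -ltnNge; exact: nph_le.
- by move=> i; exact: mint_ge0.
- by move=> i; rewrite /L -ltnNge; exact: nph_le.
Qed.

Lemma tn_Wp mu (e : R) : Pp p mu -> 0 < e -> \forall nu \near tn p mu, Wp p nu mu < e.
Proof.
move=> mup e0.
set E := e `^ p; have E0 : 0 < E by rewrite powR_gt0.
set q := 2 `^ p; have q0 : 0 < q by rewrite powR_gt0.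
(* The sum in [Wp_cost_bound] will be less than [4 * eta]: [eta] for the small cells, [2 * eta] and
   [eta] for the last cell under [nu] and [mu]. Multiplied by [q] this is [E / 4]. *)
pose eta := E / 4 / (4 * q).
have eta0 : 0 < eta by rewrite !divr_gt0// mulr_gt0.
have [r hr] := tail_small hp mup eta0.
(* The bound [1 / 2] ensures that [2 / n.+1] is at most 1, where its [p]-th power is no larger than
   itself. Below, [n >= r.+1] places the last cell where [tail] is the full weight. *)
have [j0 hj0] := @inv_nat_small R (Num.min (1 / 2) (E / 4 / 2)) (ltac:(by rewrite lt_min !divr_gt0)).
pose n := maxn j0 r.+1.
have hn : (2 * n.+1%:R^-1) `^ p < E / 4.
  have := hj0 n (leq_maxl _ _); rewrite lt_min => /andP[h1 h2].
  have n0 : 0 < n.+1%:R^-1 :> R by rewrite invr_gt0.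
  rewrite (@le_lt_trans _ _ (2 * n.+1%:R^-1))//; last by rewrite mulrC -ltr_pdivlMr.
  rewrite ge1r_powR// mulr_gt0//= mulrC -ler_pdivlMr// ltW//.
pose S := (kn n).+1%:R * (2 * plan_radius n) + 1 : R.
have S0 : 0 < S by rewrite ltr_wpDl// mulr_ge0// mulr_ge0// plan_radius_ge0.
pose del := eta / S.
have del0 : 0 < del by rewrite divr_gt0.
near=> nu.
have nup : Pp p nu by near: nu; exact: tn_Pp.
have hph (i : 'I_(kn n).+1) : `|mint nu (ph i) - mint mu (ph i)| < del.
  move: i; near: nu; apply: (@filter_forall _ _ (fun i : 'I_(kn n).+1 =>
    [set nu | `|mint nu (ph i) - mint mu (ph i)| < del]) (tn p mu) _) => i.
  by apply: tn_mint => //; exact: adm_ph.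
have hN : `|mint nu (nph (n := n) ord_max) - mint mu (nph (n := n) ord_max)| < eta.
  by near: nu; exact: tn_mint.
have [pi cpi hpi] := Wp_cost_bound n nup mup.
apply: (Wp_lt p1 e0 cpi); apply: le_lt_trans hpi _; rewrite lte_fin -/q -/E.
have hM : mint mu (nph (n := n) ord_max) <= mint mu (tail p r%:R).
  apply: (mint_le hp) => //; first exact: adm_tail.
  move=> x; rewrite /nph; have [->|h] := eqVneq (ph (ord_max : 'I_(kn n).+1) x) 0.
    by rewrite mulr0 tail_ge0.
  have xn : n%:R < enorm x by exact: (ph_last h).
  rewrite /tail cut1 ?mulr1.
    by rewrite (@le_trans _ _ (npow p x))// ?ler_piMr ?npow_ge0 ?ph_le1// lerDr.
  by rewrite natr1 (le_trans _ (ltW xn))// ler_nat leq_maxr.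
have hs : \sum_(i < (kn n).+1) (if (kn n <= i)%N
      then mint nu (fun x => npow p x * ph i x) + mint mu (fun x => npow p x * ph i x)
      else 2 * plan_radius n * `|mint nu (ph i) - mint mu (ph i)|) <=
   (kn n).+1%:R * (2 * plan_radius n * del) +
   (mint nu (nph (n := n) ord_max) + mint mu (nph (n := n) ord_max)).
  have T0 : 0 <= 2 * plan_radius n * del by rewrite mulr_ge0 ?(ltW del0)// mulr_ge0 ?plan_radius_ge0.
  rewrite big_ord_recr/= leqnn lerD2r.
  apply: (@le_trans _ _ (\sum_(i < kn n) 2 * plan_radius n * del)).
    apply: ler_sum => i _; rewrite leqNgt ltn_ord/= ler_wpM2l ?mulr_ge0 ?plan_radius_ge0//.
    exact/ltW.
  by rewrite sumr_const card_ord -[leLHS]mulr_natl ler_wpM2r// ler_nat.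
have hr' := hr r (leqnn _).
have hSd : (kn n).+1%:R * (2 * plan_radius n * del) <= eta.
  rewrite mulrA /del mulrA ler_pdivrMr// mulrC ler_pM2l// /S mulrA lerDl//.
have tot : \sum_(i < (kn n).+1) (if (kn n <= i)%N
      then mint nu (fun x => npow p x * ph i x) + mint mu (fun x => npow p x * ph i x)
      else 2 * plan_radius n * `|mint nu (ph i) - mint mu (ph i)|) < 4 * eta.
  apply: (le_lt_trans hs); move: hN; rewrite ltr_norml => /andP[_ hN].
  move: hN hM hr' hSd; set A := mint nu _; set B := mint mu _; set C := mint mu _; set D := _ * (_ * del).
  lra.
have qt : q * (4 * eta) = E / 4.
  by rewrite /eta; field; rewrite gt_eqF.
move: hn; set X := _ `^ p => hn.
move: tot; set Y := \sum_(_ < _) _ => tot.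
have : q * Y < E / 4 by rewrite -qt ltr_pM2l.
lra.
Unshelve. all: by end_near. Qed.

End Wp_nbhs.

Hypothesis hp : p = 0 \/ 1 <= p.

Lemma adm0_bcont phi : adm 0 phi -> bcont phi.
Proof.
move=> [cphi [C hC]]; split => //; exists (C * 2) => x.
by have := hC x; rewrite /wt /npow powRr0.
Qed.

Lemma PnbhdP mu N : Pp p mu -> Pnbhd p mu N <-> tn p mu N.
Proof.
move=> mup; rewrite /Pnbhd; case: ifPn => [/eqP p0|pN0].
  split => -[k [f [e [af e0 h]]]]; exists k, f, e; split => // i.
    by rewrite p0; exact: bcont_adm.
  by apply: adm0_bcont; rewrite -p0.
have p1 : 1 <= p by case: hp pN0 => // ->; rewrite eqxx.
split.
  move=> [e e0 h]; near=> nu; apply: h; first by near: nu; exact: tn_Pp.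
  by near: nu; exact: tn_Wp.
move=> [k [f [e [af e0 h]]]].
have /choice[del hdel] : forall i, exists del : R, 0 < del /\ forall nu, Pp p nu -> Wp p nu mu < del ->
    `|mint nu (f i) - mint mu (f i)| < e.
  by move=> i; have [del d0 hd] := Wp_mint p1 mup (af i) e0; exists del.
(* The seed 1 gives a positive radius even for an empty family of test functions. *)
exists (\big[Num.min/1]_i del i).
  by elim/big_ind : _ => // [u v u0 v0|i _]; [rewrite lt_min u0|have [] := hdel i].
move=> nu nup hW; apply: h => // i; have [_] := hdel i; apply => //.
by apply: (lt_le_trans hW); exact: bigmin_le_cond.
Unshelve. all: by end_near. Qed.

End topology.

(** * C^1 approximation on the simplex *)

Section continuous_real.
Variables (R : realType) (T : topologicalType).
Implicit Types f g : T -> R.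

Lemma continuousD_fun f g : continuous f -> continuous g -> continuous (fun x => f x + g x).
Proof. by move=> cf cg x; apply: cvgD; [exact: cf|exact: cg]. Qed.

Lemma continuousM_fun f g : continuous f -> continuous g -> continuous (fun x => f x * g x).
Proof. by move=> cf cg x; apply: cvgM; [exact: cf|exact: cg]. Qed.

Lemma continuous_sum_fun (I : Type) (r : seq I) (f : I -> T -> R) :
  (forall i, continuous (f i)) -> continuous (fun x => \sum_(i <- r) f i x).
Proof.
move=> cf; elim: r => [|i r ih].
  by under [X in continuous X]eq_fun do rewrite big_nil; exact: cst_continuous.
by under [X in continuous X]eq_fun do rewrite big_cons; exact: continuousD_fun.
Qed.

End continuous_real.

(** * Bernstein polynomials as expectations of a random walk *)

Section bernstein.
Variables (R : realType) (k : nat).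
Local Notation V := 'rV[R]_k.+1.
Local Notation e_ i := (delta_mx 0 i : V).
Implicit Types (c y z : V) (F G H : V -> R).

(* [bern N F c y] is the expectation of [F] after [N] independent steps
   [e_ j] with law [y], started at [c]; for [y] off the simplex it is the
   same polynomial in [y]. *)
Fixpoint bern (N : nat) F c y : R :=
  if N is N'.+1 then \sum_j y 0 j * bern N' F (c + e_ j) y else F c.

Lemma eq_bern N F G c y : F =1 G -> bern N F c y = bern N G c y.
Proof. by move=> FG; elim: N c => [|N ih] c //=; apply: eq_bigr => j _; rewrite ih. Qed.

Lemma bernD N F G c y : bern N (fun c => F c + G c) c y = bern N F c y + bern N G c y.
Proof.
elim: N c => [//|N ih] c /=; rewrite -big_split/=; apply: eq_bigr => j _.
by rewrite ih mulrDr.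
Qed.

Lemma bernZ N a F c y : bern N (fun c => a * F c) c y = a * bern N F c y.
Proof.
elim: N c => [//|N ih] c /=; rewrite mulr_sumr; apply: eq_bigr => j _.
by rewrite ih mulrCA.
Qed.

Lemma bern_sum N (I : Type) (r : seq I) (F : I -> V -> R) c y :
  bern N (fun c => \sum_(i <- r) F i c) c y = \sum_(i <- r) bern N (F i) c y.
Proof.
elim: r => [|i r ih].
  rewrite big_nil (@eq_bern _ _ (fun=> 0 * 0)); last by move=> c'; rewrite big_nil mul0r.
  by rewrite (bernZ N 0 (fun=> 0)) mul0r.
rewrite big_cons -ih -bernD; apply: eq_bern => c'; exact: big_cons.
Qed.

Lemma bern_shift N F c b y : bern N F (c + b) y = bern N (fun c => F (c + b)) c y.
Proof. by elim: N c => [//|N ih] c /=; apply: eq_bigr => j _; rewrite addrAC ih. Qed.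

Lemma bern_cst N a c y : simplex y -> bern N (fun=> a) c y = a.
Proof.
move=> [_ y1]; elim: N c => [//|N ih] c /=.
by under eq_bigr do rewrite ih; rewrite -mulr_suml y1 mul1r.
Qed.

Lemma sum_delta (j : 'I_k.+1) : \sum_i e_ j 0 i = 1.
Proof.
rewrite (bigD1 j)//= mxE !eqxx/= big1 ?addr0// => i ij.
by rewrite mxE (negbTE ij) andbF.
Qed.

Lemma sum_zero : \sum_i (0 : V) 0 i = 0.
Proof. by rewrite big1// => i _; rewrite mxE. Qed.

(** On the simplex the expectation is monotone and preserves constants. The estimate is required
    only at nonnegative points with the coordinate sum reached after [N] steps, since [F] will be
    controlled only at rescalings of such points. *)
Lemma bern_dist N F H a c y : simplex y -> (forall i, 0 <= c 0 i) ->
  (forall c', (forall i, 0 <= c' 0 i) -> \sum_i c' 0 i = \sum_i c 0 i + N%:R ->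
     `|F c' - a| <= H c') ->
  `|bern N F c y - a| <= bern N H c y.
Proof.
move=> hy; have [y0 y1] := hy; elim: N c => [|N ih] c c0 h /=.
  by apply: h => //; rewrite addr0.
have -> : \sum_j y 0 j * bern N F (c + e_ j) y - a =
    \sum_j y 0 j * (bern N F (c + e_ j) y - a).
  under [RHS]eq_bigr do rewrite mulrBr.
  by rewrite sumrB -mulr_suml y1 mul1r.
apply: (le_trans (ler_norm_sum _ _ _)); apply: ler_sum => j _.
rewrite normrM (ger0_norm (y0 j)) ler_wpM2l//; apply: ih.
  by move=> i; rewrite !mxE addr_ge0.
move=> c' c'0 c'1; apply: h => //; rewrite c'1.
under eq_bigr do rewrite mxE.
by rewrite big_split/= sum_delta -addrA -natr1 [1 + _]addrC.
Qed.

(** Squared bias plus variance: the number of steps in direction [i] is binomial with parameters [N]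
    and [y 0 i]. *)
Lemma bern_var N (i : 'I_k.+1) (b : R) c y : simplex y ->
  bern N (fun c' => (c' 0 i - b) ^+ 2) c y =
  (c 0 i + N%:R * y 0 i - b) ^+ 2 + N%:R * (y 0 i * (1 - y 0 i)).
Proof.
move=> [_ y1]; elim: N c => [|N ih] c /=; first by rewrite !mul0r !addr0.
under eq_bigr do rewrite ih.
pose X := c 0 i + N%:R * y 0 i - b.
have E j : y 0 j * (((c + e_ j) 0 i + N%:R * y 0 i - b) ^+ 2 + N%:R * (y 0 i * (1 - y 0 i))) =
    y 0 j * (X ^+ 2 + N%:R * (y 0 i * (1 - y 0 i))) + (y 0 j * (i == j)%:R) * (2 * X + 1).
  rewrite !mxE /= ?eqxx/= /X; case: (i == j) => /=; ring.
under eq_bigr do rewrite E.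
rewrite big_split/= -!mulr_suml y1 mul1r.
have -> : \sum_j y 0 j * (i == j)%:R = y 0 i.
  rewrite (bigD1 i)//= eqxx mulr1 big1 ?addr0// => j; rewrite eq_sym => /negbTE ->.
  by rewrite mulr0.
by rewrite /X -natr1; ring.
Qed.

Lemma is_derive_coord y (i j : 'I_k.+1) :
  is_derive y (e_ i) (fun y : V => y 0 j : R) (i == j)%:R.
Proof.
have h : (fun t : R => t^-1 *: (((fun y : V => y 0 j) \o shift y) (t *: e_ i) - y 0 j))
    @ (0 : R)^' --> ((i == j)%:R : R).
  apply: cvg_near_cst; near=> t; rewrite /= !mxE eqxx/= addrK.
  rewrite [LHS]mulrA mulVf ?mul1r; first by rewrite eq_sym.
  by near: t; exact: nbhs_dnbhs_neq.
by apply: DeriveDef; [apply/cvg_ex; exists (i == j)%:R|exact: cvg_lim].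
Unshelve. all: by end_near. Qed.

(** The [N] steps play the same role, so the product rule gives [N] equal terms, in each of which
    one step is forced to be [e_ i]. For [N = 0] the factor [N] makes the predecessor harmless. *)
Lemma is_derive_bern N F c y i :
  is_derive y (e_ i) (bern N F c) (N%:R * bern N.-1 F (c + e_ i) y).
Proof.
elim: N c => [|N ih] c; first by rewrite mul0r; exact: is_derive_cst.
have -> : bern N.+1 F c = \sum_j ((fun y : V => y 0 j : R) * (bern N F (c + e_ j)) : V -> R).
  by apply/funext => z; rewrite fct_sumE.
apply: is_derive_eq.
  by apply: is_derive_sum => j; exact: (is_deriveM (is_derive_coord y i j) (ih _)).
rewrite big_split/=.
have -> : \sum_j bern N F (c + e_ j) y *: ((i == j)%:R : R) = bern N F (c + e_ i) y.
  rewrite (bigD1 i)//= eqxx big1 ?addr0; first by rewrite /GRing.scale/= mulr1.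
  by move=> j; rewrite eq_sym => /negbTE ->; rewrite /GRing.scale/= mulr0.
rewrite -natr1 mulrDl mul1r; congr (_ + _).
case: N ih => [|N] ih; first by rewrite mul0r big1// => j _; rewrite mul0r scaler0.
rewrite /= mulr_sumr; apply: eq_bigr => j _.
by rewrite /GRing.scale/= mulrCA addrAC.
Qed.

Lemma continuous_bern N F c : continuous (bern N F c).
Proof.
elim: N c => [|N ih] c; first exact: cst_continuous.
apply: continuous_sum_fun => j.
by apply: continuousM_fun; [exact: coord_continuous|exact: ih].
Qed.

End bernstein.

(** * Simultaneous approximation of a function and its gradient *)

Section simplex_approx.
Variables (R : realType) (k : nat).
Local Notation V := 'rV[R]_k.+1.
Local Notation e_ i := (delta_mx 0 i : V).
Implicit Types (c y z : V).
Variables (h : V -> R) (G : 'I_k.+1 -> V -> R) (M : R).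
Hypothesis M0 : 0 < M.
Hypothesis GM : forall i y, simplex y -> `|G i y| <= M.
Hypothesis Gunif : forall e : R, 0 < e -> exists2 del : R, 0 < del &
  forall i y z, simplex y -> simplex z -> (forall j, `|y 0 j - z 0 j| < del) ->
    `|G i y - G i z| <= e.
(** Stands for the integral of [G] along a segment, with neither differentiability of [h] nor
    measurability: whatever bounds the integrand bounds the increment. *)
Hypothesis mean_value : forall y z, simplex y -> simplex z -> forall a D : R,
  (forall t, 0 <= t <= 1 ->
     `|\sum_i (z 0 i - y 0 i) * G i (t *: z + (1 - t) *: y) - a| <= D) ->
  `|h z - h y - a| <= D.

Lemma simplex_segment y z (t : R) : simplex y -> simplex z -> 0 <= t <= 1 ->
  simplex (t *: z + (1 - t) *: y).
Proof.
move=> [y0 y1] [z0 z1] /andP[t0 t1]; split.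
  by move=> i; rewrite !mxE addr_ge0 ?mulr_ge0 ?subr_ge0.
under eq_bigr do rewrite !mxE.
by rewrite big_split/= -!mulr_sumr y1 z1 !mulr1 addrC subrK.
Qed.

Lemma mean_value_lip y z : simplex y -> simplex z ->
  `|h z - h y| <= M * \sum_i `|z 0 i - y 0 i|.
Proof.
move=> hy hz; rewrite -[X in `|X|]subr0; apply: (mean_value hy hz) => t t01.
rewrite subr0 mulr_sumr (le_trans (ler_norm_sum _ _ _))//; apply: ler_sum => i _.
by rewrite normrM mulrC ler_wpM2r// GM//; exact: simplex_segment.
Qed.

Lemma simplex_le1 y i : simplex y -> 0 <= y 0 i <= 1.
Proof.
move=> [y0 y1]; rewrite y0/= -y1 (bigD1 i)//= lerDl sumr_ge0// => j _; exact: y0.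
Qed.

(** Lattice points of coordinate sum [n.+1] are rescaled into the simplex. Samples for the
    derivative have the same sum, from [n] random steps and a forced one. *)
Let sc n (c : V) : V := n.+1%:R^-1 *: c.

Let sc_simplex n c : (forall i, 0 <= c 0 i) -> \sum_i c 0 i = n.+1%:R -> simplex (sc n c).
Proof.
move=> c0 c1; split.
  by move=> i; rewrite mxE mulr_ge0.
by under eq_bigr do rewrite mxE; rewrite -mulr_sumr c1 mulVf.
Qed.

Let bernh n : V -> R := bern n.+1 (h \o sc n) 0.
(** Chosen so that, by [gn'_simplex], the derivative in direction [i] averages [G 0] plus a
    difference quotient of [h] between the neighbours [c + e_ i] and [c + e_ 0]. That quotient is
    close to [G i - G 0]. *)
Let psi_fun n (c : V) : R := G 0 (sc n (c + e_ 0)) - n.+1%:R * h (sc n (c + e_ 0)).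
Let psi n : V -> R := bern n (psi_fun n) 0.

(* The second term vanishes on the simplex; it fixes the additive constant
   in the gradient, which the values on the simplex do not determine. *)
Let gn n (y : V) : R := bernh n y + (\sum_j y 0 j - 1) * psi n y.

Let gn' n i (y : V) : R := n.+1%:R * bern n (h \o sc n) (0 + e_ i) y +
  ((\sum_j y 0 j - 1) * (n%:R * bern n.-1 (psi_fun n) (0 + e_ i) y) + psi n y).

Let is_derive_gn n i y : is_derive y (e_ i) (gn n) (gn' n i y).
Proof.
have ds : is_derive y (e_ i) ((\sum_j (fun y : V => y 0 j : R)) - cst (1 : R)) (1 : R).
  apply: is_derive_eq; first apply: is_deriveB.
    by apply: is_derive_sum => j; exact: is_derive_coord.
  rewrite subr0 (bigD1 i)//= eqxx big1 ?addr0// => j; rewrite eq_sym => /negbTE ->//.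
have -> : gn n = bernh n + ((\sum_j (fun y : V => y 0 j : R)) - cst (1 : R)) * psi n.
  by apply/funext => z; rewrite /gn /= !fctE/= fct_sumE.
apply: is_derive_eq.
  apply: is_deriveD; first exact: is_derive_bern.
  exact: (is_deriveM ds (is_derive_bern _ _ _ _ _)).
rewrite /gn' /=; congr (_ + (_ + _)); rewrite /GRing.scale/= ?mulr1//.
by rewrite !fctE/= fct_sumE.
Qed.

Let C1_gn n : C1Rn (gn n).
Proof.
move=> i; split; first by move=> y; have [] := is_derive_gn n i y.
have -> : pderiv (gn n) i = gn' n i.
  by apply/funext => y; have [_] := is_derive_gn n i y.
have cs : continuous (fun y : V => \sum_j y 0 j - 1 : R).
  apply: continuousD_fun; last exact: cst_continuous.
  by apply: continuous_sum_fun => j; exact: coord_continuous.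
have cb N F c : continuous (fun y : V => N%:R * bern N.-1 F c y : R).
  by apply: continuousM_fun; [exact: cst_continuous|exact: continuous_bern].
apply: continuousD_fun; first exact: (cb n.+1).
apply: continuousD_fun; last exact: continuous_bern.
by apply: continuousM_fun; [exact: cs|exact: cb].
Qed.

Let gn'_simplex n i y : simplex y ->
  gn' n i y = bern n (fun c => n.+1%:R * (h (sc n (c + e_ i)) - h (sc n (c + e_ 0))) +
     G 0 (sc n (c + e_ 0))) 0 y.
Proof.
move=> [_ y1]; rewrite /gn' bern_shift y1 subrr mul0r add0r /psi -bernZ -bernD.
by apply: eq_bern => c; rewrite /psi_fun /=; ring.
Qed.

Let sumsq n (y c : V) : R := \sum_j (c 0 j - n.+1%:R * y 0 j) ^+ 2.

Let bern_sumsq n y : simplex y -> bern n (sumsq n y) 0 y <= k.+1%:R * n.+1%:R.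
Proof.
move=> hy; rewrite /sumsq bern_sum.
apply: (@le_trans _ _ (\sum_(j < k.+1) n.+1%:R)); last by rewrite sumr_const card_ord -[leLHS]mulr_natl.
apply: ler_sum => j _; rewrite bern_var// mxE add0r.
have /andP[y0 y1] := simplex_le1 j hy.
rewrite -natr1; set N := n%:R; have N0 : 0 <= N :> R by rewrite ler0n.
have -> : (N * y 0 j - (N + 1) * y 0 j) = - y 0 j by ring.
rewrite sqrrN; nra.
Qed.

Let bern_sumsq1 n y : simplex y -> bern n.+1 (sumsq n y) 0 y <= k.+1%:R * n.+1%:R.
Proof.
move=> hy; rewrite /sumsq bern_sum.
apply: (@le_trans _ _ (\sum_(j < k.+1) n.+1%:R)); last by rewrite sumr_const card_ord -[leLHS]mulr_natl.
apply: ler_sum => j _; rewrite bern_var// mxE add0r subrr expr0n/= add0r.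
have /andP[y0 y1] := simplex_le1 j hy.
rewrite ler_piMr//; nra.
Qed.

(** By [|u| <= e1 + u ^+ 2 / e1] the Lipschitz estimate becomes a constant plus a quadratic term,
    whose expectation is a variance. *)
Let gn_close n (y : V) (e1 : R) : simplex y -> 0 < e1 ->
  `|gn n y - h y| <= M * k.+1%:R * e1 + M * k.+1%:R / e1 * n.+1%:R^-1.
Proof.
move=> hy e10; have [y0 y1] := hy.
rewrite /gn y1 subrr mul0r addr0 /bernh.
set N := n.+1%:R; have N0 : 0 < N :> R by rewrite ltr0n.
pose H c := M * k.+1%:R * e1 + M / e1 / N ^+ 2 * sumsq n y c.
apply: (@le_trans _ _ (bern n.+1 H 0 y)).
  apply: bern_dist => //; first by move=> i; rewrite mxE.
  move=> c c0; rewrite sum_zero add0r => c1 /=.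
  rewrite (le_trans (mean_value_lip hy (sc_simplex c0 c1)))//.
  rewrite /H /sumsq -/N.
  have -> : M * k.+1%:R * e1 + M / e1 / N ^+ 2 * (\sum_j (c 0 j - N * y 0 j) ^+ 2) =
     M * \sum_j (e1 + (c 0 j - N * y 0 j) ^+ 2 / N ^+ 2 / e1).
    rewrite big_split/= sumr_const card_ord mulrDr -[e1 *+ _]mulr_natl mulrA; congr (_ + _).
    by rewrite !mulr_sumr; apply: eq_bigr => j _; field; rewrite !gt_eqF.
  rewrite ler_pM2l//; apply: ler_sum => j _; rewrite mxE -/N.
  have -> : (c 0 j - N * y 0 j) ^+ 2 / N ^+ 2 = (N^-1 * c 0 j - y 0 j) ^+ 2.
    by field; rewrite gt_eqF.
  set u := _ - y 0 j.
  have [ue|ue] := leP `|u| e1; first by rewrite (le_trans ue)// lerDl divr_ge0 ?sqr_ge0// ltW.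
  rewrite (@le_trans _ _ (u ^+ 2 / e1))//; last by rewrite lerDr ltW.
  by rewrite ler_pdivlMr// -[u ^+ 2]real_normK ?num_real// expr2 ler_wpM2l// ltW.
rewrite /H bernD bern_cst// bernZ lerD2l.
apply: (@le_trans _ _ (M / e1 / N ^+ 2 * (k.+1%:R * N))).
  by rewrite ler_wpM2l ?bern_sumsq1// !divr_ge0 ?exprn_ge0// ltW.
by rewrite le_eqVlt; apply/orP; left; apply/eqP; field; rewrite !gt_eqF.
Qed.

(** Samples near [y] contribute at most [3 * e1] by uniform continuity of [G], since the forced step
    moves the rescaled point by less than [del / 2]. Far samples are bounded crudely and are rare by
    Chebyshev's inequality. *)
Let gn'_close n i (y : V) (e1 del : R) : simplex y -> 0 < e1 -> 0 < del ->
  (forall i y z, simplex y -> simplex z -> (forall j, `|y 0 j - z 0 j| < del) ->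
    `|G i y - G i z| <= e1) ->
  n.+1%:R^-1 < del / 2 ->
  `|gn' n i y - G i y| <= 3 * e1 + 16 * M * k.+1%:R / del ^+ 2 * n.+1%:R^-1.
Proof.
move=> hy e10 del0 hG hn; rewrite gn'_simplex//.
set N := n.+1%:R in hn *; have N0 : 0 < N :> R by rewrite ltr0n.
(* A far sample has error at most [4 * M] and a coordinate deviating by at least [del / 2]; hence
   the factor 16 once the squared deviation is divided by [del ^+ 2]. *)
pose H c := 3 * e1 + 16 * M / del ^+ 2 / N ^+ 2 * sumsq n y c.
apply: (@le_trans _ _ (bern n H 0 y)); last first.
  rewrite /H bernD bern_cst// bernZ lerD2l.
  apply: (@le_trans _ _ (16 * M / del ^+ 2 / N ^+ 2 * (k.+1%:R * N))).
    by rewrite ler_wpM2l ?bern_sumsq// !divr_ge0 ?exprn_ge0 ?mulr_ge0// ltW.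
  by rewrite le_eqVlt; apply/orP; left; apply/eqP; field; rewrite !gt_eqF.
apply: bern_dist => //; first by move=> j; rewrite mxE.
move=> c c0; rewrite sum_zero add0r => c1 /=.
have cs l : simplex (sc n (c + e_ l)).
  apply: sc_simplex; first by move=> j; rewrite !mxE addr_ge0.
  under eq_bigr do rewrite mxE.
  by rewrite big_split/= sum_delta c1 natr1.
set z := sc n (c + e_ i); set w := sc n (c + e_ 0).
have hz : simplex z by exact: cs.
have hw : simplex w by exact: cs.
(* [z - w] is [N^-1] times [e_ i - e_ 0], so the mean value inequality compares [N * (h z - h w)]
   with [G i - G 0]. *)
have lin (A : 'I_k.+1 -> R) : \sum_l (z 0 l - w 0 l) * A l = N^-1 * (A i - A 0).
  have E l : (z 0 l - w 0 l) * A l = N^-1 * ((l == i)%:R * A l - (l == 0)%:R * A l).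
    by rewrite /z /w !mxE !eqxx/= -/N; ring.
  under eq_bigr do rewrite E.
  rewrite -mulr_sumr sumrB; congr (_ * (_ - _)).
  - rewrite (bigD1 i)//= eqxx mul1r big1 ?addr0// => l /negbTE ->; exact: mul0r.
  - rewrite (bigD1 0)//= mul1r big1 ?addr0// => l /negbTE ->; exact: mul0r.
have scale (a D : R) : `|h z - h w - N^-1 * a| <= N^-1 * D -> `|N * (h z - h w) - a| <= D.
  have -> : N * (h z - h w) - a = N * (h z - h w - N^-1 * a).
    by field; rewrite gt_eqF.
  by rewrite normrM gtr0_norm// -ler_pdivlMl.
have [near_c|] := pselect (forall j, `|N^-1 * c 0 j - y 0 j| < del / 2).
  apply: (@le_trans _ _ (3 * e1)); last first.
    rewrite lerDl mulr_ge0 ?sumr_ge0// => [|j _]; last exact: sqr_ge0.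
    by rewrite !divr_ge0 ?exprn_ge0 ?mulr_ge0// ltW.
  have cl l j : `|sc n (c + e_ l) 0 j - (N^-1 * c 0 j)| < del / 2.
    rewrite !mxE -/N mulrDr addrAC subrr add0r normrM gtr0_norm ?invr_gt0//.
    apply: le_lt_trans hn; rewrite ler_piMr ?invr_ge0 ?(ltW N0)//.
    by case: (_ && _); rewrite ?normr1 ?normr0.
  have near_s (t : R) l : 0 <= t <= 1 ->
      `|G l (t *: z + (1 - t) *: w) - G l y| <= e1.
    move=> t01; apply: hG => //; first exact: simplex_segment.
    move=> j; rewrite [del]splitr.
    apply: (le_lt_trans (ler_distD (N^-1 * c 0 j) _ _)); apply: ltrD => //.
    have E : (t *: z + (1 - t) *: w) 0 j = t * z 0 j + (1 - t) * w 0 j.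
      by rewrite [LHS]mxE [X in X + _]mxE [X in _ + X]mxE.
    have zj : `|z 0 j - N^-1 * c 0 j| < del / 2 := cl i j.
    have wj : `|w 0 j - N^-1 * c 0 j| < del / 2 := cl 0 j.
    rewrite E; move: t01 zj wj => /andP[t0 t1].
    move: (z 0 j) (w 0 j) (N^-1 * c 0 j) (del / 2) => Z W C D.
    move=> ZD WD; set m := Num.max `|Z - C| `|W - C|.
    have mD : m < D by rewrite gt_max ZD.
    have Zm : `|Z - C| <= m by rewrite le_max lexx.
    have Wm : `|W - C| <= m by rewrite le_max lexx orbT.
    apply: le_lt_trans mD; move: Zm Wm; rewrite !ler_norml.
    by move=> /andP[a1 a2] /andP[b1 b2]; apply/andP; split; nra.
  have main : `|N * (h z - h w) - (G i y - G 0 y)| <= 2 * e1.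
    apply: scale; apply: (mean_value hw hz) => t t01; rewrite lin -mulrBr normrM.
    rewrite gtr0_norm ?invr_gt0// ler_pM2l ?invr_gt0//.
    have := near_s t i t01; have := near_s t 0 t01.
    rewrite !ler_norml => /andP[a1 a2] /andP[b1 b2]; apply/andP; split; lra.
  have wy : `|G 0 w - G 0 y| <= e1.
    by have := near_s 0 0; rewrite scale0r add0r subr0 scale1r; apply; rewrite lexx ler01.
  move: main wy; rewrite !ler_norml => /andP[a1 a2] /andP[b1 b2]; apply/andP; split; lra.
move=> /existsNP[j /negP]; rewrite -leNgt => far.
have main : `|N * (h z - h w) - 0| <= 2 * M.
  apply: scale; rewrite mulr0; apply: (mean_value hw hz) => t t01; rewrite lin subr0 normrM.
  rewrite gtr0_norm ?invr_gt0// ler_pM2l ?invr_gt0//.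
  have hs := simplex_segment hw hz t01.
  by rewrite (le_trans (ler_normB _ _))// mulr_natl mulr2n lerD ?GM.
apply: (@le_trans _ _ (4 * M)).
  have := GM 0 hw; have := GM i hy; move: main; rewrite subr0.
  rewrite !ler_norml => /andP[a1 a2] /andP[b1 b2] /andP[c1' c2]; apply/andP; split; lra.
apply: (@le_trans _ _ (16 * M / del ^+ 2 / N ^+ 2 * sumsq n y c)); last first.
  by rewrite lerDr mulr_ge0 ?ltW.
have -> : 4 * M = 16 * M / del ^+ 2 / N ^+ 2 * ((del / 2) ^+ 2 * N ^+ 2).
  by field; rewrite !gt_eqF.
rewrite ler_wpM2l ?divr_ge0 ?exprn_ge0 ?mulr_ge0 ?(ltW M0) ?(ltW del0) ?(ltW N0)//.
rewrite /sumsq (bigD1 j)//=; apply: (@le_trans _ _ ((c 0 j - N * y 0 j) ^+ 2)); last first.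
  by rewrite -/N lerDl sumr_ge0// => l _; exact: sqr_ge0.
have -> : (c 0 j - N * y 0 j) ^+ 2 = (N^-1 * c 0 j - y 0 j) ^+ 2 * N ^+ 2.
  by field; rewrite gt_eqF.
rewrite ler_wpM2r ?exprn_ge0 ?(ltW N0)// -[leRHS]real_normK ?num_real//.
by rewrite ler_pXn2r ?nnegrE// ltW// divr_gt0.
Qed.

Lemma simplex_C1_approx (e : R) : 0 < e -> exists g : V -> R, C1Rn g /\
  forall y, simplex y -> `|g y - h y| <= e /\ forall i, `|pderiv g i y - G i y| <= e.
Proof.
move=> e0.
(* For the gradient, [3 * (e / 6)] is one half of [e] and the Chebyshev term the other; [e1] makes
   the same split for the values. *)
have e60 : 0 < e / 6 by rewrite divr_gt0.
have [del del0 hdel] := Gunif e60.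
have Mk0 : 0 < M * k.+1%:R by rewrite mulr_gt0.
pose e1 := e / (2 * (M * k.+1%:R)).
have e10 : 0 < e1 by rewrite divr_gt0// mulr_gt0.
have small (A eta : R) : 0 < A -> 0 < eta -> exists j0, forall j, (j0 <= j)%N -> A * j.+1%:R^-1 < eta.
  move=> A0 eta0; have [j0 hj0] := inv_nat_small (divr_gt0 eta0 A0).
  by exists j0 => j /hj0; rewrite ltr_pdivlMr// mulrC.
have e20 : 0 < e / 2 by rewrite divr_gt0.
have [j1 hj1] := small (M * k.+1%:R / e1) (e / 2) (divr_gt0 Mk0 e10) e20.
have A2 : 0 < 16 * M * k.+1%:R / del ^+ 2 by rewrite divr_gt0 ?exprn_gt0// !mulr_gt0.
have [j2 hj2] := small _ _ A2 e20.
have [j3 hj3] := @inv_nat_small R (del / 2) (divr_gt0 del0 (ltr0Sn _ 1)).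
pose n := maxn j1 (maxn j2 j3).
exists (gn n); split; first exact: C1_gn.
move=> y hy; split.
  apply: (le_trans (gn_close n hy e10)).
  have := hj1 n (leq_maxl _ _).
  have -> : M * k.+1%:R * e1 = e / 2 by rewrite /e1; field; rewrite !gt_eqF.
  move: (_ * _^-1) => X; lra.
move=> i; have [_] := is_derive_gn n i y; rewrite /pderiv => ->.
apply: (le_trans (gn'_close i hy e60 del0 hdel (hj3 n _))).
  by rewrite /n leq_max leq_max leqnn !orbT.
have := hj2 n; rewrite /n leq_max leq_max leqnn orbT => /(_ isT).
move: (_ * _^-1) => X; lra.
Qed.

End simplex_approx.

(** * Functions of class C^1 on P_p *)

Section simplex_compact.
Variables (R : realType) (k : nat).

Lemma simplex_compact : compact (@simplex R k).
Proof.
pose A (i : 'I_k) := `[0, 1]%classic : set R.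
have cA : compact [set v : 'rV[R]_k | forall i, A i (v ord0 i)].
  by apply: rV_compact => i; exact: segment_compact.
have cs : continuous (fun y : 'rV[R]_k => \sum_i y 0 i : R).
  by apply: continuous_sum_fun => j; exact: coord_continuous.
have clS : closed ((fun y : 'rV[R]_k => \sum_i y 0 i : R) @^-1` [set 1]).
  by apply: closed_comp => [y _|]; [exact: cs|exact: closed_eq].
have -> : @simplex R k = [set v : 'rV[R]_k | forall i, A i (v ord0 i)] `&`
    ((fun y : 'rV[R]_k => \sum_i y 0 i : R) @^-1` [set 1]).
  apply/seteqP; split=> y /=.
    move=> [y0 y1]; split => // i; rewrite /A/= in_itv/= y0/= -y1 (bigD1 i)//= lerDl.
    by rewrite sumr_ge0// => j _; exact: y0.
  by move=> [h y1]; split => // i; have := h i; rewrite /A/= in_itv/= => /andP[].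
exact: compact_closedI.
Qed.

Lemma simplex_near (I : Type) (F : set_system I) (Q : I -> 'rV[R]_k -> Prop) : Filter F ->
  (forall y, simplex y -> exists2 del : R, 0 < del & \forall i \near F,
     forall z, simplex z -> (forall j, `|z 0 j - y 0 j| < del) -> Q i z) ->
  \forall i \near F, forall y, simplex y -> Q i y.
Proof.
move=> FF h; have /compact_near_coveringP cA := simplex_compact.
have := cA I F (fun i y => simplex y -> Q i y) FF.
have cov y : simplex y -> \forall y' \near y & i \near F, simplex y' -> Q i y'.
  move=> /h[del del0 hd].
  exists (ball y del, [set i | forall z, simplex z -> (forall j, `|z 0 j - y 0 j| < del) -> Q i z]) => /=.
    by split => //; exact: nbhsx_ballx.
  case=> y' i [/= bv hi] hy'; apply: hi => // j; rewrite distrC.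
  exact: (bv.2 ord0 j).
move=> /(_ cov); apply: filterS => i hi y hy; exact: hi.
Qed.

End simplex_compact.

(** * Local bounds, continuity, and transfer to the simplex *)

Section differentiable.
Variables (R : realType) (d : nat) (p : R).
Hypothesis hp : p = 0 \/ 1 <= p.
Local Notation Rd := (Rd R d).
Local Notation P := (probability Rd R).
Local Notation kn := (@kn R d).
Implicit Types (x : Rd) (mu nu : P).
Variables (f : P -> R) (Df : Rd -> P -> R).
Hypothesis fC1 : C1P p f Df.

(** The sets [B c] need not be open, but their interiors [U c] are, by [tn_near]. Monotonicity
    reduces a finite subcover to its largest index. *)
Lemma compact_tn_cover (K : set P) (B : nat -> set P) : Pcompact p K ->
  (forall m n, (m <= n)%N -> B m `<=` B n) ->
  (forall mu, K mu -> exists c, tn p mu (B c)) -> exists c, K `<=` B c.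
Proof.
move=> [Kp Kc] Bmono KB.
pose U c : set P := Pp p `&` [set nu | tn p nu (B c)].
have Uo c : Popen p (U c).
  split=> [nu []//|nu [nup nuB]]; apply/(PnbhdP hp _ nup).
  by apply: filterI; [exact: tn_Pp|exact: tn_near].
have [|s Ks] := Kc nat U Uo.
  by move=> mu Kmu; have [c hc] := KB _ Kmu; exists c => //; split => //; exact: Kp.
exists (\max_(i <- s) i)%N.
suff h : \big[setU/set0]_(i <- s) U i `<=` B (\max_(i <- s) i)%N by move=> mu /Ks /h.
elim: s {Ks} => [|i s ih]; first by rewrite big_nil.
rewrite !big_cons => mu [[mup hmu]|/ih].
  by apply: (Bmono i); [exact: leq_maxl|exact: tn_self hmu].
by apply: Bmono; exact: leq_maxr.
Qed.

Lemma Df_near x mu (e : R) : Pp p mu -> 0 < e -> exists2 del : R, 0 < del &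
  \forall nu \near tn p mu, forall y, dist y x < del -> `|Df y nu - Df x mu| < e.
Proof.
move=> mup e0; have [cDf _ _] := fC1.
have [del del0 [N [hN h]]] := cDf x mu mup e e0.
exists del => //; near=> nu => y yx; apply: h => //; first by near: nu; exact: tn_Pp.
by near: nu; apply/(PnbhdP hp _ mup).
Unshelve. all: by end_near. Qed.

Lemma Df_cont mu : Pp p mu -> cont_Rd (Df ^~ mu).
Proof.
move=> mup x e e0; have [del del0 h] := Df_near x mup e0.
by exists del => //; exact: (tn_self mup h).
Qed.

Lemma Df_locally_bounded mu : Pp p mu -> exists2 c : R, 0 < c &
  \forall nu \near tn p mu, forall x, `|Df x nu| <= c * wt p x.
Proof.
move=> mup; have [_ bDf _] := fC1.
apply: contrapT => hno.
have [B [tB hB]] := tn_countable hp mup.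
have /choice[nus hnus] : forall j, exists nu, [/\ Pp p nu, B j nu &
    exists x, j.+1%:R * wt p x < `|Df x nu|].
  move=> j; apply: contrapT => hn; apply: hno; exists j.+1%:R => //.
  near=> nu => x; rewrite leNgt; apply/negP => hx; apply: hn; exists nu; split.
  - by near: nu; exact: tn_Pp.
  - by near: nu; exact: tB.
  - by exists x.
have Kc : Pcompact p (mu |` range nus).
  split.
    by move=> _ [->//|[j _ <-]]; have [] := hnus j.
  move=> I U Uo cov.
  (* One open set around [mu] contains all terms from some [j0] on; each earlier term takes one more
     set. *)
  have [i0 _ Ui0] := cov mu (or_introl erefl).
  have /choice[ij hij] : forall j, exists i, U i (nus j).
    move=> j; have [i _ Ui] := cov (nus j) (or_intror (ex_intro2 _ _ j Logic.I erefl)).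
    by exists i.
  have [j0 hj0] := hB (U i0) (iffLR (PnbhdP hp _ mup) ((Uo i0).2 _ Ui0)).
  exists (i0 :: [seq ij j | j <- iota 0 j0]).
  move=> _ [->|[j _ <-]]; rewrite big_cons; first by left.
  have [jj|jj] := ltnP j j0; last first.
    by left; have [nup Bn _] := hnus j; exact: (hj0 j).
  by right; rewrite big_map -bigcup_seq; exists j; rewrite //= mem_iota.
have [c hc] := bDf _ Kc.
have [j hj] : exists j : nat, c < j.+1%:R.
  exists (Num.bound `|c|); rewrite (le_lt_trans (ler_norm _))//.
  by rewrite (lt_le_trans (archi_boundP (normr_ge0 _)))// ler_nat.
have [_ _ [x hx]] := hnus j.
have := hc x (nus j) (or_intror (ex_intro2 _ _ j Logic.I erefl)).
rewrite leNgt => /negP; apply; apply: le_lt_trans hx.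
by rewrite ler_pM2r ?wt_gt0// ltW.
Unshelve. all: by end_near. Qed.

Lemma adm_Df mu : Pp p mu -> adm p (Df ^~ mu).
Proof.
move=> mup; split; first exact: Df_cont.
by have [c _ h] := Df_locally_bounded mup; exists c; exact: (tn_self mup h).
Qed.

(* Measures are functions on all subsets, so two distinct ones may agree on
   the Borel sets. *)
Lemma Df_ext x mu nu : Pp p mu -> Pp p nu ->
  (forall phi, adm p phi -> mint nu phi = mint mu phi) -> Df x nu = Df x mu.
Proof.
move=> mup nup h; apply/eqP; rewrite -subr_eq0 -normr_eq0; apply: contraT => hne.
have e0 : 0 < `|Df x nu - Df x mu| by rewrite lt_def hne/=.
have [del del0 [k [phi [e [ap e0' hphi]]]]] := Df_near x mup e0.
have := hphi nu nup; rewrite /= => /(_ _ x); rewrite distxx ltxx => -> //.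
by move=> i; rewrite h// subrr normr0.
Qed.

Lemma f_mean_value mu nu (a D : R) : Pp p mu -> Pp p nu ->
  (forall t, 0 <= t <= 1 -> `|mint nu (Df ^~ (pmix t nu mu)) -
     mint mu (Df ^~ (pmix t nu mu)) - a| <= D) -> `|f nu - f mu - a| <= D.
Proof.
move=> mup nup h; have [_ _ ftc] := fC1.
exact: (unit_integral_norm_le (ftc _ _ mup nup) h).
Qed.

(** Along the whole segment from [mu] to [nu], [Df] is close to its value at [mu], uniformly on a
    ball and up to a tail outside. The increment of [f] is thus nearly the difference of integrals
    of the single test function [Df ^~ mu]. *)
Lemma f_continuous mu (e : R) : Pp p mu -> 0 < e ->
  \forall nu \near tn p mu, `|f nu - f mu| <= e.
Proof.
move=> mup e0; have [c c0 hc] := Df_locally_bounded mup.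
pose eta := e / (3 + 6 * c).
have eta0 : 0 < eta by rewrite divr_gt0// addr_gt0// mulr_gt0.
have [r hr] := tail_small hp mup eta0.
have hunif : \forall nu \near tn p mu, forall x, enorm x <= r%:R + 1 ->
    `|Df x nu - Df x mu| <= eta.
  apply: (@ball_near_covering _ _ _ _ (fun nu x => `|Df x nu - Df x mu| <= eta)) => x.
  have eta20 : 0 < eta / 2 by rewrite divr_gt0.
  have [del del0 hd] := Df_near x mup eta20.
  exists del => //; near=> nu => y yx.
  have h1 : `|Df y nu - Df x mu| < eta / 2 by move: y yx; near: nu; exact: hd.
  have h2 : `|Df y mu - Df x mu| < eta / 2 by exact: (tn_self mup hd).
  rewrite (le_trans (ler_distD (Df x mu) _ _))// [leRHS]splitr lerD// ?ltW//.
  by rewrite distrC.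
have hmix : \forall nu \near tn p mu, forall t, 0 <= t <= 1 ->
    forall x, `|Df x (pmix t nu mu) - Df x mu| <= eta + 2 * c * tail p r%:R x.
  have A : \forall nu \near tn p mu,
      forall x, `|Df x nu - Df x mu| <= eta + 2 * c * tail p r%:R x.
    near=> nu => x.
    have [xr|/ltW xr] := leP (enorm x) (r%:R + 1).
      rewrite (@le_trans _ _ eta)//; first by move: x xr; near: nu.
      by rewrite lerDl mulr_ge0 ?tail_ge0// mulr_ge0// ltW.
    rewrite /tail cut1// mulr1.
    have h1 : `|Df x nu| <= c * wt p x by move: x {xr}; near: nu; exact: hc.
    have h2 : `|Df x mu| <= c * wt p x by exact: (tn_self mup hc).
    rewrite (le_trans (ler_normB _ _))// (le_trans (lerD h1 h2))//.
    by rewrite -[leLHS]add0r lerD ?(ltW eta0)// -mulrA mulr_natl mulr2n.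
  exact: pmix_cvg A.
near=> nu; rewrite -[X in `|X|]subr0.
have nup : Pp p nu by near: nu; exact: tn_Pp.
have nut : `|mint nu (tail p r%:R) - mint mu (tail p r%:R)| < eta.
  by near: nu; apply: tn_mint => //; exact: adm_tail.
have nug : `|mint nu (Df ^~ mu) - mint mu (Df ^~ mu)| < eta.
  by near: nu; apply: tn_mint => //; exact: adm_Df.
have nm : forall t, 0 <= t <= 1 ->
    forall x, `|Df x (pmix t nu mu) - Df x mu| <= eta + 2 * c * tail p r%:R x.
  by near: nu; exact: hmix.
apply: (f_mean_value mup nup) => t t01; rewrite subr0.
have [mixp _] := pmix_mint hp t01 mup nup.
have am := adm_Df mixp; have a0 := adm_Df mup.
have dev (m : P) : Pp p m ->
    `|mint m (Df ^~ (pmix t nu mu)) - mint m (Df ^~ mu)| <= eta + 2 * c * mint m (tail p r%:R).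
  move=> mp; rewrite -(mintB hp)// -(mintZ hp)//; last exact: adm_tail.
  rewrite -[X in _ <= X + _](mint_cst m) -(mintD hp)//; last 2 first.
    exact: adm_cst.
    exact: admZ (adm_tail _ _).
  apply: (mint_norm_le hp) => //.
  - exact: admB.
  - by apply: admD; [exact: adm_cst|exact: admZ (adm_tail _ _)].
  - by move=> x; exact: nm.
have d1 := dev _ nup; have d2 := dev _ mup.
have t2 := hr r (leqnn _).
have t1 : mint nu (tail p r%:R) <= 2 * eta.
  move: nut t2; rewrite ltr_norml => /andP[_]; move: (mint nu _) (mint mu _) => A B; lra.
have h1 : 2 * c * mint nu (tail p r%:R) <= 2 * c * (2 * eta) by rewrite ler_pM2l// mulr_gt0.
have h2 : 2 * c * mint mu (tail p r%:R) <= 2 * c * eta by rewrite ler_pM2l ?mulr_gt0// ltW.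
have E : e = (3 + 6 * c) * eta.
  by rewrite /eta mulrC divfK// gt_eqF// addr_gt0// mulr_gt0.
rewrite E; move: d1 d2 nug h1 h2.
move: (mint nu (Df ^~ _)) (mint mu (Df ^~ _)) => X1 X2.
move: (2 * c * mint nu _) (2 * c * mint mu _) => Y1 Y2.
move: (mint nu _) (mint mu _) => X3 X4.
rewrite ltr_norml !ler_norml => /andP[a1 a2] /andP[b1 b2] /andP[c1 c2] y1 y2.
apply/andP; split; nra.
Unshelve. all: by end_near. Qed.

Section level.
Variable n : nat.
Local Notation V := 'rV[R]_(kn n).+1.
Local Notation dsc := (disc hp (@pt R d n)).
Let G (i : 'I_(kn n).+1) (y : V) : R := Df (pt i) (dsc y).

(** Integrals against [disc] are linear in the weights, with coefficients that [S] bounds for all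
    test functions at once. *)
Lemma disc_near (y : V) N : simplex y -> tn p (dsc y) N -> exists2 del : R, 0 < del &
  forall z, simplex z -> (forall j, `|z 0 j - y 0 j| < del) -> N (dsc z).
Proof.
move=> hy [k [phi [e [ap e0 hN]]]].
pose S := 1 + \sum_l \sum_i `|phi l (pt (i : 'I_(kn n).+1))|.
have S1 : 0 <= \sum_l \sum_i `|phi l (pt (i : 'I_(kn n).+1))|.
  by apply: sumr_ge0 => l _; exact: sumr_ge0.
have S0 : 0 < S by rewrite ltr_wpDr.
exists (e / S); first by rewrite divr_gt0.
move=> z hz zy; have [zp zE] := discP hp (@pt R d n) hz; have [yp yE] := discP hp (@pt R d n) hy.
apply: hN => // l; rewrite zE// yE// -sumrB.
apply: (@le_lt_trans _ _ (\sum_i e / S * `|phi l (pt (i : 'I_(kn n).+1))|)).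
  apply: (le_trans (ler_norm_sum _ _ _)); apply: ler_sum => i _.
  by rewrite -mulrBl normrM ler_wpM2r// ltW.
rewrite -mulr_sumr -mulrA gtr_pMr// mulrC ltr_pdivrMr// mul1r.
rewrite (@le_lt_trans _ _ (\sum_l \sum_i `|phi l (pt (i : 'I_(kn n).+1))|))//.
  rewrite [leRHS](bigD1 l)//= lerDl; apply: sumr_ge0 => l' _; exact: sumr_ge0.
by rewrite /S ltrDr.
Qed.

Let G_near (i : 'I_(kn n).+1) (y : V) (e : R) : simplex y -> 0 < e ->
  exists2 del : R, 0 < del & forall z, simplex z -> (forall j, `|z 0 j - y 0 j| < del) ->
    `|G i z - G i y| < e.
Proof.
move=> hy e0; have [yp _] := discP hp (@pt R d n) hy.
have [del0 del00 h] := Df_near (pt i) yp e0.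
apply: (disc_near (N := [set nu | `|Df (pt i) nu - Df (pt i) (dsc y)| < e]) hy).
by apply: filterS h => nu; apply; rewrite distxx.
Qed.

Lemma level_bounded : exists2 M : R, 0 < M & forall y, simplex y ->
  `|f (dsc y)| <= M /\ forall i, `|G i y| <= M.
Proof.
have : \forall m \near \oo, forall y, simplex y -> `|f (dsc y)| <= m%:R.
  apply: (@simplex_near _ _ _ _ (fun m y => `|f (dsc y)| <= m%:R)) => y hy.
  have [yp _] := discP hp (@pt R d n) hy.
  have [del del0 h] := disc_near hy (f_continuous yp ltr01).
  exists del => //; near=> m => z hz zy.
  have := h z hz zy; rewrite /= => hzy.
  have : `|f (dsc z)| <= 1 + `|f (dsc y)|.
    by rewrite -[f (dsc z)](subrK (f (dsc y))) (le_trans (ler_normD _ _))// lerD2r.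
  move=> /le_trans; apply; near: m; exact: nbhs_infty_ger.
move=> [m1 _ hm1].
have hG : forall i, exists m, forall y, simplex y -> `|G i y| <= m%:R.
  move=> i; have : \forall m \near \oo, forall y, simplex y -> `|G i y| <= m%:R.
    apply: (@simplex_near _ _ _ _ (fun m y => `|G i y| <= m%:R)) => y hy.
    have [del del0 h] := G_near i hy ltr01.
    exists del => //; near=> m => z hz zy.
    have /ltW hzy := h z hz zy.
    have : `|G i z| <= 1 + `|G i y|.
      by rewrite -[G i z](subrK (G i y)) (le_trans (ler_normD _ _))// lerD2r.
    move=> /le_trans; apply; near: m; exact: nbhs_infty_ger.
  by move=> [m _ hm]; exists m; apply: hm => /=.
have /choice[m2 hm2] := hG.
exists (m1 + \max_i m2 i).+1%:R => // y hy; split.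
  rewrite (le_trans (hm1 m1 (leqnn _) y hy))// ler_nat.
  by rewrite (leq_trans (leq_addr _ _) (leqnSn _)).
move=> i; rewrite (le_trans (hm2 i y hy))// ler_nat.
by rewrite (leq_trans (leq_bigmax i))// (leq_trans (leq_addl _ _) (leqnSn _)).
Unshelve. all: by end_near. Qed.

Let G_unif (e : R) : 0 < e -> exists2 del : R, 0 < del &
  forall i y z, simplex y -> simplex z -> (forall j, `|y 0 j - z 0 j| < del) ->
    `|G i y - G i z| <= e.
Proof.
move=> e0.
have e20 : 0 < e / 2 by rewrite divr_gt0.
have hi i : \forall del \near (0 : R)^'+, forall y, simplex y -> forall z, simplex z ->
    (forall j, `|y 0 j - z 0 j| < del) -> `|G i y - G i z| <= e.
  apply: (@simplex_near _ _ _ _ (fun del y => forall z, simplex z ->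
    (forall j, `|y 0 j - z 0 j| < del) -> `|G i y - G i z| <= e)) => y hy.
  have [del del0 h] := G_near i hy e20.
  exists (del / 2); first by rewrite divr_gt0.
  near=> t => y' hy' yy' z hz zy'.
  have zd j : `|z 0 j - y 0 j| < del.
    rewrite (le_lt_trans (ler_distD (y' 0 j) _ _))// [ltRHS]splitr ltrD//.
    rewrite distrC (lt_le_trans (zy' j))//; near: t; apply: nbhs_right_le.
    by rewrite divr_gt0.
  have yd j : `|y' 0 j - y 0 j| < del.
    by rewrite (lt_le_trans (yy' j))// ler_pdivrMr// ler_pMr// ler1n.
  have /ltW h1 := h z hz zd; have /ltW h2 := h y' hy' yd.
  by rewrite (le_trans (ler_distD (G i y) _ _))// [leRHS]splitr lerD// distrC.
have hall : \forall del \near (0 : R)^'+, forall i y, simplex y -> forall z, simplex z ->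
    (forall j, `|y 0 j - z 0 j| < del) -> `|G i y - G i z| <= e.
  exact: filter_forall hi.
have /filter_ex[del [h del0]] : \forall del \near (0 : R)^'+,
    (forall i y, simplex y -> forall z, simplex z ->
    (forall j, `|y 0 j - z 0 j| < del) -> `|G i y - G i z| <= e) /\ 0 < del.
  by apply: filterI; [exact: hall|exact: nbhs_right_gt].
by exists del => // i y z hy hz; exact: h.
Unshelve. all: by end_near. Qed.

Let mean_value (y z : V) : simplex y -> simplex z -> forall a D : R,
  (forall t, 0 <= t <= 1 ->
     `|\sum_i (z 0 i - y 0 i) * G i (t *: z + (1 - t) *: y) - a| <= D) ->
  `|f (dsc z) - f (dsc y) - a| <= D.
Proof.
move=> hy hz a D h.
have [yp yE] := discP hp (@pt R d n) hy; have [zp zE] := discP hp (@pt R d n) hz.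
apply: (f_mean_value yp zp) => t t01.
have [mp mE] := pmix_mint hp t01 yp zp.
have hw := simplex_segment hy hz t01.
have [wp wE] := discP hp (@pt R d n) hw.
(* The mixture of two discrete measures and the discrete measure with mixed weights have the same
   integrals of test functions, which is what [Df_ext] asks for. *)
have DE x : Df x (pmix t (dsc z) (dsc y)) = Df x (dsc (t *: z + (1 - t) *: y)).
  apply: Df_ext => // phi ap; rewrite mE// wE// zE// yE// !mulr_sumr -big_split/=.
  by apply: eq_bigr => i _; rewrite !mxE; ring.
rewrite zE ?yE; try exact: adm_Df.
rewrite -sumrB; have := h t t01; congr (_ <= _); congr `|_ - _|.
by apply: eq_bigr => i _; rewrite /G DE mulrBl.
Qed.

Lemma level_approx (e : R) : 0 < e -> exists g : V -> R, C1Rn g /\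
  forall y, simplex y -> `|g y - f (dsc y)| <= e /\
    forall i, `|pderiv g i y - Df (pt i) (dsc y)| <= e.
Proof.
move=> e0; have [M M0 hM] := level_bounded.
exact: (simplex_C1_approx M0 (fun i y hy => (hM y hy).2 i) G_unif mean_value e0).
Qed.

End level.

End differentiable.

(** * Assembly of the cylinder functions *)

Theorem theorem4p4 (R : realType) (d : nat) (p : R) (hp : p = 0 \/ 1 <= p)
  (f : probability (Rd R d) R -> R) (Df : Rd R d -> probability (Rd R d) R -> R) :
  C1P p f Df ->
  exists (k : nat -> nat) (g : forall n, 'rV[R]_(k n) -> R)
         (phi : forall n, 'I_(k n) -> Rd R d -> R),
    [/\ forall n, C1Rn (g n),
        forall n i, bcont (phi n i),
        forall mu, Pp p mu -> cyl (g n) (phi n) mu @[n --> \oo] --> f mu,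
        forall (x : Rd R d) mu, Pp p mu ->
          cylD (g n) (phi n) x mu @[n --> \oo] --> Df x mu &
        forall K, Pcompact p K -> exists c : R, forall n (x : Rd R d) mu, K mu ->
          `|cyl (g n) (phi n) mu| <= c /\
          `|cylD (g n) (phi n) x mu| <= c * (1 + npow p x)].
Proof.
move=> fC1.
pose gP n (g : 'rV[R]_(kn d n).+1 -> R) := C1Rn g /\
  forall y, simplex y -> `|g y - f (disc hp (@pt R d n) y)| <= n.+1%:R^-1 /\
    forall i, `|pderiv g i y - Df (pt i) (disc hp (@pt R d n) y)| <= n.+1%:R^-1.
have ex_g n : exists g, gP n g by apply: (level_approx hp fC1); rewrite invr_gt0.
pose g n := sval (cid (ex_g n)).
have gE n : gP n (g n) := svalP (cid (ex_g n)).
pose phi n : 'I_(kn d n).+1 -> Rd R d -> R := @ph R d n.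
have cyl_close n mu : Pp p mu -> `|cyl (g n) (phi n) mu - f (Tn hp n mu)| <= n.+1%:R^-1.
  by move=> mup; have [_ /(_ _ (cf_simplex hp n mup))[]] := gE n.
(* The weights [ph i x] sum to 1, so the uniform error on the partial derivatives is not multiplied
   by the number of cells. *)
have cylD_close n x mu : Pp p mu ->
    `|cylD (g n) (phi n) x mu - \sum_i ph i x * Df (@pt R d n i) (Tn hp n mu)| <= n.+1%:R^-1.
  move=> mup; have [_ /(_ _ (cf_simplex hp n mup))[_ h]] := gE n.
  rewrite /cylD -sumrB.
  have -> : \sum_i (pderiv (g n) i (\row_j mint mu (phi n j)) * phi n i x -
      ph i x * Df (pt i) (Tn hp n mu)) =
    \sum_i ph i x * (pderiv (g n) i (cf n mu) - Df (@pt R d n i) (Tn hp n mu)).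
    by apply: eq_bigr => i _; rewrite mulrBr [X in X - _]mulrC.
  apply: (le_trans (ler_norm_sum _ _ _)).
  under eq_bigr do rewrite normrM (ger0_norm (ph_ge0 _ _)).
  by apply: ph_avg_le => i _; exact: h.
exists (fun n => (kn d n).+1), g, phi; split.
- by move=> n; have [] := gE n.
- by move=> n i; exact: ph_bcont.
- move=> mu mup; apply/cvgrPdist_le => e e0.
  have e20 : 0 < e / 2 by rewrite divr_gt0.
  have [n0 h0] := Tn_cvg hp mup (f_continuous hp fC1 mup e20).
  have {}h0 := tn_self mup h0.
  have [n1 h1] := inv_nat_small e20.
  near=> n; rewrite distrC.
  apply: (le_trans (ler_distD (f (Tn hp n mu)) _ _)); rewrite [leRHS]splitr lerD//.
    rewrite (le_trans (cyl_close n mu mup))// ltW// h1//.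
    by near: n; exact: nbhs_infty_ge.
  by apply: h0; near: n; exact: nbhs_infty_ge.
- move=> x mu mup; apply/cvgrPdist_le => e e0.
  have e20 : 0 < e / 2 by rewrite divr_gt0.
  have [del del0 hdel] := Df_near hp fC1 x mup e20.
  have [n0 h0] := Tn_cvg hp mup hdel.
  have {}h0 := tn_self mup h0.
  have [n1 h1] := inv_nat_small e20.
  have [n2 h2] := inv_nat_small del0.
  near=> n; rewrite distrC.
  apply: (le_trans (ler_distD (\sum_i ph i x * Df (@pt R d n i) (Tn hp n mu)) _ _)).
  rewrite [leRHS]splitr lerD//.
    rewrite (le_trans (cylD_close n x mu mup))// ltW// h1//.
    by near: n; exact: nbhs_infty_ge.
  have -> : \sum_i ph i x * Df (@pt R d n i) (Tn hp n mu) - Df x mu =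
      \sum_i ph i x * (Df (@pt R d n i) (Tn hp n mu) - Df x mu).
    under [RHS]eq_bigr do rewrite mulrBr.
    by rewrite sumrB -mulr_suml ph_sum mul1r.
  apply: (le_trans (ler_norm_sum _ _ _)).
  under eq_bigr do rewrite normrM (ger0_norm (ph_ge0 _ _)).
  (* Only cells containing [x] contribute, and for large [n] their points [pt i] are within [del] of
     [x]. *)
  apply: ph_avg_le => i hi; apply/ltW; apply: h0.
    by near: n; exact: nbhs_infty_ge.
  rewrite distC (lt_trans (ph_close hi _))//; first by near: n; exact: nbhs_infty_ger.
  by apply: h2; near: n; exact: nbhs_infty_ge.
- move=> K Kc.
  (* [c] is both the bound and the level from which it holds, which makes the family increasing as
     [compact_tn_cover] requires. *)
  pose B (c : nat) : set (probability (Rd R d) R) := [set nu | forall n, (c <= n)%N ->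
    `|f (Tn hp n nu)| <= c%:R /\ forall x, `|Df x (Tn hp n nu)| <= c%:R * wt p x].
  have [m n mn nu Bnu l nl|mu Kmu|c0 hc0] := @compact_tn_cover R d p hp K B Kc.
  + have [h1 h2] := Bnu l (leq_trans mn nl); split.
      by rewrite (le_trans h1)// ler_nat.
    by move=> x; rewrite (le_trans (h2 x))// ler_pM2r ?wt_gt0// ler_nat.
  + have mup : Pp p mu by exact: Kc.1.
    have [c c_gt0 hc] := Df_locally_bounded hp fC1 mup.
    have hf := f_continuous hp fC1 mup ltr01.
    have [n0 h0] := Tn_cvg hp mup (filterI hc hf).
    have [c1 hc1] : exists c1 : nat, c <= c1%:R /\ 1 + `|f mu| <= c1%:R.
      exists (Num.bound (c + (1 + `|f mu|))).
      have f0 : 0 <= 1 + `|f mu| by rewrite addr_ge0.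
      have := archi_boundP (addr_ge0 (ltW c_gt0) f0).
      move: f0 c_gt0; move: (1 + `|f mu|) (_%:R) => A C; split; lra.
    exists (maxn n0 c1); apply: filterS h0 => nu hnu n; rewrite geq_max => /andP[n0n c1n].
    have c1m : c1%:R <= (maxn n0 c1)%:R :> R by rewrite ler_nat leq_maxr.
    have [h1 h2] := hnu n n0n; split.
      apply: le_trans c1m; apply: le_trans hc1.2.
      by rewrite -[f _](subrK (f mu)) (le_trans (ler_normD _ _))// lerD2r.
    move=> x; rewrite (le_trans (h1 x))// ler_pM2r ?wt_gt0//.
    exact: le_trans hc1.1 c1m.
  (* The cover says nothing about the finitely many levels below [c0]; each is bounded over its
     whole simplex, independently of [K]. *)
  have /choice[M hM] : forall n, exists M : R, 0 < M /\
      forall y : 'rV[R]_(kn d n).+1, simplex y -> `|f (disc hp (@pt R d n) y)| <= M /\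
        forall i, `|Df (@pt R d n i) (disc hp (@pt R d n) y)| <= M.
    by move=> n; have [M M0 h] := level_bounded hp fC1 n; exists M.
  set q := 2 * 2 `^ p; have q1 : 1 <= q.
    have : 1 <= 2 `^ p :> R by rewrite -[leLHS](powRr0 2) ler_powR ?ler1n// (hp_ge0 hp).
    by rewrite /q; move: (2 `^ p) => A; lra.
  (* The 1 covers the approximation error, [q] the passage from the weight at [pt i] to the weight
     at [x], and the sum the levels below [c0]. *)
  pose c : R := 1 + (c0%:R * q + \sum_(i < c0) M i).
  have S0 : 0 <= \sum_(i < c0) M i by apply: sumr_ge0 => i _; rewrite ltW//; have [] := hM i.
  have cq0 : 0 <= c0%:R * q by rewrite mulr_ge0// (le_trans ler01).
  exists c => n x mu Kmu.
  have mup : Pp p mu by exact: Kc.1.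
  have inv1 : n.+1%:R^-1 <= 1 :> R by rewrite invf_le1// ler1n.
  have fb : `|f (Tn hp n mu)| <= c0%:R * q + \sum_(i < c0) M i.
    have [c0n|nc0] := leqP c0 n.
      have [h _] := hc0 mu Kmu n c0n; rewrite (le_trans h)//.
      by rewrite (@le_trans _ _ (c0%:R * q))// ?lerDl// ler_peMr.
    have [_ /(_ _ (cf_simplex hp n mup))[h _]] := hM n.
    rewrite (le_trans h)// (@le_trans _ _ (\sum_(i < c0) M i))// ?lerDr//.
    rewrite (bigD1 (Ordinal nc0))//= lerDl; apply: sumr_ge0 => i _.
    by rewrite ltW//; have [] := hM i.
  have Db : `|\sum_i ph i x * Df (@pt R d n i) (Tn hp n mu)| <=
      (c0%:R * q + \sum_(i < c0) M i) * wt p x.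
    apply: (le_trans (ler_norm_sum _ _ _)).
    under eq_bigr do rewrite normrM (ger0_norm (ph_ge0 _ _)).
    apply: ph_avg_le => i hi; have [c0n|nc0] := leqP c0 n.
      have [_ h] := hc0 mu Kmu n c0n; rewrite (le_trans (h _))//.
      rewrite mulrDl (@le_trans _ _ (c0%:R * q * wt p x))//.
        by rewrite -mulrA ler_wpM2l// (wt_shift hp)// (ph_pt hi).
      by rewrite lerDl mulr_ge0// ltW// wt_gt0.
    have [_ /(_ _ (cf_simplex hp n mup))[_ h]] := hM n.
    rewrite (le_trans (h i))// (@le_trans _ _ (\sum_(i < c0) M i))//.
      rewrite (bigD1 (Ordinal nc0))//= lerDl; apply: sumr_ge0 => j _.
      by rewrite ltW//; have [] := hM j.
    rewrite (@le_trans _ _ (c0%:R * q + \sum_(i < c0) M i))// ?lerDr//.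
    by rewrite ler_peMr ?wt_ge1// addr_ge0.
  split.
    rewrite -[cyl _ _ _](subrK (f (Tn hp n mu))) (le_trans (ler_normD _ _))// lerD//.
    exact: le_trans (cyl_close n mu mup) inv1.
  rewrite -[1 + _]/(wt p x).
  rewrite -[cylD _ _ _ _](subrK (\sum_i ph i x * Df (@pt R d n i) (Tn hp n mu))).
  rewrite (le_trans (ler_normD _ _))// /c mulrDl lerD// mul1r.
  by rewrite (le_trans (cylD_close n x mu mup))// (le_trans inv1)// wt_ge1.
Unshelve. all: by end_near. Qed.
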